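(* Consider the deconvolution model of the context with $\theta_1,\dots,\theta_n$ i.i.d. with pdf $f$; let $s\ge0$, $B>0$, and let $\varphi$ be uniformly bounded, $|\varphi(\theta)|\le\|\varphi\|_\infty<\infty$. Suppose that $g$ is bounded above and that there are constants $C_{g2}>0$, $C_{\varphi1}>0$ and non-negative $\alpha,\beta,\gamma,a,b,d$ (with $\alpha>0$ and $\beta=0$ whenever $\gamma=0$, and $b=0$ whenever $d=0$) such that for all $\omega\in\mathbb R$ $$|g^*(\omega)|\le C_{g2}(\omega^2+1)^{-\alpha/2}e^{-\gamma|\omega|^\beta},\qquad|\varphi^*(\omega)|\ge C_{\varphi1}(\omega^2+1)^{-a/2}e^{-d|\omega|^b}.$$ Suppose $g^*$ is differentiable and, for some $C_g>0$ and $\tau\ge0$ with $\tau=0$ if $\gamma=0$, $|(g^* )'(\omega)|/|g^*(\omega)|\le C_g(1+|\omega|)^\tau$. Suppose there exists $\omega_0\in(0,\infty)$ such that for $|\omega|>\omega_0$ the function $\rho(\omega)=\arg(\varphi^*(\omega))$ is twice continuously differentiable with $|\rho^{(j)}(\omega)|\le\rho<\infty$, $j=0,1,2$. Let $\Phi_n=\frac1n\sum_{i=1}^n\varphi(\theta_i)$. Then, for sufficiently large $n$, $$\inf_{\widetilde\Phi_n}\sup_{f\in\Omega_s(B)}\mathbb E(\widetilde\Phi_n-\Phi_n)^2\ge C\,r_n,$$ where the infimum is over all estimators $\widetilde\Phi_n$ based on $Y_1,\dots,Y_n$, $C>0$ is a constant independent of $n$, and $$r_n=\begin{cases} n^{-1}&\text{if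 } b>\beta\ \text{ or }\ b=\beta,\ d>\gamma>0,\\ n^{-1}&\text{if } b=\beta,\ d=\gamma,\ a\ge\alpha+1/2,\\ n^{-1}&\text{if } b=\beta>0,\ d=\gamma>0,\ a<\alpha+1/2,\\ n^{-\frac{2s+2a-1}{2s+2\alpha}}&\text{if } d=\gamma=0,\ a<\alpha+1/2,\\ (\log n)^{-U_3/\beta}\,n^{-d/\gamma}&\text{if } b=\beta,\ \gamma\ge d>0,\\ (\log n)^{-U_4/\beta}\exp\!\Big(-2d\big[\tfrac{\log n}{2\gamma}\big]^{b/\beta}\Big)&\text{if } b<\beta,\ d>0,\ \gamma>0,\\ (\log n)^{-\frac{2s+2a-1}{\beta}}&\text{if } b=d=0,\ \beta>0,\ \gamma>0, \end{cases}$$ with $U_3=2a+2s(1-d/\gamma)-2d\alpha/\gamma+8\beta-(U_\tau+1)d/\gamma-1$, $U_4=2a+2s+8b-1$, $U_\tau=\min(7\beta-2\tau-1,\ 5\beta+1)$ (the bound holding in each case that applies).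
   Context: Model: $Y_i=\theta_i+\xi_i$, $i=1,\dots,n$, where $\theta_i$ are i.i.d. with unknown pdf $f$, $\xi_i$ are i.i.d. with known pdf $g$, and the $\theta$'s and $\xi$'s are independent. For a function $t$, $t^*(\omega)=\int_{-\infty}^\infty e^{i\omega x}t(x)\,dx$. $\varphi$ is a known real function with Fourier transform $\varphi^*$, and it is assumed that $\int\varphi f=\frac1{2\pi}\int_{-\infty}^\infty f^*(\omega)\varphi^*(-\omega)\,d\omega$ with an absolutely convergent integral. $\Omega_s(B)$ is the set of pdfs $f$ with $\int|f^*(\omega)|^2(\omega^2+1)^s\,d\omega\le B^2$. In cases where $\beta$ appears in a denominator, $\beta>0$ is understood. *)

(* Defs.v *)
From HB Require Import structures.
From mathcomp Require Import all_boot all_order all_algebra.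
From mathcomp Require Import complex.
From mathcomp Require Import all_classical all_reals all_analysis.

Set Implicit Arguments.
Unset Strict Implicit.
Unset Printing Implicit Defensive.

Import Order.TTheory GRing.Theory Num.Theory.
Import numFieldNormedType.Exports.

Local Open Scope classical_set_scope.
Local Open Scope ring_scope.
Local Open Scope complex_scope.

Section fourier.
Context {R : realType}.
Local Notation mu := (@lebesgue_measure R).
Local Notation re := (@complex.Re R).
Local Notation im := (@complex.Im R).
Implicit Types (t : R -> R) (F : R -> R[i]).

Definition cmod (z : R[i]) : R := ComplexField.Normc.normc z.

Definition expi (x : R) : R[i] := cos x +i* sin x.

Definition cintegral (D : set R) F : R[i] :=
  Complex (\int[mu]_(x in D) re (F x))
          (\int[mu]_(x in D) im (F x)).

Definition cderivable F (w : R) : Prop :=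
  derivable (re \o F) w 1 /\ derivable (im \o F) w 1.

Definition cderive F (w : R) : R[i] :=
  Complex ((re \o F)^`()%classic w) ((im \o F)^`()%classic w).

Definition fourier t (w : R) : R[i] :=
  cintegral setT (fun x => expi (w * x) * (t x)%:C).

(* Transform of a bounded function that need not be integrable: the integral
   over the line is the limit of the integrals over [-A, A].  For an integrable
   t this says that T is [fourier t]. *)
Definition is_fourier t (T : R -> R[i]) : Prop := forall w : R,
  let I (A : R) :=
    cintegral `[- A, A] (fun x => expi (w * x) * (t x)%:C) in
  re (I A) @[A --> +oo] --> re (T w) /\
  im (I A) @[A --> +oo] --> im (T w).

Definition is_pdf t : Prop :=
  [/\ measurable_fun setT t, forall x, 0 <= t x
    & (\int[mu]_x (t x)%:E = 1)%E].

Definition sobolev_pdf (s B : R) : set (R -> R) :=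
  [set f | is_pdf f /\
    (\int[mu]_w (cmod (fourier f w) ^+ 2 * (w ^+ 2 + 1) `^ s)%:E
       <= (B ^+ 2)%:E)%E].

Definition parseval (phi : R -> R) (phis : R -> R[i]) (f : R -> R) : Prop :=
  mu.-integrable setT
    (EFin \o (fun w => cmod (fourier f w * phis (- w)))) /\
  (\int[mu]_x (phi x * f x))%:C =
    ((2 * pi)^-1)%:C *
      cintegral setT (fun w => fourier f w * phis (- w)).

(* [rho] is a determination of arg F on |w| > w0, twice continuously
   differentiable and bounded by M there together with rho' and rho''. *)
Definition bounded_C2_arg F (w0 : R) (rho : R -> R) (M : R) : Prop :=
  forall w, w0 < `|w| ->
  [/\ F w = (cmod (F w))%:C * expi (rho w),
      derivable rho w 1,
      derivable rho^`()%classic w 1,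
      {for w, continuous rho^`(2)%classic}
    & forall j : nat, (j <= 2)%N -> `|rho^`(j)%classic w| <= M].

End fourier.

Section model.
Context {R : realType}.
Local Notation mu := (@lebesgue_measure R).

Definition has_pdf (dO : measure_display) (O : measurableType dO)
    (P : probability O R) (X : {RV P >-> R}) (f : R -> R) : Prop :=
  forall A : set R, measurable A ->
    (distribution P X A = \int[mu]_(x in A) (f x)%:E)%E.

(* Taking A k = setT outside a subfamily gives the product rule for it. *)
Definition mutually_independent (dO : measure_display) (O : measurableType dO)
    (P : probability O R) (I : finType) (X : I -> {RV P >-> R}) : Prop :=
  forall A : I -> set R, (forall k, measurable (A k)) ->
    P (\bigcap_(k in [set: I]) (X k @^-1` A k)) =
    (\prod_(k : I) fine (P (X k @^-1` A k)))%:E.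

Definition deconvolution_model (dO : measure_display) (O : measurableType dO)
    (P : probability O R) (n : nat) (f g : R -> R)
    (theta xi : 'I_n -> {RV P >-> R}) : Prop :=
  [/\ forall i, has_pdf (theta i) f,
      forall i, has_pdf (xi i) g
    & mutually_independent
        (fun k : ('I_n + 'I_n)%type =>
           match k with inl i => theta i | inr i => xi i end)].

Definition observations (O : Type) (n : nat) (theta xi : 'I_n -> O -> R)
    (o : O) : n.-tuple R := [tuple theta i o + xi i o | i < n].

Definition empirical_functional (O : Type) (n : nat) (phi : R -> R)
    (theta : 'I_n -> O -> R) (o : O) : R :=
  n%:R^-1 * \sum_(i < n) phi (theta i o).

(* The values of E (T(Y_1, .., Y_n) - Phi_n)^2 over all realizations of the
   model with theta-density f.  The expectation depends only on the joint law
   of the theta's and xi's, which f and g determine, so this is a singleton. *)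
Definition mse (n : nat) (phi f g : R -> R) (T : n.-tuple R -> R) :
    set (\bar R) :=
  [set r | exists (dO : measure_display) (O : measurableType dO)
      (P : probability O R) (theta xi : 'I_n -> {RV P >-> R}),
    deconvolution_model f g theta xi /\
    r = 'E_P[fun o => ((T (observations theta xi o)
                        - empirical_functional phi theta o) ^+ 2)%R]%E].

Definition minimax_risk (n : nat) (F : set (R -> R)) (phi g : R -> R) :
    \bar R :=
  ereal_inf [set ereal_sup (\bigcup_(f in F) mse phi f g T)
            | T in [set T : n.-tuple R -> R | measurable_fun setT T]].

Definition U_tau (beta tau : R) : R :=
  Num.min (7 * beta - 2 * tau - 1) (5 * beta + 1).

Definition U3 (s alpha beta gamma a d tau : R) : R :=
  2 * a + 2 * s * (1 - d / gamma) - 2 * d * alpha / gamma + 8 * beta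
  - (U_tau beta tau + 1) * d / gamma - 1.

Definition U4 (s a b : R) : R := 2 * a + 2 * s + 8 * b - 1.

(* The cases overlap, so the rate is a relation. *)
Inductive rate (s alpha beta gamma a b d tau : R) : (nat -> R) -> Prop :=
| rate_smooth of beta < b \/ [/\ b = beta, gamma < d & 0 < gamma] :
    rate s alpha beta gamma a b d tau (fun n => n%:R^-1)
| rate_equal_large of [/\ b = beta, d = gamma & alpha + 2^-1 <= a] :
    rate s alpha beta gamma a b d tau (fun n => n%:R^-1)
| rate_equal_small of
    [/\ b = beta, 0 < beta, d = gamma, 0 < gamma & a < alpha + 2^-1] :
    rate s alpha beta gamma a b d tau (fun n => n%:R^-1)
| rate_polynomial of [/\ d = gamma, gamma = 0 & a < alpha + 2^-1] :
    rate s alpha beta gamma a b d tau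
      (fun n => n%:R `^ (- ((2 * s + 2 * a - 1) / (2 * s + 2 * alpha))))
| rate_equal_exponential of [/\ b = beta, 0 < beta, d <= gamma & 0 < d] :
    rate s alpha beta gamma a b d tau
      (fun n => ln n%:R `^ (- (U3 s alpha beta gamma a d tau / beta))
                * n%:R `^ (- (d / gamma)))
| rate_lower_exponential of [/\ b < beta, 0 < d & 0 < gamma] :
    rate s alpha beta gamma a b d tau
      (fun n => ln n%:R `^ (- (U4 s a b / beta))
                * expR (- 2 * d * (ln n%:R / (2 * gamma)) `^ (b / beta)))
| rate_logarithmic of [/\ b = 0, d = 0, 0 < beta & 0 < gamma] :
    rate s alpha beta gamma a b d tau
      (fun n => ln n%:R `^ (- ((2 * s + 2 * a - 1) / beta))).

End model.

(* Main.v *)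
Require Import Defs.
From HB Require Import structures.
From mathcomp Require Import all_boot all_order all_algebra.
From mathcomp Require Import complex.
From mathcomp Require Import all_classical all_reals all_analysis.
From mathcomp Require Import measurable_realfun.
From mathcomp Require Import ring lra.
Import Order.TTheory GRing.Theory Num.Theory.
Import numFieldNormedType.Exports.
Local Open Scope classical_set_scope.
Local Open Scope ring_scope.
Set Implicit Arguments.
Unset Strict Implicit.
Unset Printing Implicit Defensive.

(* The bound C / n: fix a positive Cauchy density f in the class, a shift dl such
   that g and g(. - dl) overlap, and D = phi - phi(. + dl). The statistic
     u(th, xi) = D(th) f(th + dl) g(xi - dl) - D(th - dl) f(th - dl) g(xi + dl)
   integrates to 0 against every function of Y = th + xi, because the shift
   (th, xi) -> (th + dl, xi - dl) preserves Y and exchanges its two terms, whereas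
   its covariance with phi(th) is positive unless phi is dl-periodic. A periodic
   phi is excluded by phi^*(0) <> 0.

   The nonparametric bound: f_0 and f_1 are mixtures of a fixed Cauchy density
   with |k| and |k| + k, smoothed by a Cauchy kernel of scale 1/m. Here the
   transform of k is a bump on [m, m + m^(1-b)] modulated by the phase of phi^*,
   so that positivity is automatic and Parseval bounds the gap in the functional
   from below. The transform of (f_1 - f_0) * g and its derivative are as small
   as g^* near m, hence the chi-square distance of the two laws of Y is at most
   1/n once n m^E exp(-2 gamma m^beta) is bounded, where
   E = 2 max(tau, b - 1) - (2 s + 7 b) - 2 alpha. The squared gap is of order
   m^(-U4) exp(-2 d m^b), and each rate corresponds to one choice of m. *)

(** * Integrals of real functions *)

(** The target Phi_n is random, so a two-point argument on the mean of phi loses a variance term of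
    order 1/n; the parametric bound pays for it, and therefore enters every rate. The chi-square
    distance divides by the density of Y under f_0. The fixed Cauchy component keeps that density
    above a multiple of 1/(1 + y^2), so the distance is controlled by an L^2 norm with weight 1 +
    y^2, that is, by the transform and its derivative: this is where the derivative of g^* enters.
    Since f_1 <= 2 f_0, the likelihood ratio is at most 2, and with estimators clamped to [-M, M]
    all risks are integrals of bounded functions. Complex transforms are replaced by real cosine
    integrals with a phase; the phases 0 and pi/2 give the real and the imaginary part. The Cauchy
    kernel of scale 1/m multiplies transforms by exp(-|w|/m), which stays above exp(-2) on the
    window and costs only m^(2 s) in the Sobolev norm. The 7 b is more than the Sobolev constraint
    asks for; it is the power for which the gap and the distance give exactly U4 and U3. *)

Section integrable_real.
Context d (T : measurableType d) (R : realType).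
Variable mu : {measure set T -> \bar R}.
Implicit Types f g h : T -> R.

Definition Rintegrable f := mu.-integrable setT (EFin \o f).

Lemma Rintegrable_measurable f : Rintegrable f -> measurable_fun setT f.
Proof. by move=> /integrableP[/measurable_EFinP]. Qed.

Lemma le_Rintegrable f g : measurable_fun setT f ->
  (forall x, `|f x| <= g x) -> Rintegrable g -> Rintegrable f.
Proof.
move=> mf fg; apply: le_integrable => //; first exact/measurable_EFinP.
by move=> x _ /=; rewrite lee_fin (le_trans (fg x))// ler_norm.
Qed.

Lemma RintegrableM f h M : Rintegrable f -> measurable_fun setT h ->
  (forall x, `|h x| <= M) -> Rintegrable (fun x => f x * h x).
Proof.
move=> intf mh hM; apply: (@le_Rintegrable _ (fun x => M * `|f x|)).
- by apply: measurable_funM => //; exact: Rintegrable_measurable.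
- by move=> x; rewrite normrM mulrC ler_wpM2r.
- have := integrableZl measurableT M (integrable_norm intf).
  by apply: eq_integrable.
Qed.

Lemma RintegrableMl f h M : Rintegrable f -> measurable_fun setT h ->
  (forall x, `|h x| <= M) -> Rintegrable (fun x => h x * f x).
Proof.
move=> intf mh hM; have := RintegrableM intf mh hM.
by apply: eq_integrable => // x _ /=; rewrite mulrC.
Qed.

Lemma RintegrableZ f c : Rintegrable f -> Rintegrable (fun x => c * f x).
Proof. by move=> /(integrableZl measurableT c); apply: eq_integrable. Qed.

Lemma RintegrableD f g : Rintegrable f -> Rintegrable g ->
  Rintegrable (fun x => f x + g x).
Proof. by move=> /integrableD; apply. Qed.

Lemma RintegrableN f : Rintegrable f -> Rintegrable (fun x => - f x).
Proof. by move=> /integrableN; apply: eq_integrable. Qed.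

Lemma RintegrableB f g : Rintegrable f -> Rintegrable g ->
  Rintegrable (fun x => f x - g x).
Proof. by move=> intf /RintegrableN; exact: RintegrableD. Qed.

Lemma Rintegrable_abs f : Rintegrable f -> Rintegrable (fun x => `|f x|).
Proof. exact: integrable_norm. Qed.

Lemma ge0_Rintegrable f : measurable_fun setT f -> (forall x, 0 <= f x) ->
  (\int[mu]_x (f x)%:E < +oo)%E -> Rintegrable f.
Proof.
move=> mf f0 foo; apply/integrableP; split; first exact/measurable_EFinP.
by under eq_integral do rewrite /= ger0_norm//.
Qed.

Lemma RintegralE f : Rintegrable f ->
  (\int[mu]_x (f x)%:E = (\int[mu]_x f x)%:E)%E.
Proof. by move=> intf; rewrite /Rintegral fineK// integrable_fin_num. Qed.

Lemma RintegralE_eq f c : (\int[mu]_x (f x)%:E = c%:E)%E ->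
  \int[mu]_x f x = c.
Proof. by rewrite /Rintegral => ->. Qed.

Lemma normr_Rintegral_le f g : Rintegrable f -> Rintegrable g ->
  (forall x, `|f x| <= g x) -> `|\int[mu]_x f x| <= \int[mu]_x g x.
Proof.
move=> intf intg fg; apply: (le_trans (le_normr_Rintegral measurableT intf)).
by apply: le_Rintegral => // ; exact: Rintegrable_abs.
Qed.

Lemma RintegralM_le f h M : Rintegrable f -> measurable_fun setT h ->
  (forall x, `|h x| <= M) ->
  `|\int[mu]_x (f x * h x)| <= M * \int[mu]_x `|f x|.
Proof.
move=> intf mh hM; rewrite -RintegralZl//; last exact: Rintegrable_abs.
apply: normr_Rintegral_le; first exact: RintegrableM hM.
  exact/RintegrableZ/Rintegrable_abs.
by move=> x; rewrite normrM mulrC ler_wpM2r.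
Qed.

End integrable_real.

(** * Fubini for two integrable factors and a bounded kernel *)

Section fubini_real.
Context d1 d2 (T1 : measurableType d1) (T2 : measurableType d2) (R : realType).
Variables (m1 : {sigma_finite_measure set T1 -> \bar R})
          (m2 : {sigma_finite_measure set T2 -> \bar R}).
Variables (a : T1 -> R) (b : T2 -> R) (c : T1 * T2 -> R) (M : R).
Hypotheses (ia : Rintegrable m1 a) (ib : Rintegrable m2 b)
  (mc : measurable_fun setT c) (cM : forall z, `|c z| <= M).

Let F (z : T1 * T2) := a z.1 * (b z.2 * c z).

Let mF : measurable_fun setT F.
Proof.
have ma := Rintegrable_measurable ia; have mb := Rintegrable_measurable ib.
apply: measurable_funM; first exact: measurableT_comp.
by apply: measurable_funM => //; exact: measurableT_comp.
Qed.

Let msec1 x : measurable_fun setT (fun y => c (x, y)).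
Proof. exact: measurableT_comp. Qed.

Let msec2 y : measurable_fun setT (fun x => c (x, y)).
Proof. exact: measurableT_comp. Qed.

Lemma Rintegrable_prod : Rintegrable (m1 \x m2)%E F.
Proof.
apply: (@le_Rintegrable _ _ _ _ _ (fun z => `|a z.1| * (`|b z.2| * M))) => //.
  by move=> z; rewrite !normrM; apply: ler_wpM2l => //; exact: ler_wpM2l.
have ma := Rintegrable_measurable ia; have mb := Rintegrable_measurable ib.
have M0 : 0 <= M by apply: le_trans (cM (point, point)).
have mna : measurable_fun setT (fun x => `|a x|) by exact: measurableT_comp.
have mnb : measurable_fun setT (fun x => `|b x|) by exact: measurableT_comp.
have mab : measurable_fun setT (fun z => `|a z.1| * (`|b z.2| * M)).
  apply: measurable_funM; first exact: measurableT_comp mna measurable_fst.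
  by apply: measurable_funM => //; exact: measurableT_comp mnb measurable_snd.
apply: ge0_Rintegrable => //.
- by move=> z; rewrite !mulr_ge0.
rewrite fubini_tonelli1//=; last 2 first.
- exact/measurable_EFinP.
- by move=> z; rewrite lee_fin !mulr_ge0.
rewrite /fubini_F/=.
have E x : (\int[m2]_y (`|a x| * (`|b y| * M))%:E =
    (`|a x| * (M * \int[m2]_y `|b y|))%:E)%E.
  have ib' := Rintegrable_abs ib.
  rewrite -RintegralZl// -RintegralZl//; last exact: RintegrableZ.
  rewrite -RintegralE; last exact/RintegrableZ/RintegrableZ.
  by apply: eq_integral => y _; rewrite (mulrC M).
under eq_integral do rewrite E.
rewrite RintegralE ?ltry//.
have := RintegrableZ (M * \int[m2]_y `|b y|) (Rintegrable_abs ia).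
by apply: eq_integrable => // x _ /=; rewrite mulrC.
Qed.

Let inner1 x : Rintegrable m2 (fun y => b y * c (x, y)).
Proof. exact: (RintegrableM ib (msec1 x) (fun y => cM (x, y))). Qed.

Let inner2 y : Rintegrable m1 (fun x => a x * c (x, y)).
Proof. exact: (RintegrableM ia (msec2 y) (fun x => cM (x, y))). Qed.

Let FE x : (\int[m2]_y (F (x, y))%:E)%E = (a x * \int[m2]_y (b y * c (x, y)))%:E.
Proof. by rewrite EFinM -(RintegralE (inner1 x)) -integralZl//; exact: inner1. Qed.

Let GE y : (\int[m1]_x (F (x, y))%:E)%E = (b y * \int[m1]_x (a x * c (x, y)))%:E.
Proof.
rewrite EFinM -(RintegralE (inner2 y)) -integralZl//; last exact: inner2.
by apply: eq_integral => x _ /=; rewrite /F/= -!EFinM mulrCA.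
Qed.

Lemma Rintegrable_fubini1 :
  Rintegrable m1 (fun x => a x * \int[m2]_y (b y * c (x, y))).
Proof.
have := integrable_fubini_F Rintegrable_prod.
by apply: eq_integrable => // x _; rewrite /fubini_F FE.
Qed.

Lemma Rintegral_prod1 : \int[(m1 \x m2)%E]_z (a z.1 * (b z.2 * c z)) =
  \int[m1]_x (a x * \int[m2]_y (b y * c (x, y))).
Proof.
rewrite /Rintegral -(integral12_prod_meas1 Rintegrable_prod).
by congr fine; apply: eq_integral => x _; exact: FE.
Qed.

Lemma Rintegral_prod2 : \int[(m1 \x m2)%E]_z (a z.1 * (b z.2 * c z)) =
  \int[m2]_y (b y * \int[m1]_x (a x * c (x, y))).
Proof.
rewrite /Rintegral -(integral21_prod_meas1 Rintegrable_prod).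
by congr fine; apply: eq_integral => x _; exact: GE.
Qed.

(** The form in which integrals are exchanged later: [c] is typically a cosine of a product, bounded
    but integrable in neither variable, and integrability comes from [a] and [b] alone. *)
Lemma Rintegral_swap : \int[m1]_x (a x * \int[m2]_y (b y * c (x, y))) =
  \int[m2]_y (b y * \int[m1]_x (a x * c (x, y))).
Proof. by rewrite -Rintegral_prod1 Rintegral_prod2. Qed.

End fubini_real.

(** * Translations and reflections of the line *)

Section lebesgue_translation.
Context (R : realType).
Local Notation mu := (@lebesgue_measure R).
Implicit Types (f : R -> R) (c : R).

Let shiftm (c : R) : measurableTypeR R -> measurableTypeR R := fun x => x + c.

Let mshift c : measurable_fun setT (shiftm c).
Proof. exact: measurable_funD. Qed.

Let lebesgue_measureD (c : R) (A : set R) : measurable A ->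
  pushforward mu (shiftm c) A = mu A.
Proof.
move=> mA; apply/esym/lebesgue_measure_unique => //= _ [[a b]] _ <-.
rewrite /pushforward.
have -> : shiftm c @^-1` `]a, b]%classic = `]a - c, b - c]%classic.
  by apply/seteqP; split => x /=; rewrite !in_itv/= /shiftm ltrBlDr lerBrDr.
rewrite !lebesgue_measure_itv/= !lte_fin ltrD2r; case: ifP => // _.
by rewrite -!EFinB opprB addrA subrK.
Qed.

Lemma ge0_integral_shift (f : R -> \bar R) c : measurable_fun setT f ->
  (forall x, 0 <= f x)%E -> (\int[mu]_x f (x + c)%R = \int[mu]_x f x)%E.
Proof.
move=> mf f0; rewrite -[LHS](@ge0_integral_pushforward _ _ _ _ _ (shiftm c) (mshift c) mu setT)//.
by apply: eq_measure_integral => A mA _; exact: lebesgue_measureD.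
Qed.

Let oppm : measurableTypeR R -> measurableTypeR R := fun x => - x.

Lemma ge0_integral_opp (f : R -> \bar R) : measurable_fun setT f ->
  (forall x, 0 <= f x)%E -> (\int[mu]_x f (- x)%R = \int[mu]_x f x)%E.
Proof.
move=> mf f0.
have mopp : measurable_fun setT oppm by exact: oppr_measurable.
rewrite -[LHS](@ge0_integral_pushforward _ _ _ _ _ oppm mopp mu setT)//.
by apply: eq_measure_integral => A mA _; exact: lebesgue_measureN.
Qed.

Lemma measurable_shift f c : measurable_fun setT f ->
  measurable_fun setT (fun x : R => f (x + c)).
Proof. by move=> mf; apply: (measurableT_comp mf); exact: measurable_funD. Qed.

Lemma measurable_opp f : measurable_fun setT f ->
  measurable_fun setT (fun x : R => f (- x)).
Proof. by move=> mf; apply: (measurableT_comp mf); exact: oppr_measurable. Qed.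

Lemma Rintegrable_shift f c : Rintegrable mu f ->
  Rintegrable mu (fun x => f (x + c)).
Proof.
move=> /integrableP[mf foo]; apply/integrableP; split.
  apply/measurable_EFinP; apply: measurable_shift; exact/measurable_EFinP.
rewrite (@ge0_integral_shift (fun x => `|(f x)%:E|)%E)//.
exact: measurableT_comp.
Qed.

Lemma Rintegrable_opp f : Rintegrable mu f -> Rintegrable mu (fun x => f (- x)).
Proof.
move=> /integrableP[mf foo]; apply/integrableP; split.
  apply/measurable_EFinP; apply: measurable_opp; exact/measurable_EFinP.
rewrite (@ge0_integral_opp (fun x => `|(f x)%:E|)%E)//.
exact: measurableT_comp.
Qed.

(** Positive and negative parts are translated separately, so measurability suffices and the
    identity can be used before integrability is known. *)
Lemma Rintegral_shift f c : measurable_fun setT f ->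
  \int[mu]_x f (x + c) = \int[mu]_x f x.
Proof.
move=> mf; rewrite /Rintegral; congr fine; rewrite integralE [RHS]integralE.
have mf' : measurable_fun setT (EFin \o f) by exact/measurable_EFinP.
congr (_ - _)%E.
- rewrite -(@ge0_integral_shift (EFin \o f)^\+%E c); [by rewrite funepos.unlock|exact: measurable_funepos|by []].
- rewrite -(@ge0_integral_shift (EFin \o f)^\-%E c); [by rewrite funeneg.unlock|exact: measurable_funeneg|by []].
Qed.

Lemma Rintegral_opp f : measurable_fun setT f ->
  \int[mu]_x f (- x) = \int[mu]_x f x.
Proof.
move=> mf; rewrite /Rintegral; congr fine; rewrite integralE [RHS]integralE.
have mf' : measurable_fun setT (EFin \o f) by exact/measurable_EFinP.
congr (_ - _)%E.
- rewrite -(@ge0_integral_opp (EFin \o f)^\+%E); [by rewrite funepos.unlock|exact: measurable_funepos|by []].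
- rewrite -(@ge0_integral_opp (EFin \o f)^\-%E); [by rewrite funeneg.unlock|exact: measurable_funeneg|by []].
Qed.

End lebesgue_translation.

(** * Product laws *)

Section bounded_integrals.
Context d (T : measurableType d) (R : realType) (P : probability T R).
Implicit Types h f g : T -> R.

Definition bounded_by (M : R) h := forall x, `|h x| <= M.

Lemma prob_Rintegrable h M : measurable_fun setT h -> bounded_by M h ->
  Rintegrable P h.
Proof.
move=> mh hM.
have i1 : Rintegrable P (cst 1) by exact: finite_measure_integrable_cst.
have := RintegrableMl i1 mh hM.
by apply: eq_integrable => // x _ /=; rewrite mulr1.
Qed.

Lemma Rintegral_cst1 c : \int[P]_x c = c.
Proof. by rewrite Rintegral_cst//= probability_setT/= mulr1. Qed.

Lemma Rintegral_prob_bound h M : measurable_fun setT h -> bounded_by M h ->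
  `|\int[P]_x h x| <= M.
Proof.
move=> mh hM; rewrite -[leRHS]Rintegral_cst1; apply: normr_Rintegral_le => //.
  exact: prob_Rintegrable hM.
exact: finite_measure_integrable_cst.
Qed.

End bounded_integrals.

(** * Fubini for bounded functions on probability spaces *)

Section fubini_prob.
Context d1 d2 (T1 : measurableType d1) (T2 : measurableType d2) (R : realType).
Variables (P1 : probability T1 R) (P2 : probability T2 R).
Variables (c : T1 * T2 -> R) (M : R).
Hypotheses (mc : measurable_fun setT c) (cM : forall z, `|c z| <= M).

Let i1 : Rintegrable P1 (cst 1). Proof. exact: finite_measure_integrable_cst. Qed.
Let i2 : Rintegrable P2 (cst 1). Proof. exact: finite_measure_integrable_cst. Qed.

Lemma Rintegral_prob_prod1 : \int[(P1 \x P2)%E]_z c z =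
  \int[P1]_x \int[P2]_y c (x, y).
Proof.
have := Rintegral_prod1 i1 i2 mc cM; rewrite /cst/= => E.
transitivity (\int[(P1 \x P2)%E]_z (1 * (1 * c z))).
  by apply: eq_Rintegral => z _; rewrite !mul1r.
rewrite E.
by apply: eq_Rintegral => x _; rewrite mul1r; apply: eq_Rintegral => y _; rewrite mul1r.
Qed.

Lemma Rintegral_prob_prod2 : \int[(P1 \x P2)%E]_z c z =
  \int[P2]_y \int[P1]_x c (x, y).
Proof.
rewrite Rintegral_prob_prod1.
have := Rintegral_swap i1 i2 mc cM; rewrite /cst/= => E.
transitivity (\int[P1]_x (1 * \int[P2]_y (1 * c (x, y)))).
  by apply: eq_Rintegral => x _; rewrite mul1r; apply: eq_Rintegral => y _; rewrite mul1r.
rewrite E.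
by apply: eq_Rintegral => x _; rewrite mul1r; apply: eq_Rintegral => y _; rewrite mul1r.
Qed.

Lemma measurable_Rintegral1 : measurable_fun setT (fun x => \int[P2]_y c (x, y)).
Proof.
have := Rintegrable_fubini1 i1 i2 mc cM => /Rintegrable_measurable.
apply: eq_measurable_fun => x _; rewrite /cst mul1r.
by apply: eq_Rintegral => y _; rewrite mul1r.
Qed.

End fubini_prob.

(** * Independent samples *)

Section tuple_power.
Context d (T : measurableType d) (R : realType).
Implicit Types P : probability T R.

Definition cons_tup n (z : T * n.-tuple T) : n.+1.-tuple T :=
  [tuple of z.1 :: z.2].

Lemma measurable_cons_tup n : measurable_fun setT (@cons_tup n).
Proof. exact: measurable_cons. Qed.

HB.instance Definition _ n :=
  isMeasurableFun.Build _ _ _ _ (@cons_tup n) (@measurable_cons_tup n).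

(** The n-fold product law, as the image of a product with one more factor under [cons_tup].
    Integrating the first coordinate outermost ([tuple_powerS1]) or innermost ([tuple_powerS2]) then
    drives every induction on n. *)
Fixpoint tuple_power P n : probability (n.-tuple T) R :=
  match n with
  | 0%N => \d_([tuple] : 0.-tuple T)
  | n'.+1 => distribution (P \x tuple_power P n')%E (@cons_tup n')
  end.

Local Notation "P ^^ n" := (tuple_power P n) (at level 30).

Section recursion.
Variables (P : probability T R) (n : nat) (h : n.+1.-tuple T -> R) (M : R).
Hypotheses (mh : measurable_fun setT h) (hM : bounded_by M h).

Let mhc : measurable_fun setT (h \o @cons_tup n).
Proof. exact: measurableT_comp. Qed.

Let tpE : \int[P ^^ n.+1]_t h t = \int[(P \x (P ^^ n))%E]_z h (cons_tup z).
Proof.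
rewrite /Rintegral /= /distribution integral_pushforward//.
  exact/measurable_EFinP.
rewrite preimage_setT.
exact: (@prob_Rintegrable _ _ _ (P \x (P ^^ n))%E (h \o @cons_tup n) M mhc (fun z => hM _)).
Qed.

Lemma tuple_powerS1 : \int[P ^^ n.+1]_t h t =
  \int[P]_z \int[P ^^ n]_t h (cons_tup (z, t)).
Proof. by rewrite tpE (Rintegral_prob_prod1 _ _ mhc (fun z => hM _)). Qed.

Lemma tuple_powerS2 : \int[P ^^ n.+1]_t h t =
  \int[P ^^ n]_t \int[P]_z h (cons_tup (z, t)).
Proof. by rewrite tpE (Rintegral_prob_prod2 _ _ mhc (fun z => hM _)). Qed.

End recursion.

Lemma tuple_power0 P (h : 0.-tuple T -> R) : measurable_fun setT h ->
  \int[P ^^ 0]_t h t = h [tuple].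
Proof.
move=> mh; rewrite /Rintegral /= integral_dirac//; last exact/measurable_EFinP.
by rewrite diracT mul1e.
Qed.

Lemma tnth_cons_tup0 n (z : T) (t : n.-tuple T) : tnth (cons_tup (z, t)) ord0 = z.
Proof. by []. Qed.

Lemma tnth_cons_tupS n (z : T) (t : n.-tuple T) i :
  tnth (cons_tup (z, t)) (lift ord0 i) = tnth t i.
Proof. by rewrite tnthS. Qed.

Lemma measurable_prod_tnth n (F : 'I_n -> T -> R) :
  (forall i, measurable_fun setT (F i)) ->
  measurable_fun setT (fun t : n.-tuple T => \prod_(i < n) F i (tnth t i)).
Proof.
move=> mF; apply: measurable_prod => i _.
by apply: measurableT_comp => //; exact: measurable_tnth.
Qed.

Lemma measurable_sum_tnth n (F : T -> R) : measurable_fun setT F ->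
  measurable_fun setT (fun t : n.-tuple T => \sum_(i < n) F (tnth t i)).
Proof.
move=> mF; apply: measurable_sum => i.
by apply: measurableT_comp => //; exact: measurable_tnth.
Qed.

Lemma prod_tnth_bound n (F : 'I_n -> T -> R) M :
  (forall i, bounded_by M (F i)) ->
  bounded_by (M ^+ n) (fun t : n.-tuple T => \prod_(i < n) F i (tnth t i)).
Proof.
move=> FM t; rewrite normr_prod; apply: (@le_trans _ _ (\prod_(i < n) M)).
  by apply: ler_prod => i _; rewrite normr_ge0 FM.
by rewrite prodr_const card_ord.
Qed.

Lemma sum_tnth_bound n (F : T -> R) M : bounded_by M F ->
  bounded_by (n%:R * M) (fun t : n.-tuple T => \sum_(i < n) F (tnth t i)).
Proof.
move=> FM t; apply: (le_trans (ler_norm_sum _ _ _)).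
apply: (@le_trans _ _ (\sum_(i < n) M)); first exact: ler_sum.
by rewrite sumr_const card_ord mulr_natl.
Qed.

Lemma tuple_power_prod P n (F : 'I_n -> T -> R) M :
  (forall i, measurable_fun setT (F i)) -> (forall i, bounded_by M (F i)) ->
  \int[P ^^ n]_t (\prod_(i < n) F i (tnth t i)) = \prod_(i < n) \int[P]_z F i z.
Proof.
elim: n F => [|n IH] F mF FM.
  by rewrite tuple_power0 ?big_ord0//; exact: measurable_prod_tnth.
rewrite (tuple_powerS1 P (measurable_prod_tnth mF) (prod_tnth_bound FM)).
rewrite big_ord_recl -(IH (fun i => F (lift ord0 i)))//.
rewrite -RintegralZr//; last exact: prob_Rintegrable (FM _).
apply: eq_Rintegral => z _.
rewrite -RintegralZl//; last first.
  apply: prob_Rintegrable (measurable_prod_tnth (fun i => mF (lift ord0 i))) _.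
  exact: (prod_tnth_bound (fun i => FM (lift ord0 i))).
apply: eq_Rintegral => t _; rewrite big_ord_recl tnth_cons_tup0.
by congr (_ * _); apply: eq_bigr => i _; rewrite tnth_cons_tupS.
Qed.

Lemma tuple_power_sum P n (F : T -> R) M :
  measurable_fun setT F -> bounded_by M F -> \int[P]_z F z = 0 ->
  \int[P ^^ n]_t (\sum_(i < n) F (tnth t i)) = 0.
Proof.
move=> mF FM F0; elim: n => [|n IH].
  by rewrite tuple_power0 ?big_ord0//; exact: measurable_sum_tnth.
rewrite (tuple_powerS1 P (measurable_sum_tnth mF) (sum_tnth_bound FM)).
rewrite -[RHS]F0; apply: eq_Rintegral => z _.
under eq_Rintegral => t _.
  rewrite big_ord_recl tnth_cons_tup0.
  under eq_bigr do rewrite tnth_cons_tupS.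
  over.
rewrite RintegralD//; last 2 first.
- exact: finite_measure_integrable_cst.
- apply: prob_Rintegrable; first exact: measurable_sum_tnth.
  exact: sum_tnth_bound FM.
by rewrite IH Rintegral_cst1 addr0.
Qed.

Lemma bounded_byM d' (T' : measurableType d') (f g : T' -> R) M N :
  bounded_by M f -> bounded_by N g -> bounded_by (M * N) (fun x => f x * g x).
Proof. by move=> fM gN x; rewrite normrM ler_pM. Qed.

(** Covariances of independent centred terms vanish off the diagonal. In the induction step the
    product of the two sums is expanded at the first coordinate, and both cross terms vanish by
    [tuple_power_sum]. *)
Lemma tuple_power_cov P n (F G : T -> R) M N :
  measurable_fun setT F -> bounded_by M F -> \int[P]_z F z = 0 ->
  measurable_fun setT G -> bounded_by N G -> \int[P]_z G z = 0 ->
  \int[P ^^ n]_t ((\sum_(i < n) F (tnth t i)) * (\sum_(i < n) G (tnth t i))) =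
  n%:R * \int[P]_z (F z * G z).
Proof.
move=> mF FM F0 mG GN G0; elim: n => [|n IH].
  rewrite tuple_power0 ?big_ord0 ?mul0r//.
  by apply: measurable_funM; exact: measurable_sum_tnth.
have mS k := @measurable_sum_tnth k _ mF; have mS' k := @measurable_sum_tnth k _ mG.
have bS k := @sum_tnth_bound k _ _ FM; have bS' k := @sum_tnth_bound k _ _ GN.
have iF := prob_Rintegrable P mF FM.
have iG := prob_Rintegrable P mG GN.
have iFG : Rintegrable P (fun z => F z * G z) := RintegrableM iF mG GN.
have iS := prob_Rintegrable (P ^^ n) (mS n) (bS n).
have iS' := prob_Rintegrable (P ^^ n) (mS' n) (bS' n).
have iSS' := RintegrableM iS (mS' n) (bS' n).
rewrite (tuple_powerS1 P (measurable_funM (mS _) (mS' _)) (bounded_byM (bS _) (bS' _))).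
transitivity (\int[P]_z (F z * G z + n%:R * \int[P]_z (F z * G z))); last first.
  rewrite RintegralD//; last exact: finite_measure_integrable_cst.
  by rewrite Rintegral_cst1 -[n.+1]addn1 natrD mulrDl mul1r addrC.
apply: eq_Rintegral => z _; rewrite -IH.
transitivity (\int[P ^^ n]_t ((F z * G z + F z * \sum_(i < n) G (tnth t i)) +
   (G z * (\sum_(i < n) F (tnth t i)) + (\sum_(i < n) F (tnth t i)) * (\sum_(i < n) G (tnth t i))))).
  apply: eq_Rintegral => t _ /=; rewrite !big_ord_recl !tnth_cons_tup0.
  have -> : \sum_(i < n) F (tnth (cons_tup (z, t)) (lift ord0 i)) =
    \sum_(i < n) F (tnth t i) by apply: eq_bigr => i _; rewrite tnth_cons_tupS.
  have -> : \sum_(i < n) G (tnth (cons_tup (z, t)) (lift ord0 i)) =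
    \sum_(i < n) G (tnth t i) by apply: eq_bigr => i _; rewrite tnth_cons_tupS.
  ring.
have ic c : Rintegrable (P ^^ n) (fun=> c) by exact: finite_measure_integrable_cst.
rewrite RintegralD//; last 2 first.
- exact: RintegrableD (ic _) (RintegrableZ _ iS').
- exact: RintegrableD (RintegrableZ _ iS) iSS'.
rewrite RintegralD//; [|exact: ic|exact: RintegrableZ].
rewrite RintegralD//; last exact: RintegrableZ.
rewrite Rintegral_cst1 !RintegralZl//.
by rewrite (tuple_power_sum n mF FM F0) (tuple_power_sum n mG GN G0) !mulr0 addr0 add0r.
Qed.

End tuple_power.

(** * Statistics of transformed samples *)

Section tuple_map.
Context d d' (T : measurableType d) (T' : measurableType d') (R : realType).
Variables (y : T -> T') (my : measurable_fun setT y).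

Lemma measurable_map_tuple n : measurable_fun setT (@map_tuple n _ _ y).
Proof.
apply/measurable_fun_tnthP => i.
rewrite (_ : _ \o _ = fun t => y (tnth t i)); last first.
  by apply/funext => t /=; rewrite tnth_map.
by apply: measurableT_comp => //; exact: measurable_tnth.
Qed.

Lemma map_cons_tup n z (t : n.-tuple T) :
  map_tuple y (cons_tup (z, t)) = cons_tup (y z, map_tuple y t).
Proof. exact: val_inj. Qed.

Lemma measurable_cons_tupl n (z : T') :
  measurable_fun setT (fun t : n.-tuple T' => cons_tup (z, t)).
Proof. exact: (@measurable_cons _ _ _ _ (fun=> z) _ id). Qed.

Lemma measurable_cons_tupr n (t : n.-tuple T') :
  measurable_fun setT (fun z : T' => cons_tup (z, t)).
Proof. exact: (@measurable_cons _ _ _ _ id _ (fun=> t)). Qed.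

(** With all coordinates but one frozen, [h] is a bounded function of the value of [y] at that
    coordinate, and such functions are orthogonal to [u]. *)
Lemma tuple_power_orth (P : probability T R) (u : T -> R) N n
    (h : n.-tuple T' -> R) M :
  measurable_fun setT u -> bounded_by N u ->
  (forall k K, measurable_fun setT k -> bounded_by K k ->
    \int[P]_z (k (y z) * u z) = 0) ->
  measurable_fun setT h -> bounded_by M h ->
  \int[tuple_power P n]_t (h (map_tuple y t) * \sum_(i < n) u (tnth t i)) = 0.
Proof.
move=> mu uN u0; elim: n h => [|n IH] h mh hM.
  rewrite tuple_power0 ?big_ord0 ?mulr0//.
  by apply: measurable_funM; [exact: measurableT_comp mh (@measurable_map_tuple _)|exact: measurable_sum_tnth].
have mS k := @measurable_sum_tnth _ _ _ k _ mu.
have bS k := @sum_tnth_bound _ _ _ k _ _ uN.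
pose H (t : n.+1.-tuple T) := h (map_tuple y t).
have mH : measurable_fun setT H := measurableT_comp mh (@measurable_map_tuple _).
have HM : bounded_by M H by move=> t; exact: hM.
pose A (t : n.+1.-tuple T) := H t * u (thead t).
pose B (t : n.+1.-tuple T) := H t * \sum_(i < n) u (tnth t (lift ord0 i)).
have mA : measurable_fun setT A.
  by apply: measurable_funM => //; apply: measurableT_comp => //; exact: measurable_tnth.
have mB : measurable_fun setT B.
  apply: measurable_funM => //; apply: measurable_sum => i.
  by apply: measurableT_comp => //; exact: measurable_tnth.
have bA : bounded_by (M * N) A.
  by move=> t; rewrite normrM ler_pM//; exact: HM.
have bB : bounded_by (M * (n%:R * N)) B.
  move=> t; rewrite normrM; apply: ler_pM => //.
  apply: (le_trans (ler_norm_sum _ _ _)).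
  apply: (@le_trans _ _ (\sum_(i < n) N)); first exact: ler_sum.
  by rewrite sumr_const card_ord mulr_natl.
transitivity (\int[tuple_power P n.+1]_t (A t + B t)).
  by apply: eq_Rintegral => t _; rewrite big_ord_recl mulrDr.
rewrite RintegralD//; last 2 first.
- exact: prob_Rintegrable bA.
- exact: prob_Rintegrable bB.
(* In [A] the first coordinate is integrated before the others, which are frozen; in [B] it is
   integrated last, so that the induction hypothesis applies to the remaining ones. *)
rewrite (tuple_powerS2 P mA bA) (tuple_powerS1 P mB bB).
rewrite [X in X + _](_ : _ = 0) ?add0r; last first.
  rewrite -[RHS](Rintegral_cst1 (tuple_power P n) 0); apply: eq_Rintegral => t _.
  rewrite -(u0 (fun z => h (cons_tup (z, map_tuple y t))) M)//.
  - by apply: eq_Rintegral => z _; rewrite /A /H map_cons_tup.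
  - exact: measurableT_comp mh (@measurable_cons_tupr _ _).
rewrite -[RHS](Rintegral_cst1 P 0); apply: eq_Rintegral => z _.
rewrite -(IH (fun t => h (cons_tup (y z, t))))//; last first.
  exact: measurableT_comp mh (@measurable_cons_tupl _ _).
apply: eq_Rintegral => t _; rewrite /B /H map_cons_tup; congr (_ * _).
by apply: eq_bigr => i _; rewrite tnth_cons_tupS.
Qed.

(** The likelihood ratio of a sample is the product of the ratios. [P0] and [P1] are compared
    through functions of [y] only, since the hypothesis speaks of the observed law. The first
    coordinate is moved from [P1] to [P0], the integrals are exchanged over the mixed product, and
    induction moves the rest. *)
Lemma tuple_power_likelihood (P0 P1 : probability T R) (L : T' -> R) N n
    (h : n.-tuple T' -> R) M :
  measurable_fun setT L -> bounded_by N L ->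
  (forall k K, measurable_fun setT k -> bounded_by K k ->
    \int[P1]_z k (y z) = \int[P0]_z (k (y z) * L (y z))) ->
  measurable_fun setT h -> bounded_by M h ->
  \int[tuple_power P1 n]_t h (map_tuple y t) =
  \int[tuple_power P0 n]_t (h (map_tuple y t) * \prod_(i < n) L (y (tnth t i))).
Proof.
move=> mL LN PL; elim: n h M => [|n IH] h M mh hM.
  have mH := measurableT_comp mh (@measurable_map_tuple 0).
  rewrite !tuple_power0 ?big_ord0 ?mulr1//.
  by apply: measurable_funM => //; exact: (@measurable_prod_tnth _ _ _ _ (fun=> L \o y)) (fun=> measurableT_comp mL my).
have mLy : measurable_fun setT (L \o y) by exact: measurableT_comp.
have mP k := @measurable_prod_tnth _ _ _ k (fun=> L \o y) (fun=> mLy).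
have bP k := @prod_tnth_bound _ _ _ k (fun=> L \o y) N (fun i x => LN (y x)).
pose H (t : n.+1.-tuple T) := h (map_tuple y t).
have mH : measurable_fun setT H := measurableT_comp mh (@measurable_map_tuple _).
have HM : bounded_by M H by move=> t; exact: hM.
have bHP := bounded_byM HM (bP n.+1).
rewrite (tuple_powerS2 P1 mH HM).
rewrite (tuple_powerS1 P0 (measurable_funM mH (mP _)) bHP).
have i1 : Rintegrable (tuple_power P1 n) (cst 1) by exact: finite_measure_integrable_cst.
pose c (z : T * n.-tuple T) := H (cons_tup z).
have mc : measurable_fun setT c by exact: measurableT_comp mH (@measurable_cons_tup _ _ n).
have cM z : `|c z| <= M by exact: HM.
have iL : Rintegrable P0 (L \o y) by apply: prob_Rintegrable mLy (fun x => LN (y x)).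
transitivity (\int[tuple_power P1 n]_t \int[P0]_z (L (y z) * c (z, t))).
  apply: eq_Rintegral => t _.
  rewrite (@eq_Rintegral _ _ _ _ _ (fun z => h (cons_tup (y z, map_tuple y t)))); last first.
    by move=> z _; rewrite /H map_cons_tup.
  rewrite (PL (fun z => h (cons_tup (z, map_tuple y t))) M)//; last first.
    exact: measurableT_comp mh (@measurable_cons_tupr _ _).
  by apply: eq_Rintegral => z _; rewrite /c /H map_cons_tup mulrC.
transitivity (\int[P0]_z (L (y z) * \int[tuple_power P1 n]_t (1 * c (z, t)))).
  rewrite (Rintegral_swap iL i1 mc cM).
  by apply: eq_Rintegral => t _; rewrite mul1r.
apply: eq_Rintegral => z _.
rewrite (@eq_Rintegral _ _ _ _ _ (fun t => h (cons_tup (y z, map_tuple y t)))); last first.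
  by move=> t _; rewrite mul1r /c /H map_cons_tup.
have mhz : measurable_fun setT (fun t => h (cons_tup (y z, t))).
  exact: measurableT_comp mh (@measurable_cons_tupl n _).
rewrite (IH (fun t => h (cons_tup (y z, t))) M)// -RintegralZl//; last first.
  apply: (@prob_Rintegrable _ _ _ _ _ (M * N ^+ n)).
    by apply: measurable_funM; [exact: measurableT_comp mhz (@measurable_map_tuple _)|exact: mP].
  by apply: bounded_byM; [move=> t; exact: hM|exact: bP].
apply: eq_Rintegral => t _ /=; rewrite /H map_cons_tup big_ord_recl tnth_cons_tup0.
rewrite mulrCA; congr (_ * (_ * _)).
by apply: eq_bigr => i _; rewrite tnth_cons_tupS.
Qed.

End tuple_map.

(** * Lower bounds for the quadratic risk *)

Section cauchy_schwarz.
Context d (T : measurableType d) (R : realType) (P : probability T R).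

Lemma quadratic_discriminant (a b c : R) : 0 <= b ->
  (forall s, 0 <= a - 2 * s * c + s ^+ 2 * b) -> c ^+ 2 <= a * b.
Proof.
rewrite le_eqVlt => /predU1P[<- H|b0 H]; last first.
  have := H (c / b); have -> : a - 2 * (c / b) * c + (c / b) ^+ 2 * b = a - c ^+ 2 / b.
    by field; rewrite gt_eqF.
  by rewrite subr_ge0 ler_pdivrMr.
have [->|c0] := eqVneq c 0; first by rewrite expr0n mulr0.
(* With b = 0 the expression is affine in s, and at this s it equals -1. *)
have := H ((a + 1) / (2 * c)).
have -> : a - 2 * ((a + 1) / (2 * c)) * c + ((a + 1) / (2 * c)) ^+ 2 * 0 = - 1.
  by field.
lra.
Qed.

Lemma bounded_cauchy_schwarz (X Y : T -> R) M N :
  measurable_fun setT X -> bounded_by M X ->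
  measurable_fun setT Y -> bounded_by N Y ->
  (\int[P]_x (X x * Y x)) ^+ 2 <= \int[P]_x (X x ^+ 2) * \int[P]_x (Y x ^+ 2).
Proof.
move=> mX bX mY bY.
have iXX : Rintegrable P (fun x => X x ^+ 2).
  exact: (RintegrableM (prob_Rintegrable P mX bX) mX bX).
have iYY : Rintegrable P (fun x => Y x ^+ 2).
  exact: (RintegrableM (prob_Rintegrable P mY bY) mY bY).
have iXY := RintegrableM (prob_Rintegrable P mX bX) mY bY.
apply: quadratic_discriminant => [|s]; first by apply: Rintegral_ge0 => x _; exact: sqr_ge0.
have : 0 <= \int[P]_x ((X x - s * Y x) ^+ 2).
  by apply: Rintegral_ge0 => x _; exact: sqr_ge0.
rewrite (_ : \int[P]_x _ = \int[P]_x ((X x ^+ 2 - (2 * s) * (X x * Y x)) + s ^+ 2 * Y x ^+ 2)); last first.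
  by apply: eq_Rintegral => x _; ring.
rewrite RintegralD//; last 2 first.
- exact: (RintegrableB iXX (RintegrableZ _ iXY)).
- exact: RintegrableZ.
rewrite RintegralB//; last exact: RintegrableZ.
by rewrite !RintegralZl.
Qed.

Lemma bounded_jensen (X : T -> R) M : measurable_fun setT X -> bounded_by M X ->
  (\int[P]_x X x) ^+ 2 <= \int[P]_x (X x ^+ 2).
Proof.
move=> mX bX.
have := @bounded_cauchy_schwarz X (cst 1) M 1 mX bX (@measurable_cst _ _ _ _ _ _).
rewrite /cst/= expr1n Rintegral_cst1 mulr1.
under eq_Rintegral do rewrite mulr1.
by apply => x; rewrite normr1.
Qed.

Lemma prob_indic (A : set T) : measurable A -> P A = (\int[P]_x \1_A x)%:E.
Proof.
move=> mA; rewrite /Rintegral integral_indic// setIT fineK//.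
exact: fin_num_measure.
Qed.

Lemma bounded_by_indic (A : set T) : bounded_by 1 (\1_A : T -> R).
Proof. by move=> x; rewrite indicE; case: (_ \in _); rewrite ?normr1 ?normr0. Qed.

End cauchy_schwarz.

(** * Orthogonality and two-point bounds for the empirical mean *)

Section lower_bounds.
Context d d' (T : measurableType d) (T' : measurableType d') (R : realType).
Variables (y : T -> T') (my : measurable_fun setT y) (phi : T -> R) (M : R).
Hypotheses (mphi : measurable_fun setT phi) (phiM : bounded_by M phi).
Variables (n : nat) (n0 : (0 < n)%N) (h : n.-tuple T' -> R).
Hypotheses (mh : measurable_fun setT h) (hM : bounded_by M h).

Definition emp_mean (t : n.-tuple T) : R := n%:R^-1 * \sum_(i < n) phi (tnth t i).

Definition sq_risk (P : probability T R) :=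
  \int[tuple_power P n]_t ((h (map_tuple y t) - emp_mean t) ^+ 2).

Let nR : n%:R != 0 :> R. Proof. by rewrite pnatr_eq0 -lt0n. Qed.

Let memp : measurable_fun setT emp_mean.
Proof. by apply: measurable_funM => //; exact: measurable_sum_tnth. Qed.

Let bemp : bounded_by M emp_mean.
Proof.
move=> t; rewrite normrM normfV normr_nat ler_pdivrMl ?ltr0n//.
exact: sum_tnth_bound.
Qed.

Let mhy : measurable_fun setT (fun t : n.-tuple T => h (map_tuple y t)).
Proof. exact: (measurableT_comp mh (@measurable_map_tuple _ _ _ _ _ my n)). Qed.

Let bhy : bounded_by M (fun t : n.-tuple T => h (map_tuple y t)).
Proof. by move=> t; exact: hM. Qed.

Let mdiff : measurable_fun setT (fun t => h (map_tuple y t) - emp_mean t).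
Proof. exact: measurable_funB. Qed.

Let bdiff : bounded_by (M + M) (fun t => h (map_tuple y t) - emp_mean t).
Proof. by move=> t; apply: (le_trans (ler_normB _ _)); apply: lerD; [exact: hM|exact: bemp]. Qed.

Variable P : probability T R.
Local Notation "P ^^ n" := (tuple_power P n) (at level 30).

Let m := \int[P]_z phi z.

Let mcen : measurable_fun setT (fun z => phi z - m).
Proof. exact: measurable_funB. Qed.

Let bcen : bounded_by (M + M) (fun z => phi z - m).
Proof.
move=> z; apply: (le_trans (ler_normB _ _)); apply: lerD; first exact: phiM.
exact: Rintegral_prob_bound.
Qed.

Let icen : \int[P]_z (phi z - m) = 0.
Proof.
rewrite RintegralB//; first by rewrite Rintegral_cst1 subrr.
- exact: prob_Rintegrable phiM.
- exact: finite_measure_integrable_cst.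
Qed.

Let emp_cen t : emp_mean t - m = n%:R^-1 * \sum_(i < n) (phi (tnth t i) - m).
Proof.
rewrite big_split/= sumr_const card_ord mulrDr mulNrn -mulNrn mulrnAr.
by rewrite -mulrnAr -(mulr_natr (- _)) mulrCA mulVf// mulr1.
Qed.

Lemma emp_mean_var : \int[P ^^ n]_t ((emp_mean t - m) ^+ 2) <= (2 * M) ^+ 2 / n%:R.
Proof.
rewrite (@eq_Rintegral _ _ _ _ _ (fun t => n%:R^-1 ^+ 2 *
   ((\sum_(i < n) (phi (tnth t i) - m)) * (\sum_(i < n) (phi (tnth t i) - m))))); last first.
  by move=> t _; rewrite emp_cen exprMn [X in _ * X]expr2.
have mS := @measurable_sum_tnth _ _ _ n _ mcen.
have bS := @sum_tnth_bound _ _ _ n _ _ bcen.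
rewrite RintegralZl//; last first.
  exact: (RintegrableM (prob_Rintegrable (P ^^ n) mS bS) mS bS).
rewrite (tuple_power_cov n mcen bcen icen mcen bcen icen).
rewrite expr2 -mulrA mulKf// mulrC ler_pM2r ?invr_gt0 ?ltr0n//.
apply: (le_trans (ler_norm _)).
apply: (@Rintegral_prob_bound _ _ _ _ _ ((2 * M) ^+ 2)).
  exact: measurable_funM.
move=> z; rewrite normrM expr2 mulr_natl mulr2n; apply: ler_pM => //; exact: bcen.
Qed.

(* If [u] has zero conditional expectation given [y], then the statistic
   [h] carries no information on the sum of the [u (t_i)], while the
   empirical mean is correlated with it. *)
Lemma sq_risk_orth (u : T -> R) N : measurable_fun setT u -> bounded_by N u ->
  (forall k K, measurable_fun setT k -> bounded_by K k ->
    \int[P]_z (k (y z) * u z) = 0) ->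
  (\int[P]_z (phi z * u z)) ^+ 2 <= sq_risk P * (n%:R * \int[P]_z (u z ^+ 2)).
Proof.
move=> mu uN u0.
have iu : \int[P]_z u z = 0.
  rewrite -[RHS](u0 (cst 1) 1)//; last by move=> x; rewrite normr1.
  by apply: eq_Rintegral => z _; rewrite mul1r.
have mS := @measurable_sum_tnth _ _ _ n _ mu.
have bS := @sum_tnth_bound _ _ _ n _ _ uN.
have mS' := @measurable_sum_tnth _ _ _ n _ mcen.
have bS' := @sum_tnth_bound _ _ _ n _ _ bcen.
have <- : \int[P ^^ n]_t ((\sum_(i < n) u (tnth t i)) ^+ 2) = n%:R * \int[P]_z (u z ^+ 2).
  transitivity (n%:R * \int[P]_z (u z * u z)); last first.
    by congr (_ * _); apply: eq_Rintegral => z _; rewrite expr2.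
  rewrite -(tuple_power_cov n mu uN iu mu uN iu).
  by apply: eq_Rintegral => t _; rewrite expr2.
apply: le_trans (bounded_cauchy_schwarz (P ^^ n) mdiff bdiff mS bS).
(* The covariance of [phi] and [u] is, up to sign, the correlation of the error of [h] with the sum
   of the [u]: the part of [h] vanishes by [tuple_power_orth], the factor n cancels against the
   mean, and the square hides the sign. *)
rewrite -sqrrN le_eqVlt; apply/orP; left; apply/eqP; congr (_ ^+ 2).
have iS := prob_Rintegrable (P ^^ n) mS bS.
have ihS := RintegrableMl iS mhy bhy.
have iSS := RintegrableM (prob_Rintegrable (P ^^ n) mS' bS') mS bS.
transitivity (\int[P ^^ n]_t ((h (map_tuple y t) * (\sum_(i < n) u (tnth t i))
   - m * (\sum_(i < n) u (tnth t i)))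
   - n%:R^-1 * ((\sum_(i < n) (phi (tnth t i) - m)) * (\sum_(i < n) u (tnth t i))))); last first.
  apply: eq_Rintegral => t _; rewrite mulrA -emp_cen; ring.
rewrite RintegralB//; [|exact: (RintegrableB ihS (RintegrableZ _ iS))|exact: RintegrableZ].
rewrite RintegralB//; last exact: RintegrableZ.
rewrite !RintegralZl// (tuple_power_orth my mu uN u0 mh hM).
rewrite (tuple_power_sum n mu uN iu) (tuple_power_cov n mcen bcen icen mu uN iu).
rewrite mulKf// mulr0 subr0 sub0r; congr (- _).
have ipu := RintegrableM (prob_Rintegrable P mphi phiM) mu uN.
transitivity (\int[P]_z (phi z * u z - m * u z)); last first.
  by apply: eq_Rintegral => z _; rewrite mulrBl.
have iu' := prob_Rintegrable P mu uN.
rewrite RintegralB//; last exact: RintegrableZ.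
by rewrite RintegralZl// iu mulr0 subr0.
Qed.

(** The difference of the two means of [phi] is B - A, where A is the bias of [h] under [P1] and B
    is the distance from the expectation of [h] under [P1] to the mean under [P]. Jensen bounds A by
    the risk. The likelihood moves B to [P], where Cauchy-Schwarz bounds it by (1 + chi)^n <= e
    times the second moment of h - m, that is, the risk plus the variance of the empirical mean. *)
Lemma sq_risk_two_point (P1 : probability T R) (L : T' -> R) N (chi r : R) :
  measurable_fun setT L -> bounded_by N L ->
  (forall k K, measurable_fun setT k -> bounded_by K k ->
    \int[P1]_z k (y z) = \int[P]_z (k (y z) * L (y z))) ->
  \int[P]_z (L (y z) ^+ 2) <= 1 + chi -> n%:R * chi <= 1 ->
  sq_risk P <= r -> sq_risk P1 <= r ->
  (\int[P1]_z phi z - m) ^+ 2 <=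
     2 * r + 2 * (expR 1 * (2 * r + 2 * ((2 * M) ^+ 2 / n%:R))).
Proof.
move=> mL LN PL Lchi nchi r0 r1.
set m1 := \int[P1]_z phi z.
pose A := \int[P1 ^^ n]_t (h (map_tuple y t) - emp_mean t).
have A2 : A ^+ 2 <= r by apply: le_trans r1; exact: (bounded_jensen _ mdiff bdiff).
have ih := prob_Rintegrable (P1 ^^ n) mhy bhy.
have AE : A = \int[P1 ^^ n]_t h (map_tuple y t) - m1.
  rewrite /A RintegralB//; last exact: prob_Rintegrable bemp.
  congr (_ - _).
  have i1 := prob_Rintegrable (P1 ^^ n) memp bemp.
  have mc1 : measurable_fun setT (fun z => phi z - m1) by exact: measurable_funB.
  have bc1 : bounded_by (M + M) (fun z => phi z - m1).
    move=> z; apply: (le_trans (ler_normB _ _)); apply: lerD; first exact: phiM.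
    exact: Rintegral_prob_bound.
  have ic1 : \int[P1]_z (phi z - m1) = 0.
    rewrite RintegralB//; first by rewrite Rintegral_cst1 subrr.
    - exact: prob_Rintegrable phiM.
    - exact: finite_measure_integrable_cst.
  apply/eqP; rewrite -subr_eq0 -(Rintegral_cst1 (P1 ^^ n) m1) -RintegralB//; last first.
    exact: finite_measure_integrable_cst.
  rewrite (@eq_Rintegral _ _ _ _ _ (fun t => n%:R^-1 * \sum_(i < n) (phi (tnth t i) - m1))); last first.
    move=> t _; rewrite big_split/= sumr_const card_ord mulrDr mulNrn -mulNrn mulrnAr.
    by rewrite -mulrnAr -(mulr_natr (- _)) mulrCA mulVf// mulr1.
  rewrite RintegralZl//; last first.
    apply: prob_Rintegrable; first exact: (measurable_sum_tnth mc1).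
    exact: (sum_tnth_bound bc1).
  by rewrite (tuple_power_sum n mc1 bc1 ic1) mulr0.
pose B := \int[P1 ^^ n]_t (h (map_tuple y t) - m).
have BE : B = \int[P1 ^^ n]_t h (map_tuple y t) - m.
  rewrite /B RintegralB//; first by rewrite Rintegral_cst1.
  exact: finite_measure_integrable_cst.
have m1M : `|m| <= M by exact: Rintegral_prob_bound.
have mhm : measurable_fun setT (fun s => h s - m) by exact: measurable_funB.
have bhm : bounded_by (M + M) (fun s => h s - m).
  by move=> s; apply: (le_trans (ler_normB _ _)); apply: lerD.
have mhmy : measurable_fun setT (fun t => h (map_tuple y t) - m) by exact: measurable_funB.
have bhmy : bounded_by (M + M) (fun t => h (map_tuple y t) - m) by move=> t; exact: bhm.
have mLy : measurable_fun setT (L \o y) by exact: measurableT_comp.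
have bLy : bounded_by N (L \o y) by move=> z; exact: LN.
have mPr := @measurable_prod_tnth _ _ _ n (fun=> L \o y) (fun=> mLy).
have bPr := @prod_tnth_bound _ _ _ n (fun=> L \o y) N (fun=> bLy).
have B2 : B ^+ 2 <= \int[P ^^ n]_t ((h (map_tuple y t) - m) ^+ 2) * expR 1.
  rewrite /B (tuple_power_likelihood my mL LN PL mhm bhm).
  apply: (le_trans (bounded_cauchy_schwarz (P ^^ n) mhmy bhmy mPr bPr)).
  apply: ler_wpM2l; first by apply: Rintegral_ge0 => t _; exact: sqr_ge0.
  rewrite (@eq_Rintegral _ _ _ _ _ (fun t => \prod_(i < n) ((L (y (tnth t i))) ^+ 2))); last first.
    by move=> t _; rewrite prodrXl.
  rewrite (@tuple_power_prod _ _ _ P n (fun=> fun z => L (y z) ^+ 2) (N ^+ 2)); last 2 first.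
  - by move=> _; exact: measurable_funX.
  - by move=> _ z; rewrite normrX lerXn2r// ?nnegrE//; exact: le_trans (LN (y z)).
  rewrite prodr_const card_ord.
  apply: (@le_trans _ _ ((1 + chi) ^+ n)).
    apply: lerXn2r => //; rewrite nnegrE; first by apply: Rintegral_ge0 => t _; exact: sqr_ge0.
    by apply: le_trans Lchi; apply: Rintegral_ge0 => t _; exact: sqr_ge0.
  apply: (@le_trans _ _ (expR chi ^+ n)).
    apply: lerXn2r; rewrite ?nnegrE ?expR_ge0 ?expR_ge1Dx//.
    by apply: le_trans Lchi; apply: Rintegral_ge0 => t _; exact: sqr_ge0.
  by rewrite -expRM_natl ler_expR.
have V : \int[P ^^ n]_t ((h (map_tuple y t) - m) ^+ 2) <= 2 * r + 2 * ((2 * M) ^+ 2 / n%:R).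
  have memc : measurable_fun setT (fun t => emp_mean t - m) by exact: measurable_funB.
  have bemc : bounded_by (M + M) (fun t => emp_mean t - m).
    by move=> t; apply: (le_trans (ler_normB _ _)); apply: lerD => //; exact: bemp.
  have sqi (X : n.-tuple T -> R) K : measurable_fun setT X -> bounded_by K X ->
      Rintegrable (P ^^ n) (fun t => X t ^+ 2).
    by move=> mX bX; exact: (RintegrableM (prob_Rintegrable (P ^^ n) mX bX) mX bX).
  apply: (@le_trans _ _ (\int[P ^^ n]_t (2 * ((h (map_tuple y t) - emp_mean t) ^+ 2) +
       2 * ((emp_mean t - m) ^+ 2)))).
    apply: le_Rintegral => //; first exact: sqi bhmy.
      exact: RintegrableD (RintegrableZ _ (sqi _ _ mdiff bdiff)) (RintegrableZ _ (sqi _ _ memc bemc)).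
    move=> t _; set a := h _; set b := emp_mean t.
    have := sqr_ge0 ((a - b) - (b - m)); lra.
  rewrite RintegralD//; last 2 first.
  - exact: (RintegrableZ _ (sqi _ _ mdiff bdiff)).
  - exact: (RintegrableZ _ (sqi _ _ memc bemc)).
  rewrite !RintegralZl//; [|exact: sqi bemc|exact: sqi bdiff].
  by apply: lerD; rewrite ler_pM2l//; exact: emp_mean_var.
have -> : m1 - m = B - A by rewrite AE BE; ring.
have e1 : 0 <= expR 1 :> R by exact: expR_ge0.
apply: (@le_trans _ _ (2 * A ^+ 2 + 2 * B ^+ 2)); first by have := sqr_ge0 (A + B); lra.
apply: lerD; first by rewrite ler_pM2l.
rewrite ler_pM2l//; apply: (le_trans B2); rewrite mulrC; exact: ler_wpM2l.
Qed.

End lower_bounds.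

(** * Densities and the deconvolution model *)

Section pdf_law.
Context (R : realType).
Local Notation mu := (@lebesgue_measure R).
Implicit Types f g : R -> R.

Lemma pdf_measurable f : is_pdf f -> measurable_fun setT f.
Proof. by case. Qed.

Lemma pdf_ge0 f : is_pdf f -> forall x, 0 <= f x.
Proof. by case. Qed.

Lemma pdf_Rintegrable f : is_pdf f -> Rintegrable mu f.
Proof. by case=> mf f0 f1; apply: ge0_Rintegrable => //; rewrite f1 ltry. Qed.

Lemma pdf_Rintegral f : is_pdf f -> \int[mu]_x f x = 1.
Proof. by case=> mf f0 f1; exact: RintegralE_eq. Qed.

(** The proof [pf] is an argument so that the instances of measure and probability can be attached
    to the law. *)
Definition pdf_law f (pf : is_pdf f) : set (measurableTypeR R) -> \bar R :=
  fun A => (\int[mu]_(x in A) (f x)%:E)%E.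

Section instances.
Variables (f : R -> R) (pf : is_pdf f).

Let law0 : pdf_law pf set0 = 0%E.
Proof. by rewrite /pdf_law integral_set0. Qed.

Let law_ge0 A : (0 <= pdf_law pf A)%E.
Proof. by apply: integral_ge0 => x _; rewrite lee_fin; exact: pdf_ge0. Qed.

Let law_sigma_additive : semi_sigma_additive (pdf_law pf).
Proof.
move=> A mA tA mUA; rewrite /pdf_law integral_bigcup//=; last first.
  by apply: (integrableS _ _ (subsetT _)) => //; exact: pdf_Rintegrable.
apply: is_cvg_ereal_nneg_natsum_cond => n _ _.
by apply: integral_ge0 => x _; rewrite lee_fin; exact: pdf_ge0.
Qed.

HB.instance Definition _ := isMeasure.Build _ (measurableTypeR R) R (pdf_law pf)
  law0 law_ge0 law_sigma_additive.

Let law_setT : pdf_law pf setT = 1%E.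
Proof. by case: pf. Qed.

HB.instance Definition _ := Measure_isProbability.Build _ (measurableTypeR R) R (pdf_law pf) law_setT.

End instances.

Lemma pdf_law_dominated f (pf : is_pdf f) : pdf_law pf `<< mu.
Proof.
apply/null_content_dominatesP => A mA A0; rewrite /pdf_law.
apply: null_set_integral => //.
by apply/measurable_EFinP/measurable_funTS; exact: pdf_measurable.
Qed.

(** The Radon-Nikodym derivative of the law agrees almost everywhere with [f], both having the same
    integral over every measurable set; the change of variables for that derivative then applies. *)
Lemma ge0_integral_pdf_law f (pf : is_pdf f) (h : R -> R) :
  measurable_fun setT h -> (forall x, 0 <= h x) ->
  (\int[pdf_law pf]_x (h x)%:E = \int[mu]_x (h x * f x)%:E)%E.
Proof.
move=> mh h0; have dom := pdf_law_dominated pf.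
have mf := pdf_measurable pf; have f0 := pdf_ge0 pf.
have mhE : measurable_fun setT (EFin \o h) by exact/measurable_EFinP.
rewrite -(Radon_Nikodym_SigmaFinite.change_of_variables dom)//.
set g := Radon_Nikodym_SigmaFinite.f _ _.
have ig : mu.-integrable setT g by exact: Radon_Nikodym_SigmaFinite.f_integrable.
have mg := measurable_int _ ig.
have fg : ae_eq mu setT g (EFin \o f).
  apply: integral_ae_eq => //; first exact/measurable_EFinP.
  by move=> E _ mE; rewrite -Radon_Nikodym_SigmaFinite.f_integral.
apply: ge0_ae_eq_integral => //.
- exact: emeasurable_funM.
- by apply/measurable_EFinP; exact: measurable_funM.
- by move=> x _; apply: mule_ge0; rewrite ?lee_fin//; exact: Radon_Nikodym_SigmaFinite.f_ge0.
- by move=> x _; rewrite lee_fin mulr_ge0.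
- by apply: filterS fg => x /= fgx _; rewrite fgx// EFinM.
Qed.

Lemma Rintegral_pdf_law f (pf : is_pdf f) (h : R -> R) M :
  measurable_fun setT h -> bounded_by M h ->
  \int[pdf_law pf]_x h x = \int[mu]_x (h x * f x).
Proof.
move=> mh hM; have mf := pdf_measurable pf.
have M0 : 0 <= M by apply: le_trans (hM 0).
have ih := prob_Rintegrable (pdf_law pf) mh hM.
have ihf : Rintegrable mu (fun x => h x * f x).
  exact: (RintegrableMl (pdf_Rintegrable pf) mh hM).
have iMf : Rintegrable mu (fun x => M * f x) by exact/RintegrableZ/pdf_Rintegrable.
(* Adding the bound [M] reduces to the nonnegative case; the constant is removed again because f has
   mass 1. *)
have : \int[pdf_law pf]_x (h x + M) = \int[mu]_x ((h x + M) * f x).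
  rewrite /Rintegral ge0_integral_pdf_law//; first exact: measurable_funD.
  by move=> x; have := hM x; rewrite ler_norml; lra.
rewrite RintegralD//; last exact: finite_measure_integrable_cst.
have -> : \int[mu]_x ((h x + M) * f x) = \int[mu]_x (h x * f x) + M.
  transitivity (\int[mu]_x (h x * f x + M * f x)).
    by apply: eq_Rintegral => x _; rewrite mulrDl.
  rewrite RintegralD// RintegralZl; [|by []|exact: pdf_Rintegrable].
  by rewrite (pdf_Rintegral pf) mulr1.
by rewrite Rintegral_cst1 => /addIr.
Qed.

Section pair_law.
Variables (f g : R -> R) (pf : is_pdf f) (pg : is_pdf g).

Definition pair_law : probability (measurableTypeR R * measurableTypeR R)%type R :=
  (pdf_law pf \x pdf_law pg)%E.

Lemma Rintegral_pair_law (H : R * R -> R) M :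
  measurable_fun setT H -> bounded_by M H ->
  \int[pair_law]_z H z = \int[mu]_x (f x * \int[mu]_y (g y * H (x, y))).
Proof.
move=> mH HM; rewrite /pair_law (Rintegral_prob_prod1 (pdf_law pf) (pdf_law pg) mH HM).
have mi := measurable_Rintegral1 (pdf_law pf) (pdf_law pg) mH HM.
have msec x : measurable_fun setT (fun y => H (x, y)) by exact: measurableT_comp.
rewrite (@Rintegral_pdf_law f pf _ M)//; last first.
  move=> x; exact: (Rintegral_prob_bound (pdf_law pg) (msec x) (fun y => HM (x, y))).
apply: eq_Rintegral => x _; rewrite mulrC; congr (_ * _).
rewrite (@Rintegral_pdf_law g pg _ M)//; first by apply: eq_Rintegral => y _; rewrite mulrC.
Qed.

(** The density of the observation theta + xi. Boundedness of [f], assumed next, makes the integral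
    converge at every y and not only almost everywhere. *)
Definition conv_pdf (y : R) : R := \int[mu]_x (g x * f (y - x)).

Hypothesis fb : exists K, bounded_by K f.

Let mfsub : measurable_fun setT (fun z : R * R => f (z.1 - z.2)).
Proof.
apply: (measurableT_comp (pdf_measurable pf)).
by apply: measurable_funB; [exact: measurable_fst|exact: measurable_snd].
Qed.

Let iconv y : Rintegrable mu (fun x => g x * f (y - x)).
Proof.
have [K fK] := fb; apply: (RintegrableM (pdf_Rintegrable pg) _ (fun x => fK (y - x))).
by apply: (measurableT_comp (pdf_measurable pf)); exact: measurable_funB.
Qed.

Lemma conv_pdf_ge0 y : 0 <= conv_pdf y.
Proof.
by apply: Rintegral_ge0 => x _; rewrite mulr_ge0//; exact: pdf_ge0.
Qed.

Let mgf : measurable_fun setT (fun z : R * R => g z.2 * f (z.1 - z.2)).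
Proof.
apply: measurable_funM => //.
by apply: (measurableT_comp (pdf_measurable pg)); exact: measurable_snd.
Qed.

Lemma measurable_conv_pdf : measurable_fun setT conv_pdf.
Proof.
have m : measurable_fun setT (fubini_F mu (EFin \o (fun z : R * R => g z.2 * f (z.1 - z.2)))).
  apply: measurable_fun_fubini_tonelli_F; first exact/measurable_EFinP.
  by move=> z; rewrite lee_fin mulr_ge0//; exact: pdf_ge0.
apply/measurable_EFinP; move: m; apply: eq_measurable_fun => y _.
by rewrite /fubini_F/= RintegralE.
Qed.

(** Tonelli and a translation by y. The left side is an extended integral, so that k = 1 yields the
    total mass of [conv_pdf] before its integrability is known. *)
Lemma ge0_integral_pair_law_sum (k : R -> R) K : measurable_fun setT k ->
  (forall x, 0 <= k x) -> bounded_by K k ->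
  (\int[mu]_y (k y * conv_pdf y)%:E = (\int[pair_law]_z k (z.1 + z.2))%:E)%E.
Proof.
move=> mk k0 kK; have mf := pdf_measurable pf; have mg := pdf_measurable pg.
have f0 := pdf_ge0 pf; have g0 := pdf_ge0 pg.
have mks : measurable_fun setT (fun z : R * R => k (z.1 + z.2)).
  apply: (measurableT_comp mk).
  by apply: measurable_funD; [exact: measurable_fst|exact: measurable_snd].
have bks : bounded_by K (fun z : R * R => k (z.1 + z.2)) by move=> z; exact: kK.
rewrite /pair_law (Rintegral_prob_prod2 (pdf_law pf) (pdf_law pg) mks bks)/=.
have msec (y : R) : measurable_fun setT (fun x : R => k (x + y)) by exact: measurable_shift.
have ikf y : Rintegrable mu (fun x => k (x + y) * f x).
  exact: (RintegrableMl (pdf_Rintegrable pf) (msec y) (fun x => kK (x + y))).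
have mi : measurable_fun setT (fun y => \int[pdf_law pf]_x k (x + y)).
  have := @measurable_Rintegral1 _ _ _ _ _ (pdf_law pg) (pdf_law pf) (fun z => k (z.2 + z.1)) K.
  apply; last by move=> z; exact: kK.
  by apply: (measurableT_comp mk); apply: measurable_funD; [exact: measurable_snd|exact: measurable_fst].
have bi y : `|\int[pdf_law pf]_x k (x + y)| <= K.
  exact: (Rintegral_prob_bound (pdf_law pf) (msec y) (fun x => kK (x + y))).
rewrite (@Rintegral_pdf_law g pg _ K mi bi).
rewrite -RintegralE; last exact: (RintegrableMl (pdf_Rintegrable pg) mi bi).
pose F (z : measurableTypeR R * measurableTypeR R) := (k z.1 * (g z.2 * f (z.1 - z.2)))%:E.
have mF : measurable_fun setT F.
  apply/measurable_EFinP; apply: measurable_funM => //.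
  by apply: (measurableT_comp mk); exact: measurable_fst.
have F0 z : (0 <= F z)%E by rewrite lee_fin !mulr_ge0.
transitivity (\int[mu]_x fubini_F mu F x)%E.
  apply: eq_integral => y _; rewrite /fubini_F /F/= EFinM -RintegralE//.
  rewrite -ge0_integralZl//; first by apply/measurable_EFinP; exact: Rintegrable_measurable (iconv y).
  - by move=> x _; rewrite lee_fin mulr_ge0.
  - by rewrite lee_fin.
rewrite (@fubini_tonelli _ _ _ _ R lebesgue_measure lebesgue_measure F mF F0).
apply: eq_integral => y _; rewrite /fubini_G /F/=.
rewrite (@Rintegral_pdf_law f pf _ K (msec y)) => [|x]; last exact: kK.
rewrite mulrC EFinM -RintegralE// -ge0_integralZl//; last 3 first.
- by apply/measurable_EFinP; exact: Rintegrable_measurable (ikf y).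
- by move=> x _; rewrite lee_fin mulr_ge0.
- by rewrite lee_fin.
rewrite -(@ge0_integral_shift _ (fun x => (k x * (g y * f (x - y)))%:E) y).
- by apply: eq_integral => x _; rewrite addrK mulrCA EFinM.
- apply/measurable_EFinP; apply: measurable_funM => //; apply: measurable_funM => //.
  by apply: (measurableT_comp mf); exact: measurable_funB.
- by move=> x; rewrite lee_fin !mulr_ge0.
Qed.

Lemma conv_pdf_is_pdf : is_pdf conv_pdf.
Proof.
split; [exact: measurable_conv_pdf|exact: conv_pdf_ge0|].
transitivity (\int[mu]_y (cst 1 y * conv_pdf y)%:E)%E.
  by apply: eq_integral => x _; rewrite mul1r.
rewrite (@ge0_integral_pair_law_sum (cst 1) 1)//; first by rewrite Rintegral_cst1.
by move=> x; rewrite normr1.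
Qed.

Lemma Rintegral_pair_law_sum (k : R -> R) K : measurable_fun setT k ->
  bounded_by K k ->
  \int[pair_law]_z k (z.1 + z.2) = \int[mu]_y (k y * conv_pdf y).
Proof.
move=> mk kK; have K0 : 0 <= K by apply: le_trans (kK 0).
rewrite -(Rintegral_pdf_law conv_pdf_is_pdf mk kK).
pose k' x := k x + K.
have k'0 x : 0 <= k' x by have := kK x; rewrite /k' ler_norml; lra.
have mk' : measurable_fun setT k' by exact: measurable_funD.
have bk' : bounded_by (K + K) k'.
  by move=> x; rewrite ger0_norm//; have := kK x; rewrite /k' ler_norml; lra.
have := ge0_integral_pair_law_sum mk' k'0 bk'.
rewrite -(ge0_integral_pdf_law conv_pdf_is_pdf mk' k'0) RintegralE; last first.
  exact: (prob_Rintegrable (pdf_law conv_pdf_is_pdf) mk' bk').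
move=> -[]; rewrite /k' RintegralD//; last 2 first.
- exact: (prob_Rintegrable (pdf_law conv_pdf_is_pdf) mk kK).
- exact: finite_measure_integrable_cst.
rewrite RintegralD//; last 2 first.
- apply: (@prob_Rintegrable _ _ _ _ _ K) => [|z]; last exact: kK.
  apply: (measurableT_comp mk).
  by apply: measurable_funD; [exact: measurable_fst|exact: measurable_snd].
- exact: finite_measure_integrable_cst.
by rewrite !Rintegral_cst1 => /addIr.
Qed.

End pair_law.

Lemma measurable_inv_gt0 (q : R -> R) : measurable_fun setT q ->
  (forall x, 0 < q x) -> measurable_fun setT (fun x => (q x)^-1).
Proof.
move=> mq q0; rewrite (_ : (fun x => _) = (fun x => q x `^ (-1))); last first.
  by apply/funext => x; rewrite powR_inv1// ltW.
exact: (measurableT_comp (measurable_powR (-1)) mq).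
Qed.

Lemma likelihood_ratio f0 f1 g (p0 : is_pdf f0) (p1 : is_pdf f1) (pg : is_pdf g) K0 K1 :
  bounded_by K0 f0 -> bounded_by K1 f1 ->
  (forall y, 0 < conv_pdf f0 g y) ->
  forall k K, measurable_fun setT k -> bounded_by K k ->
  (exists C, bounded_by C (fun y => conv_pdf f1 g y / conv_pdf f0 g y)) ->
  \int[pair_law p1 pg]_z k (z.1 + z.2) =
  \int[pair_law p0 pg]_z (k (z.1 + z.2) *
     (conv_pdf f1 g (z.1 + z.2) / conv_pdf f0 g (z.1 + z.2))).
Proof.
move=> b0 b1 q0 k K mk kK [C bC].
have mq0 : measurable_fun setT (conv_pdf f0 g) by apply: measurable_conv_pdf => //; exists K0.
have mq1 : measurable_fun setT (conv_pdf f1 g) by apply: measurable_conv_pdf => //; exists K1.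
have mL : measurable_fun setT (fun y => conv_pdf f1 g y / conv_pdf f0 g y).
  apply: measurable_funM => //; exact: measurable_inv_gt0.
rewrite (@Rintegral_pair_law_sum _ _ p1 pg _ k K)//; last by exists K1.
rewrite (@Rintegral_pair_law_sum _ _ p0 pg _ (fun y => k y * (conv_pdf f1 g y / conv_pdf f0 g y)) (K * C)); last 3 first.
- by exists K0.
- exact: measurable_funM.
- exact: bounded_byM.
by apply: eq_Rintegral => y _; rewrite -mulrA divfK// gt_eqF.
Qed.

End pdf_law.

(** * Rectangles and marginals of the product law *)

Section tuple_power_events.
Context d (T : measurableType d) (R : realType) (P : probability T R).

Lemma measurable_tuple_rect n (B : 'I_n -> set T) :
  (forall i, measurable (B i)) ->
  measurable [set t : n.-tuple T | forall i, B i (tnth t i)].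
Proof.
move=> mB.
rewrite (_ : [set t | _] = \bigcap_(i in [set: 'I_n]) ((fun t : n.-tuple T => tnth t i) @^-1` B i)); last first.
  by apply/seteqP; split => t /= H => [i _|i]; exact: H.
apply: fin_bigcap_measurable => // i _.
by rewrite -[X in measurable X]setTI; exact: measurable_tnth.
Qed.

Lemma tuple_power_rect n (B : 'I_n -> set T) : (forall i, measurable (B i)) ->
  tuple_power P n [set t | forall i, B i (tnth t i)] =
  (\prod_(i < n) fine (P (B i)))%:E.
Proof.
move=> mB; rewrite prob_indic; last exact: measurable_tuple_rect.
congr EFin.
rewrite (@eq_Rintegral _ _ _ _ _ (fun t => \prod_(i < n) \1_(B i) (tnth t i))); last first.
  move=> t _; rewrite indicE; have [|] := boolP (t \in _) => [/set_mem/= H|/negP H].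
    by rewrite big1// => i _; rewrite indicE mem_set.
  have [i /negP Bi] : exists i, ~~ (tnth t i \in B i).
    apply/existsP; rewrite -negb_forall; apply/negP => /forallP Bt; apply: H.
    by rewrite inE => i; apply/set_mem; exact: Bt.
  by rewrite (bigD1 i)//= indicE; move/negP/negbTE: Bi => ->; rewrite mul0r.
rewrite (@tuple_power_prod _ _ _ P n (fun i => \1_(B i)) 1)//.
- by apply: eq_bigr => i _; rewrite (prob_indic P (mB i)).
- by move=> i; exact: bounded_by_indic.
Qed.

Lemma tuple_power_marginal n (i : 'I_n) (E : set T) : measurable E ->
  tuple_power P n [set t | E (tnth t i)] = P E.
Proof.
move=> mE; pose B j := if j == i then E else setT.
have -> : [set t : n.-tuple T | E (tnth t i)] = [set t | forall j, B j (tnth t j)].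
  apply/seteqP; split => t /= H; last by have := H i; rewrite /B eqxx.
  by move=> j; rewrite /B; case: eqVneq => [->|].
rewrite tuple_power_rect; last by move=> j; rewrite /B; case: ifP.
rewrite (bigD1 i)//= big1 => [|j ji]; last first.
  by rewrite /B (negbTE ji) probability_setT.
by rewrite mulr1 /B eqxx fineK//; exact: fin_num_measure.
Qed.

End tuple_power_events.

(** * A realization of the deconvolution model on a product space *)

Section realization.
Context (R : realType) (f g : R -> R) (pf : is_pdf f) (pg : is_pdf g) (n : nat).
Local Notation RM := (measurableTypeR R).
Local Notation P := (tuple_power (pair_law pf pg) n).

Definition coord1 (i : 'I_n) (t : n.-tuple (RM * RM)%type) : R := (tnth t i).1.
Definition coord2 (i : 'I_n) (t : n.-tuple (RM * RM)%type) : R := (tnth t i).2.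

Let mcoord1 i : measurable_fun setT (coord1 i).
Proof. by apply: (measurableT_comp measurable_fst); exact: measurable_tnth. Qed.

Let mcoord2 i : measurable_fun setT (coord2 i).
Proof. by apply: (measurableT_comp measurable_snd); exact: measurable_tnth. Qed.

HB.instance Definition _ i := isMeasurableFun.Build _ _ _ _ (coord1 i) (mcoord1 i).
HB.instance Definition _ i := isMeasurableFun.Build _ _ _ _ (coord2 i) (mcoord2 i).

Definition theta_coord i : {RV P >-> R} := coord1 i.
Definition xi_coord i : {RV P >-> R} := coord2 i.

Lemma pair_law_rect (A B : set RM) : measurable A -> measurable B ->
  pair_law pf pg (A `*` B) = (pdf_law pf A * pdf_law pg B)%E.
Proof. by move=> mA mB; rewrite /pair_law/= product_measure1E. Qed.

Let theta_law i (A : set R) : measurable A ->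
  P (theta_coord i @^-1` A) = pdf_law pf A.
Proof.
move=> mA.
rewrite (_ : theta_coord i @^-1` A = [set t | (A `*` setT) (tnth t i)]); last first.
  by apply/seteqP; split => t /=; [move=> ?; split|case].
rewrite tuple_power_marginal; last exact: measurableX.
by rewrite pair_law_rect// probability_setT mule1.
Qed.

Let xi_law i (A : set R) : measurable A ->
  P (xi_coord i @^-1` A) = pdf_law pg A.
Proof.
move=> mA.
rewrite (_ : xi_coord i @^-1` A = [set t | (setT `*` A) (tnth t i)]); last first.
  by apply/seteqP; split => t /=; [move=> ?; split|case].
rewrite tuple_power_marginal; last exact: measurableX.
by rewrite pair_law_rect// probability_setT mul1e.
Qed.

(** An event on the 2 n variables regroups into one rectangle for each pair (theta_i, xi_i), so
    independence follows from [tuple_power_rect] and the product form of [pair_law]. *)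
Lemma realization_model : deconvolution_model f g theta_coord xi_coord.
Proof.
split; [by move=> i A mA; exact: theta_law|by move=> i A mA; exact: xi_law|].
move=> A mA.
rewrite (_ : \bigcap_(k in _) _ =
  [set t | forall i, (A (inl i) `*` A (inr i)) (tnth t i)]); last first.
  apply/seteqP; split => t /= H; last by case=> i _ /=; have [] := H i.
  by move=> i; split; [exact: (H (inl i))|exact: (H (inr i))].
rewrite (@tuple_power_rect _ _ _ (pair_law pf pg) n (fun i => A (inl i) `*` A (inr i))); last first.
  by move=> i; exact: (@measurableX _ _ RM RM _ _ (mA _) (mA _)).
congr EFin; rewrite big_sumType/= -big_split/=; apply: eq_bigr => i _.
have t1 := theta_law i (mA (inl i)); have t2 := xi_law i (mA (inr i)).
rewrite (pair_law_rect (mA (inl i)) (mA (inr i))) fineM; last 2 first.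
- exact: (fin_num_measure (pdf_law pf) _ (mA (inl i))).
- exact: (fin_num_measure (pdf_law pg) _ (mA (inr i))).
by rewrite -t1 -t2.
Qed.

End realization.

(** The observation map: a pair (theta, xi) is seen only through this value. *)
Definition pair_sum (R : realType) (z : measurableTypeR R * measurableTypeR R) : measurableTypeR R :=
  (z.1 : R) + (z.2 : R).

Lemma measurable_pair_sum (R : realType) : measurable_fun setT (@pair_sum R).
Proof.
by apply: (@measurable_funD _ _ R setT fst snd); [exact: measurable_fst|exact: measurable_snd].
Qed.

(** * Reduction of the minimax risk to bounded estimators *)

Section mse_lower_bound.
Context (R : realType) (n : nat) (phi : R -> R) (M : R).
Hypotheses (mphi : measurable_fun setT phi) (phiM : bounded_by M phi).
Local Notation RM := (measurableTypeR R).

Definition clamp (x : R) : R := Num.max (- M) (Num.min M x).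

Let M0 : 0 <= M. Proof. by apply: le_trans (phiM 0). Qed.

Lemma clamp_bound x : `|clamp x| <= M.
Proof.
rewrite ler_norml /clamp le_max lexx/= ge_max ge_min lexx/= andbT.
by have := M0; lra.
Qed.

Lemma clamp_contract x y : `|y| <= M -> (clamp x - y) ^+ 2 <= (x - y) ^+ 2.
Proof.
rewrite ler_norml => /andP[y1 y2]; rewrite /clamp.
have := M0; case: (leP M x) => ?; [case: (leP (- M) M) => ?|case: (leP (- M) x) => ?]; nra.
Qed.

(** Phi_n lies in [-M, M], so clamping an estimator to this interval can only bring it closer. The
    clamped risk is finite even when the risk of [T] is not. *)
Lemma mse_ge_sq_risk (f g : R -> R) (pf : is_pdf f) (pg : is_pdf g)
    (T : n.-tuple R -> R) : measurable_fun setT T ->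
  exists2 r, mse phi f g T r &
    ((@sq_risk _ _ (RM * RM)%type RM R (@pair_sum R) (phi \o fst) n (clamp \o T)
       (pair_law pf pg))%:E <= r)%E.
Proof.
move=> mT.
exists ('E_(tuple_power (pair_law pf pg) n)[fun o => ((T (observations (theta_coord pf pg (n:=n)) (xi_coord pf pg (n:=n)) o)
                        - empirical_functional phi (theta_coord pf pg (n:=n)) o) ^+ 2)%R])%E.
  exists _, (n.-tuple (RM * RM)%type), (tuple_power (pair_law pf pg) n), (theta_coord pf pg (n:=n)), (xi_coord pf pg (n:=n)).
  by split => //; exact: realization_model.
rewrite unlock /sq_risk.
have obsE (t : n.-tuple (RM * RM)%type) : observations (theta_coord pf pg (n:=n)) (xi_coord pf pg (n:=n)) t =
    map_tuple (@pair_sum R) t.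
  by apply: eq_from_tnth => i; rewrite tnth_mktuple tnth_map.
have empE (t : n.-tuple (RM * RM)%type) : empirical_functional phi (theta_coord pf pg (n:=n)) t =
    emp_mean (phi \o fst) t by [].
have mT' : measurable_fun setT (fun t : n.-tuple (RM * RM)%type => T (map_tuple (@pair_sum R) t)).
  exact: (measurableT_comp mT (@measurable_map_tuple _ _ _ _ _ (@measurable_pair_sum R) n)).
have mE : measurable_fun setT (fun t : n.-tuple (RM * RM)%type => emp_mean (phi \o fst) t).
  apply: measurable_funM => //; apply: measurable_sum_tnth.
  exact: (measurableT_comp mphi measurable_fst).
have bE (t : n.-tuple (RM * RM)%type) : `|emp_mean (phi \o fst) t| <= M.
  (* For n = 0 the inverse of 0 is 0 by convention, and the mean is 0. *)
  rewrite /emp_mean; have [n0|n0] := posnP n.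
    have -> : n%:R^-1 = 0 :> R by rewrite n0 invr0.
    by rewrite mul0r normr0.
  rewrite normrM normfV normr_nat ler_pdivrMl ?ltr0n//.
  exact: (@sum_tnth_bound _ (RM * RM)%type R n (phi \o fst) M (fun x => phiM x.1) t).
have mc : measurable_fun setT clamp.
  by apply: measurable_maxr => //; exact: measurable_minr.
have mX : measurable_fun setT (fun t : n.-tuple (RM * RM)%type =>
    ((clamp \o T) (map_tuple (@pair_sum R) t) - emp_mean (phi \o fst) t) ^+ 2).
  by apply: measurable_funX; apply: measurable_funB => //; exact: (measurableT_comp mc mT').
rewrite -RintegralE; last first.
  apply: (@prob_Rintegrable _ _ _ _ _ ((M + M) ^+ 2)) => // t.
  rewrite normrX lerXn2r ?nnegrE//; first by have := M0; lra.
  by apply: (le_trans (ler_normB _ _)); apply: lerD; [exact: clamp_bound|exact: bE].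
apply: ge0_le_integral => //.
- by move=> t _; rewrite lee_fin sqr_ge0.
- exact/measurable_EFinP.
- apply/measurable_EFinP; apply: measurable_funX.
  under eq_fun do rewrite obsE empE.
  exact: measurable_funB.
- by move=> t _; rewrite lee_fin obsE empE; apply: clamp_contract; exact: bE.
Qed.

(** The density may depend on the estimator: the hypothesis receives the clamped estimator, and the
    risk at the density it returns is below the supremum. *)
Lemma minimax_risk_ge (F : set (R -> R)) (g : R -> R) (pg : is_pdf g) (c : R) :
  (forall (h : n.-tuple RM -> R), measurable_fun setT h -> bounded_by M h ->
    exists2 f, F f & exists pf : is_pdf f,
      c <= sq_risk (@pair_sum R) (phi \o fst) h (pair_law pf pg)) ->
  (c%:E <= minimax_risk n F phi g)%E.
Proof.
move=> H; apply: le_ereal_inf_tmp => _ [T /= mT <-].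
have mc : measurable_fun setT clamp.
  by apply: measurable_maxr => //; exact: measurable_minr.
have [|t|f Ff [pf cf]] := H (clamp \o T).
- exact: measurableT_comp.
- exact: clamp_bound.
have [r rm cr] := mse_ge_sq_risk pf pg mT.
apply: (@le_trans _ _ r); first by apply: le_trans cr; rewrite lee_fin.
by apply: ereal_sup_ubound; exists f.
Qed.

End mse_lower_bound.

(** * Cosine transforms *)

Section laplace.
Context (R : realType).
Implicit Types (e w x : R).
Local Notation mu := (@lebesgue_measure R).

(** The integrals of the positive and the negative part are both measurable in the parameter by
    Tonelli, whether or not the sections are integrable. *)
Lemma measurable_section_Rintegral d1 d2 (T1 : measurableType d1)
    (T2 : measurableType d2) (m2 : {sigma_finite_measure set T2 -> \bar R})
    (F : T1 * T2 -> R) : measurable_fun setT F ->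
  measurable_fun setT (fun x : T1 => \int[m2]_y F (x, y)).
Proof.
move=> mF; apply: (measurableT_comp (@fine_measurable R setT measurableT)).
have mE : measurable_fun setT (EFin \o F) by exact/measurable_EFinP.
rewrite (_ : (fun x : T1 => _) = (fun x : T1 =>
    (\int[m2]_y ((EFin \o F)^\+ (x, y)) - \int[m2]_y ((EFin \o F)^\- (x, y)))%E)); last first.
  apply/funext => x; rewrite integralE.
  by congr (_ - _)%E; apply: eq_integral => y _; rewrite ?funepos.unlock ?funeneg.unlock.
apply: emeasurable_funB.
- apply: (measurable_fun_fubini_tonelli_F (EFin \o F)^\+%E) => //.
  exact: measurable_funepos.
- apply: (measurable_fun_fubini_tonelli_F (EFin \o F)^\-%E) => //.
  exact: measurable_funeneg.
Qed.

Lemma is_derive_scale (c x : R) : is_derive x 1 (fun y : R => c * y) c.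
Proof.
have h : is_derive x 1 (c \*: (id : R -> R)) (c *: 1) by exact: is_deriveZ.
by rewrite /GRing.scale/= mulr1 in h.
Qed.

Lemma is_derive_comp_scale (f : R -> R) (c x d : R) :
  is_derive (c * x) 1 f d -> is_derive x 1 (fun y => f (c * y)) (c * d).
Proof.
move=> fd; have h := is_derive_scale c x.
by have := @is_derive1_comp _ f (fun y : R => c * y) x d c fd h; rewrite mulrC.
Qed.

Definition laplace (e x : R) : R := expR (- (e * `|x|)).

Lemma laplace_ge0 e x : 0 <= laplace e x. Proof. exact: expR_ge0. Qed.

Lemma laplaceN e x : laplace e (- x) = laplace e x.
Proof. by rewrite /laplace normrN. Qed.

Lemma laplace_le1 e x : 0 <= e -> laplace e x <= 1.
Proof. by move=> e0; rewrite -expR0 ler_expR oppr_le0 mulr_ge0. Qed.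

Lemma continuous_laplace e : continuous (laplace e).
Proof.
move=> x; apply: continuous_comp; last exact: continuous_expR.
apply: cvgN; apply: cvgM; [exact: cvg_cst|exact: norm_continuous].
Qed.

Lemma measurable_laplace e : measurable_fun setT (laplace e).
Proof. apply: continuous_measurable_fun; exact: continuous_laplace. Qed.

Lemma continuous_cos_scale (w : R) : continuous (fun x : R => cos (w * x)).
Proof.
move=> x; apply: continuous_comp; last exact: continuous_cos.
by apply: cvgM; [exact: cvg_cst|exact: cvg_id].
Qed.

Lemma continuous_sin_scale (w : R) : continuous (fun x : R => sin (w * x)).
Proof.
move=> x; apply: continuous_comp; last exact: continuous_sin.
by apply: cvgM; [exact: cvg_cst|exact: cvg_id].
Qed.

Lemma measurable_cos_scale (w : R) : measurable_fun setT (fun x : R => cos (w * x)).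
Proof. apply: continuous_measurable_fun; exact: continuous_cos_scale. Qed.

Lemma measurable_sin_scale (w : R) : measurable_fun setT (fun x : R => sin (w * x)).
Proof. apply: continuous_measurable_fun; exact: continuous_sin_scale. Qed.

Lemma cvg_expRN_scale (e : R) : 0 < e -> expR (- e * x) @[x --> +oo] --> (0 : R).
Proof.
move=> e0; have h : (e * x) @[x --> +oo] --> +oo.
  apply/cvgryPge => A; apply: filterS (nbhs_pinfty_ge (num_real (e^-1 * A))) => x.
  by rewrite ler_pdivrMl.
under eq_fun do rewrite mulNr.
exact: (cvg_comp _ _ h (@cvgr_expR R)).
Qed.

(* The constant 1 makes the integrand nonnegative, which is all that the
   improper fundamental theorem of calculus of the library covers. *)
Lemma integral_laplace_cos1 (e w : R) : 0 < e ->
  (\int[mu]_x (laplace e x * (1 + cos (w * x)))%:E =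
   (2 / e + 2 * e / (e ^+ 2 + w ^+ 2))%:E)%E.
Proof.
move=> e0; pose k := e ^+ 2 + w ^+ 2.
have k0 : 0 < k by rewrite ltr_wpDr ?sqr_ge0// exprn_gt0.
have c1 x : 0 <= 1 + cos (w * x) by have := cos_geN1 (w * x); lra.
rewrite ge0_symfun_integralT; last 3 first.
- by move=> x; rewrite mulr_ge0// laplace_ge0.
- move=> x; apply: cvgM; first exact: continuous_laplace.
  by apply: cvgD; [exact: cvg_cst|exact: continuous_cos_scale].
- by move=> x /=; rewrite laplaceN mulrN cosN.
pose f (x : R) := expR (- e * x) * (1 + cos (w * x)).
(* The primitive that vanishes at infinity, built from the primitive exp(-e x) (w sin (w x) - e cos
   (w x)) / k of exp(-e x) cos (w x). The half-line integral is the negative of its value at 0. *)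
pose F (x : R) := expR (- e * x) * (- e^-1 + (- e / k) * cos (w * x) + (w / k) * sin (w * x)).
have dF (x : R) : is_derive x 1 F (f x).
  have d1 : is_derive x 1 (fun y => expR (- e * y)) (- e * expR (- e * x)).
    exact: is_derive_comp_scale.
  have d2 : is_derive x 1 (fun y => cos (w * y)) (w * - sin (w * x)).
    exact: is_derive_comp_scale.
  have d3 : is_derive x 1 (fun y => sin (w * y)) (w * cos (w * x)).
    exact: is_derive_comp_scale.
  have := is_deriveM d1 (is_deriveD (is_deriveD (is_derive_cst (- e^-1) x 1) (is_deriveZ (- e / k) d2)) (is_deriveZ (w / k) d3)).
  move=> h; apply: (is_derive_eq h).
  rewrite !fctE /f /k /GRing.scale/= /GRing.scale/=; field.
  by rewrite (gt_eqF e0) (gt_eqF k0).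
have cf : continuous f.
  move=> x; apply: cvgM; last first.
    by apply: cvgD; [exact: cvg_cst|exact: continuous_cos_scale].
  apply: continuous_comp; last exact: continuous_expR.
  by apply: cvgM; [exact: cvg_cst|exact: cvg_id].
have Foo : F x @[x --> +oo] --> (0 : R).
  apply/cvgr0Pnorm_le => d d0.
  pose C := e^-1 + e / k + `|w| / k.
  have C0 : 0 < C by rewrite /C -addrA ltr_wpDr ?invr_gt0// addr_ge0// divr_ge0// ltW.
  have := cvg_expRN_scale e0; move=> /cvgr0Pnorm_le /(_ (d / C)) h.
  have {}h := h (divr_gt0 d0 C0).
  apply: filterS h => x hx; rewrite /F normrM.
  apply: (@le_trans _ _ (d / C * C)); last by rewrite divfK// gt_eqF.
  apply: ler_pM => //; rewrite /C.
  apply: (le_trans (ler_normD _ _)); apply: lerD.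
    apply: (le_trans (ler_normD _ _)); apply: lerD; first by rewrite normrN ger0_norm// invr_ge0 ltW.
    rewrite normrM mulNr normrN [X in X * _]ger0_norm ?divr_ge0// ?(ltW e0) ?(ltW k0)//.
    by rewrite ler_piMr ?divr_ge0 ?cos_max// ltW.
  rewrite normrM normrM normfV (gtr0_norm k0) ler_piMr ?sin_max// divr_ge0//.
  by rewrite ltW.
have -> : [set x : R | 0 <= x] = `[0, +oo[%classic by rewrite set_itvcy.
have -> : (\int[mu]_(x in `[0%R, +oo[) (laplace e x * (1 + cos (w * x)))%:E =
    \int[mu]_(x in `[0%R, +oo[) (f x)%:E)%E.
  apply: eq_integral => x; rewrite inE/= in_itv/= andbT => x0.
  by rewrite /f /laplace ger0_norm// mulNr.
rewrite (@ge0_continuous_FTC2y _ f F 0 0)//.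
- rewrite /F mulr0 expR0 mul1r mulr0 cos0 sin0 mulr0 mulr1 addr0 -EFinB -EFinM.
  by congr EFin; rewrite -/k; field; rewrite (gt_eqF e0) (gt_eqF k0).
- by move=> x x0; rewrite mulr_ge0// expR_ge0.
- exact: continuous_subspaceT.
- apply: cvg_at_right_filter; apply: differentiable_continuous.
  by apply/derivable1_diffP; case: (dF 0).
- by move=> x _; rewrite derive1E; exact: derive_val.
Unshelve. all: by end_near. Qed.

(** The case w = 0 of the preceding integral, where the factor 1 + cos equals 2. *)
Lemma integral_laplace (e : R) : 0 < e ->
  (\int[mu]_x (laplace e x)%:E = (2 / e)%:E)%E.
Proof.
move=> e0; have := integral_laplace_cos1 0 e0.
rewrite (_ : (2 / e + _) = 2 * (2 / e)); last by field; rewrite gt_eqF.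
under eq_integral do rewrite mul0r cos0 mulrC EFinM.
rewrite ge0_integralZl//; last 2 first.
- by apply/measurable_EFinP; exact: measurable_laplace.
- by move=> x _; rewrite lee_fin laplace_ge0.
rewrite EFinM (_ : (1 + 1)%:E = 2%:E)//.
by move/(congr1 (fun z : \bar R => (2^-1)%:E * z)%E); rewrite !muleA -!EFinM mulVf// !mul1e mul1r.
Qed.

Lemma Rintegrable_laplace (e : R) : 0 < e -> Rintegrable mu (laplace e).
Proof.
move=> e0; apply: ge0_Rintegrable.
- exact: measurable_laplace.
- exact: laplace_ge0.
- by rewrite integral_laplace// ltry.
Qed.

(** The transform of [laplace e], equal to 2 pi times the Cauchy density of scale e. It is an
    approximate identity as e tends to 0. *)
Definition cauchy_kernel (e w : R) := 2 * e / (e ^+ 2 + w ^+ 2).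

Lemma Rintegral_laplace_cos (e w : R) : 0 < e ->
  \int[mu]_x (laplace e x * cos (w * x)) = cauchy_kernel e w.
Proof.
move=> e0; have il := Rintegrable_laplace e0.
have ilc := RintegrableM il (measurable_cos_scale w) (fun x => cos_max (w * x)).
have := RintegralE_eq (integral_laplace_cos1 w e0).
under eq_Rintegral do rewrite mulrDr mulr1.
rewrite RintegralD//.
by rewrite (RintegralE_eq (integral_laplace e0)) => /addrI.
Qed.

Lemma Rintegral_odd0 (f : R -> R) : measurable_fun setT f ->
  (forall x, f (- x) = - f x) -> Rintegrable mu f -> \int[mu]_x f x = 0.
Proof.
move=> mf fN intf; have := Rintegral_opp mf.
under eq_Rintegral do rewrite fN -mulN1r.
by rewrite RintegralZl// => h; lra.
Qed.

Lemma Rintegral_laplace_sin (e w : R) : 0 < e ->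
  \int[mu]_x (laplace e x * sin (w * x)) = 0.
Proof.
move=> e0; apply: Rintegral_odd0.
- by apply: measurable_funM; [exact: measurable_laplace|exact: measurable_sin_scale].
- by move=> x; rewrite laplaceN mulrN sinN mulrN.
- exact: (RintegrableM (Rintegrable_laplace e0) (measurable_sin_scale w) (fun x => sin_max (w * x))).
Qed.

Lemma cauchy_kernel_ge0 e w : 0 <= e -> 0 <= cauchy_kernel e w.
Proof. by move=> e0; rewrite divr_ge0 ?mulr_ge0// addr_ge0// sqr_ge0. Qed.

Lemma cauchy_kernel_denom (e w : R) : 0 < e -> 0 < e ^+ 2 + w ^+ 2.
Proof. by move=> e0; rewrite ltr_wpDr ?sqr_ge0// exprn_gt0. Qed.

Lemma cauchy_kernelN e w : cauchy_kernel e (- w) = cauchy_kernel e w.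
Proof. by rewrite /cauchy_kernel sqrrN. Qed.

Lemma cauchy_kernel_le e w : 0 < e -> cauchy_kernel e w <= 2 / e.
Proof.
move=> e0; rewrite /cauchy_kernel ler_pdivrMr ?cauchy_kernel_denom//.
rewrite mulrAC ler_pdivlMr//; have := sqr_ge0 w; nra.
Qed.

Lemma continuous_cauchy_kernel e : 0 < e -> continuous (cauchy_kernel e).
Proof.
move=> e0 w; apply: cvgM; first exact: cvg_cst.
apply: cvgV; first by rewrite gt_eqF// cauchy_kernel_denom.
apply: cvgD; first exact: cvg_cst.
exact: exprn_continuous.
Qed.

Lemma measurable_cauchy_kernel e : 0 < e -> measurable_fun setT (cauchy_kernel e).
Proof. by move=> e0; apply: continuous_measurable_fun; exact: continuous_cauchy_kernel. Qed.

Lemma integral_cauchy_kernel (e : R) : 0 < e ->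
  (\int[mu]_x (cauchy_kernel e x)%:E = (2 * pi)%:E)%E.
Proof.
move=> e0.
rewrite ge0_symfun_integralT; last 3 first.
- by move=> x; exact: cauchy_kernel_ge0 (ltW e0).
- exact: continuous_cauchy_kernel.
- by move=> x /=; rewrite cauchy_kernelN.
have -> : [set x : R | 0 <= x] = `[0, +oo[%classic by rewrite set_itvcy.
pose F (x : R) := 2 * atan (e^-1 * x).
have dF (x : R) : is_derive x 1 F (cauchy_kernel e x).
  have d1 : is_derive x 1 (fun y => atan (e^-1 * y)) (e^-1 * (1 + (e^-1 * x) ^+ 2)^-1).
    exact: is_derive_comp_scale.
  apply: (is_derive_eq (is_deriveZ 2 d1)); rewrite /GRing.scale/= /cauchy_kernel; field.
  rewrite (gt_eqF e0) (gt_eqF (cauchy_kernel_denom x e0))//=.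
rewrite (@ge0_continuous_FTC2y _ (cauchy_kernel e) F 0 pi)//.
- by rewrite /F mulr0 atan0 mulr0 sube0.
- by move=> x _; exact: cauchy_kernel_ge0 (ltW e0).
- exact/continuous_subspaceT/continuous_cauchy_kernel.
- rewrite [X in _ --> X](_ : pi = 2 * (pi / 2)); last by field.
  apply: cvgM; first exact: cvg_cst.
  have h : (e^-1 * x) @[x --> +oo] --> +oo.
    apply/cvgryPge => A; apply: filterS (nbhs_pinfty_ge (num_real (e * A))) => x.
    by rewrite ler_pdivlMl.
  exact: (cvg_comp _ _ h (@cvgy_atan R)).
- apply: cvg_at_right_filter; apply: differentiable_continuous.
  by apply/derivable1_diffP; case: (dF 0).
- by move=> x _; rewrite derive1E; exact: derive_val.
Unshelve. all: by end_near. Qed.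

Lemma Rintegrable_cauchy_kernel e : 0 < e -> Rintegrable mu (cauchy_kernel e).
Proof.
move=> e0; apply: ge0_Rintegrable.
- exact: measurable_cauchy_kernel.
- by move=> x; exact: cauchy_kernel_ge0 (ltW e0).
- by rewrite integral_cauchy_kernel// ltry.
Qed.

End laplace.

(** * Limits under the integral sign *)

Section limits.
Context d (T : measurableType d) (R : realType) (mu : {measure set T -> \bar R}).

Lemma cvg_limn_einf_eq (u : nat -> \bar R) (l : \bar R) :
  u @ \oo --> l -> limn_einf u = l.
Proof. by move=> ul; rewrite is_cvg_limn_einfE; [exact/cvg_lim|apply/cvg_ex; exists l]. Qed.

(** Fatou's lemma in the form needed for energies: bounds on approximations pass to the limit, whose
    integral is not known to be finite beforehand. *)
Lemma fatou_bound (f_ : nat -> T -> R) (f : T -> R) (C_ : nat -> \bar R) (C : \bar R) :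
  (forall n, measurable_fun setT (f_ n)) -> (forall n x, 0 <= f_ n x) ->
  (forall x, f_ n x @[n --> \oo] --> f x) ->
  (forall n, (\int[mu]_x (f_ n x)%:E <= C_ n)%E) ->
  (C_ n @[n --> \oo] --> C)%E ->
  (\int[mu]_x (f x)%:E <= C)%E.
Proof.
move=> mf f0 ff fC CC.
have mfE n : measurable_fun setT (EFin \o f_ n) by exact/measurable_EFinP.
have := @fatou _ _ _ mu setT measurableT (fun n => EFin \o f_ n) mfE (fun n x _ => _).
move=> /(_ _)/wrap[n x|]; first by rewrite lee_fin.
rewrite (_ : (\int[mu]_x _)%E = (\int[mu]_x (f x)%:E)%E); last first.
  apply: eq_integral => x _; apply: cvg_limn_einf_eq.
  by apply: cvg_EFin; [exact: nearW|exact: ff].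
move/le_trans; apply.
rewrite -(cvg_limn_einf_eq CC).
rewrite !limn_einf_lim; apply: lee_lim; [exact: is_cvg_einfs|exact: is_cvg_einfs|].
apply: nearW => n; apply: le_ereal_inf_tmp => _ [m nm <-].
by apply: le_trans (fC m); apply: ereal_inf_lbound; exists m.
Qed.

Lemma cvg_dominated_Rintegral (f_ : nat -> T -> R) (f g : T -> R) :
  (forall n, measurable_fun setT (f_ n)) -> measurable_fun setT f ->
  (forall x, f_ n x @[n --> \oo] --> f x) ->
  (forall n x, `|f_ n x| <= g x) -> Rintegrable mu g ->
  \int[mu]_x f_ n x @[n --> \oo] --> \int[mu]_x f x.
Proof.
move=> mf_ mf ff fg ig.
have [|||||/= fi _ cv] := @dominated_convergence _ _ _ mu setT measurableT
  (fun n => EFin \o f_ n) (EFin \o f) (EFin \o g).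
- by move=> n; exact/measurable_EFinP.
- exact/measurable_EFinP.
- by apply: aeW => x _; apply: cvg_EFin; [exact: nearW|exact: ff].
- exact: ig.
- by apply: aeW => x n _; rewrite /= lee_fin fg.
have fin n : Rintegrable mu (f_ n) by exact: le_Rintegrable ig.
rewrite /Rintegral; apply: fine_cvg.
rewrite fineK; last exact: integrable_fin_num.
exact: cv.
Qed.

End limits.

(** * Cosine integrals with a phase: Bessel inequality and inversion *)

Section oscillatory.
Context (R : realType).
Local Notation mu := (@lebesgue_measure R).
Local Notation RM := (measurableTypeR R).
Implicit Types (h : R -> R) (psi x y e w : R).

(** For integrable [h], the real part of exp(-i psi) times the Fourier transform. The phase 0 gives
    the real part and pi / 2 the imaginary part, so that one statement covers both. *)
Definition osc psi h x := \int[mu]_y (h y * cos (x * y - psi)).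

Lemma measurable_phase psi : measurable_fun setT (fun z : RM * RM => cos ((z.1 : R) * (z.2 : R) - psi)).
Proof.
apply: (measurableT_comp (f := @cos R)).
  by apply: continuous_measurable_fun; exact: continuous_cos.
apply: measurable_funB => //.
by apply: (@measurable_funM _ _ R setT fst snd); [exact: measurable_fst|exact: measurable_snd].
Qed.

Lemma measurable_phase1 psi w : measurable_fun setT (fun x : R => cos (w * x - psi)).
Proof.
apply: (measurableT_comp (f := @cos R)).
  by apply: continuous_measurable_fun; exact: continuous_cos.
by apply: measurable_funB => //; exact: measurable_funM.
Qed.

Lemma measurable_phase2 psi w : measurable_fun setT (fun x : R => cos (x * w - psi)).
Proof.
rewrite (_ : (fun x => _) = (fun x : R => cos (w * x - psi))); first exact: measurable_phase1.
by apply/funext => x; rewrite mulrC.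
Qed.

Lemma osc_bound psi h x : Rintegrable mu h -> `|osc psi h x| <= \int[mu]_y `|h y|.
Proof.
move=> ih; rewrite -[leRHS]mul1r; apply: RintegralM_le => //; last by move=> y; exact: cos_max.
exact: measurable_phase1.
Qed.

Lemma measurable_osc psi h : Rintegrable mu h -> measurable_fun setT (osc psi h).
Proof.
move=> ih; apply: (@measurable_section_Rintegral R _ _ RM RM lebesgue_measure
  (fun z => h z.2 * cos ((z.1 : R) * z.2 - psi))).
apply: (@measurable_funM _ _ R); last exact: measurable_phase.
exact: (measurableT_comp (Rintegrable_measurable ih) measurable_snd).
Qed.

(** What a product of two cosines becomes when integrated against [laplace e]: the product formula
    produces the frequencies y - z and y + z, and the sine left over by the phase 2 psi is odd and
    integrates to 0. *)
Definition phase_kernel psi e y z :=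
  2^-1 * (cauchy_kernel e (y - z) + cos (2 * psi) * cauchy_kernel e (y + z)).

Lemma Rintegral_laplace_phase psi e y z : 0 < e ->
  \int[mu]_x (laplace e x * (cos (x * y - psi) * cos (x * z - psi))) =
  phase_kernel psi e y z.
Proof.
move=> e0; have il := Rintegrable_laplace e0.
have ic w : Rintegrable mu (fun x => laplace e x * cos (w * x)).
  exact: (RintegrableM il (measurable_cos_scale w) (fun x => cos_max (w * x))).
have isn w : Rintegrable mu (fun x => laplace e x * sin (w * x)).
  exact: (RintegrableM il (measurable_sin_scale w) (fun x => sin_max (w * x))).
transitivity (\int[mu]_x (2^-1 * (laplace e x * cos ((y - z) * x)) +
   (2^-1 * cos (2 * psi) * (laplace e x * cos ((y + z) * x)) +
   (2^-1 * sin (2 * psi) * (laplace e x * sin ((y + z) * x)))))).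
  apply: eq_Rintegral => x _.
  have -> : cos (x * y - psi) * cos (x * z - psi) =
      2^-1 * (cos ((y - z) * x) + cos ((y + z) * x - 2 * psi)).
    have -> : (y - z) * x = (x * y - psi) - (x * z - psi) by ring.
    have -> : (y + z) * x - 2 * psi = (x * y - psi) + (x * z - psi) by ring.
    by move: (x * y - psi) (x * z - psi) => p q; rewrite cosB cosD; field.
  by rewrite (cosB ((y + z) * x)); ring.
rewrite RintegralD//; [|exact: RintegrableZ|]; last first.
  by apply: RintegrableD; exact: RintegrableZ.
rewrite RintegralD//; [|exact: RintegrableZ|exact: RintegrableZ].
rewrite (RintegralZl _ measurableT (ic (y - z))) (RintegralZl _ measurableT (ic (y + z)))
  (RintegralZl _ measurableT (isn (y + z))).
rewrite !Rintegral_laplace_cos// Rintegral_laplace_sin// mulr0 addr0 /phase_kernel; ring.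
Qed.

Lemma Rintegral_laplace_osc psi h e w : Rintegrable mu h -> 0 < e ->
  \int[mu]_x (laplace e x * cos (x * w - psi) * osc psi h x) =
  \int[mu]_y (h y * phase_kernel psi e w y).
Proof.
move=> ih e0; have il := Rintegrable_laplace e0.
have ilc : Rintegrable mu (fun x => laplace e x * cos (x * w - psi)).
  exact: (RintegrableM il (measurable_phase2 psi w) (fun x => cos_max _)).
rewrite (@Rintegral_swap _ _ RM RM R lebesgue_measure lebesgue_measure
  (fun x => laplace e x * cos (x * w - psi)) h _ 1 ilc ih (measurable_phase psi) (fun z => cos_max _)).
apply: eq_Rintegral => y _; congr (_ * _).
rewrite -Rintegral_laplace_phase//; apply: eq_Rintegral => x _.
by rewrite mulrA.
Qed.

Lemma measurable_phase_kernel psi e : 0 < e ->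
  measurable_fun setT (fun z : RM * RM => phase_kernel psi e z.1 z.2).
Proof.
move=> e0; have mK := measurable_cauchy_kernel e0.
have m1 : measurable_fun setT (fun z : RM * RM => z.1 : R) := measurable_fst.
have m2 : measurable_fun setT (fun z : RM * RM => z.2 : R) := measurable_snd.
apply: measurable_funM => //; apply: measurable_funD.
  by apply: (measurableT_comp mK); exact: measurable_funB.
apply: measurable_funM => //.
by apply: (measurableT_comp mK); exact: measurable_funD.
Qed.

Lemma phase_kernel_abs psi e y z : 0 < e ->
  `|phase_kernel psi e y z| <= phase_kernel 0 e y z.
Proof.
move=> e0; rewrite /phase_kernel normrM gtr0_norm ?invr_gt0//.
rewrite ler_pM2l ?invr_gt0// mulr0 cos0 mul1r.
apply: (le_trans (ler_normD _ _)); have k0 w := cauchy_kernel_ge0 w (ltW e0).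
rewrite (ger0_norm (k0 _)) lerD2l normrM (ger0_norm (k0 _)) ler_piMl//.
exact: cos_max.
Qed.

Lemma phase_kernel0_ge0 e y z : 0 < e -> 0 <= phase_kernel 0 e y z.
Proof. by move=> e0; apply: le_trans (phase_kernel_abs 0 y z e0). Qed.

Lemma phase_kernel0_bound e y z : 0 < e -> phase_kernel 0 e y z <= 2 / e.
Proof.
move=> e0; rewrite /phase_kernel mulr0 cos0 mul1r.
by have := cauchy_kernel_le (y - z) e0; have := cauchy_kernel_le (y + z) e0; lra.
Qed.

Lemma phase_kernel0C e y z : phase_kernel 0 e y z = phase_kernel 0 e z y.
Proof. by rewrite /phase_kernel -(opprB z y) cauchy_kernelN (addrC y z). Qed.

Lemma integral_phase_kernel0 e y : 0 < e ->
  (\int[mu]_z (phase_kernel 0 e y z)%:E = (2 * pi)%:E)%E.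
Proof.
move=> e0; have mK := measurable_cauchy_kernel e0.
have iK := Rintegrable_cauchy_kernel e0.
have E := RintegralE_eq (integral_cauchy_kernel e0).
have i1 : Rintegrable mu (fun z => cauchy_kernel e (z + y)) by exact: Rintegrable_shift.
have i2 : Rintegrable mu (fun z => cauchy_kernel e (z + - y)) by exact: Rintegrable_shift.
have e1 : \int[mu]_z cauchy_kernel e (z + y) = 2 * pi by rewrite Rintegral_shift.
have e2 : \int[mu]_z cauchy_kernel e (z + - y) = 2 * pi by rewrite Rintegral_shift.
have PE z : phase_kernel 0 e y z = 2^-1 * cauchy_kernel e (z + y) + 2^-1 * cauchy_kernel e (z + - y).
  by rewrite /phase_kernel mulr0 cos0 mul1r -opprB cauchy_kernelN mulrDr addrC [y + z]addrC.
under eq_integral do rewrite PE.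
rewrite RintegralE; last by apply: RintegrableD; exact: RintegrableZ.
congr EFin; rewrite RintegralD//; [|exact: RintegrableZ|exact: RintegrableZ].
transitivity (2^-1 * (2 * pi) + 2^-1 * (2 * pi) : R); last by field.
by congr (_ + _); rewrite RintegralZl//; congr (_ * _); [exact: e1|exact: e2].
Qed.

Lemma cvg_laplace1 x : laplace n.+1%:R^-1 x @[n --> \oo] --> (1 : R).
Proof.
have h : - (n.+1%:R^-1 * `|x|) @[n --> \oo] --> (0 : R).
  rewrite -oppr0; apply: cvgN; rewrite -(mul0r `|x|).
  by apply: cvgM; [exact: cvg_harmonic|exact: cvg_cst].
rewrite -[X in _ --> X]expR0; apply: (@continuous_cvg _ _ _ _ _ _ expR) => //.
exact: continuous_expR.
Qed.

(** A Schur test. The factor [laplace e] legitimates an exchange of integrals, after which the left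
    side is the quadratic form of [phase_kernel psi e] at [h]. The kernel is dominated by
    [phase_kernel 0 e], which has mass 2 pi in either variable, and the product of two values of |h|
    is at most half the sum of their squares. *)
Lemma laplace_bessel psi h e : Rintegrable mu h -> Rintegrable mu (fun y => h y ^+ 2) ->
  0 < e ->
  (\int[mu]_x (laplace e x * osc psi h x ^+ 2)%:E <=
   (2 * pi * \int[mu]_y (h y ^+ 2))%:E)%E.
Proof.
move=> ih ih2 e0; have il := Rintegrable_laplace e0.
have mo := measurable_osc psi ih; have bo x := osc_bound psi x ih.
have ilo : Rintegrable mu (fun x => laplace e x * osc psi h x) := RintegrableM il mo bo.
have mh := Rintegrable_measurable ih.
have iloo : Rintegrable mu (fun x => laplace e x * osc psi h x * osc psi h x) := RintegrableM ilo mo bo.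
rewrite (_ : (\int[mu]_x (laplace e x * osc psi h x ^+ 2)%:E)%E =
   (\int[mu]_x (laplace e x * osc psi h x * osc psi h x)%:E)%E); last first.
  by apply: eq_integral => x _; rewrite expr2 mulrA.
rewrite RintegralE//.
have mD := measurable_phase_kernel psi e0; have mD0 := measurable_phase_kernel 0 e0.
have bD z : `|phase_kernel psi e z.1 z.2| <= 2 / e.
  by apply: (le_trans (phase_kernel_abs _ _ _ e0)); exact: phase_kernel0_bound.
have -> : \int[mu]_x (laplace e x * osc psi h x * osc psi h x) =
    \int[mu]_y (h y * \int[mu]_z (h z * phase_kernel psi e y z)).
  rewrite (@Rintegral_swap _ _ RM RM R lebesgue_measure lebesgue_measure
    (fun x => laplace e x * osc psi h x) h _ 1 ilo ih (measurable_phase psi) (fun z => cos_max _)).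
  apply: eq_Rintegral => y _; congr (_ * _).
  rewrite -(Rintegral_laplace_osc psi y ih e0); apply: eq_Rintegral => x _; exact: mulrAC.
rewrite -(@Rintegral_prod1 _ _ RM RM R lebesgue_measure lebesgue_measure h h
   (fun z => phase_kernel psi e z.1 z.2) (2 / e) ih ih mD bD).
have ip := @Rintegrable_prod _ _ RM RM R lebesgue_measure lebesgue_measure h h
   (fun z => phase_kernel psi e z.1 z.2) (2 / e) ih ih mD bD.
rewrite -RintegralE//.
apply: (@le_trans _ _ (\int[(lebesgue_measure \x lebesgue_measure)%E]_z
  ((2^-1 * (h z.1 ^+ 2 * phase_kernel 0 e z.1 z.2))%:E + (2^-1 * (h z.2 ^+ 2 * phase_kernel 0 e z.1 z.2))%:E))%E).
  apply: (le_trans (lee_abs _)); apply: (le_trans (le_abse_integral _ _ _)) => //.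
    by apply/measurable_EFinP; exact: Rintegrable_measurable ip.
  have m1 : measurable_fun setT (fun z : RM * RM => h z.1) := measurableT_comp mh measurable_fst.
  have m2 : measurable_fun setT (fun z : RM * RM => h z.2) := measurableT_comp mh measurable_snd.
  apply: ge0_le_integral => //.
  - by apply: measurableT_comp => //; apply/measurable_EFinP; exact: Rintegrable_measurable ip.
  - apply/measurable_EFinP; apply: measurable_funD; apply: measurable_funM => //; apply: measurable_funM => //;
      exact: measurable_funX.
  move=> z _; rewrite /= -EFinD lee_fin normrM (normrM (h z.2)) mulrA.
  have := phase_kernel_abs psi z.1 z.2 e0; have := phase_kernel0_ge0 z.1 z.2 e0.
  have := sqr_ge0 (`|h z.1| - `|h z.2|); rewrite sqrrB !real_normK ?num_real//.
  set A := `|h z.1|; set B := `|h z.2|.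
  have : 0 <= A * B by exact: (mulr_ge0 (normr_ge0 _) (normr_ge0 _)).
  rewrite -mulr_natr; nra.
have mF1 : measurable_fun setT (fun z : RM * RM => 2^-1 * (h z.1 ^+ 2 * phase_kernel 0 e z.1 z.2)).
  apply: measurable_funM => //; apply: measurable_funM => //; apply: measurable_funX.
  exact: measurableT_comp mh measurable_fst.
have mF2 : measurable_fun setT (fun z : RM * RM => 2^-1 * (h z.2 ^+ 2 * phase_kernel 0 e z.1 z.2)).
  apply: measurable_funM => //; apply: measurable_funM => //; apply: measurable_funX.
  exact: measurableT_comp mh measurable_snd.
have p0 z1 z2 := phase_kernel0_ge0 z1 z2 e0.
have F10 (z : RM * RM) : 0 <= 2^-1 * (h z.1 ^+ 2 * phase_kernel 0 e z.1 z.2).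
  by rewrite mulr_ge0// mulr_ge0// sqr_ge0.
have F20 (z : RM * RM) : 0 <= 2^-1 * (h z.2 ^+ 2 * phase_kernel 0 e z.1 z.2).
  by rewrite mulr_ge0// mulr_ge0// sqr_ge0.
have msec y : measurable_fun setT (fun z : R => phase_kernel 0 e y z).
  have mK := measurable_cauchy_kernel e0.
  apply: measurable_funM => //; apply: measurable_funD.
    by apply: (measurableT_comp mK); exact: measurable_funB.
  by apply: measurable_funM => //; apply: (measurableT_comp mK); exact: measurable_funD.
have I y : (\int[mu]_z (2^-1 * (h y ^+ 2 * phase_kernel 0 e y z))%:E = (pi * h y ^+ 2)%:E)%E.
  under eq_integral do rewrite mulrA EFinM.
  rewrite ge0_integralZl//; last 3 first.
  - by apply/measurable_EFinP; exact: msec.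
  - by move=> z _; rewrite lee_fin.
  - by rewrite lee_fin mulr_ge0// sqr_ge0.
  by rewrite integral_phase_kernel0// -EFinM; congr EFin; field.
rewrite ge0_integralD//; do ?[exact/measurable_EFinP|by move=> z _; rewrite lee_fin].
rewrite fubini_tonelli1//; do ?[exact/measurable_EFinP|by move=> z; rewrite lee_fin].
rewrite fubini_tonelli2//; do ?[exact/measurable_EFinP|by move=> z; rewrite lee_fin].
rewrite /fubini_F /fubini_G/=.
under eq_integral do rewrite I.
under [X in (_ + X)%E]eq_integral => y _.
  under eq_integral do rewrite phase_kernel0C.
  rewrite I; over.
rewrite RintegralE; last exact: RintegrableZ.
by rewrite -EFinD RintegralZl// lee_fin; lra.
Qed.

(** The regularized bound does not depend on e, so Fatou removes the regularization. *)
Lemma bessel psi h : Rintegrable mu h -> Rintegrable mu (fun y => h y ^+ 2) ->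
  (\int[mu]_x (osc psi h x ^+ 2)%:E <= (2 * pi * \int[mu]_y (h y ^+ 2))%:E)%E.
Proof.
move=> ih ih2; have mo := measurable_osc psi ih.
apply: (@fatou_bound _ RM R mu (fun n x => laplace n.+1%:R^-1 x * osc psi h x ^+ 2) _
   (fun n => (2 * pi * \int[mu]_y (h y ^+ 2))%:E)).
- move=> n; apply: measurable_funM; first exact: measurable_laplace.
  exact: measurable_funX.
- by move=> n x; rewrite mulr_ge0 ?laplace_ge0 ?sqr_ge0.
- move=> x; rewrite -[X in _ --> X]mul1r; apply: cvgM; last exact: cvg_cst.
  exact: cvg_laplace1.
- by move=> n; apply: laplace_bessel; rewrite // invr_gt0.
- exact: cvg_cst.
Qed.

Lemma approx_identity h M w : measurable_fun setT h -> (forall y, `|h y| <= M) ->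
  {for w, continuous h} ->
  \int[mu]_y (h y * cauchy_kernel n.+1%:R^-1 (y - w)) @[n --> \oo] --> 2 * pi * h w.
Proof.
move=> mh hM ch.
have M0 : 0 <= M by apply: le_trans (hM 0).
have iK (e : R) (e0 : 0 < e) : Rintegrable mu (fun y => cauchy_kernel e (y + - w)).
  by apply: Rintegrable_shift; exact: Rintegrable_cauchy_kernel.
have EK (e : R) (e0 : 0 < e) : \int[mu]_y cauchy_kernel e (y + - w) = 2 * pi.
  by rewrite Rintegral_shift ?(RintegralE_eq (integral_cauchy_kernel e0))//; exact: measurable_cauchy_kernel.
apply/cvgrPdist_le => eta eta0.
have pi0 : 0 < pi :> R := pi_gt0 R.
pose eta' := eta / (4 * pi); have eta'0 : 0 < eta' by rewrite divr_gt0// mulr_gt0.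
have /cvgrPdist_le /(_ _ eta'0)[del /= del0 hdel] := ch.
(* Where |y - w| >= del, the kernel of scale e is at most e (1 + del^-2) times the kernel of scale
   1. The tail therefore contributes at most e A times a fixed integral. *)
pose A := 2 * M * (1 + del ^- 2).
have A0 : 0 <= A by rewrite !mulr_ge0// addr_ge0// invr_ge0 exprn_ge0// ltW.
have cv := @cvg_harmonic R; move/cvgr0Pnorm_le: cv.
have d0 : 0 < eta / (4 * pi * (A + 1)) by rewrite divr_gt0// !mulr_gt0// ltr_wpDl.
move=> /(_ _ d0); apply: filterS => n /=.
set e := n.+1%:R^-1; have e0 : 0 < e by rewrite /e invr_gt0.
rewrite gtr0_norm// => ee.
have iKe := iK _ e0; have ihK := RintegrableMl iKe mh hM.
have -> : 2 * pi * h w = \int[mu]_y (h w * cauchy_kernel e (y - w)).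
  by rewrite RintegralZl// EK// mulrC.
rewrite -RintegralB//; last exact: RintegrableZ.
have i1 : Rintegrable mu (fun y => cauchy_kernel 1 (y + - w)) by exact: iK.
apply: (@le_trans _ _ (\int[mu]_y (eta' * cauchy_kernel e (y + - w) + (e * A) * cauchy_kernel 1 (y + - w)))).
  apply: normr_Rintegral_le.
  - by apply: RintegrableB => //; exact: RintegrableZ.
  - by apply: RintegrableD; exact: RintegrableZ.
  move=> y; rewrite -mulrBl normrM (ger0_norm (cauchy_kernel_ge0 _ (ltW e0))).
  have K1 := cauchy_kernel_ge0 (y - w) (ltW e0).
  have K2 := cauchy_kernel_ge0 (y - w) (@ler01 R).
  have [yw|yw] := ltP `|w - y| del.
    apply: (@le_trans _ _ (eta' * cauchy_kernel e (y - w))).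
      by apply: ler_wpM2r => //; exact: hdel.
    by rewrite lerDl; apply: mulr_ge0 => //; apply: mulr_ge0 => //; exact: ltW.
  apply: (@le_trans _ _ (e * A * cauchy_kernel 1 (y - w))); last first.
    by rewrite lerDr; apply: mulr_ge0 => //; exact: ltW.
  apply: (@le_trans _ _ (2 * M * cauchy_kernel e (y - w))).
    apply: ler_wpM2r => //; apply: (le_trans (ler_normB _ _)).
    by rewrite mulr_natl mulr2n lerD.
  have -> : e * A * cauchy_kernel 1 (y - w) =
      2 * M * (e * (1 + del ^- 2) * cauchy_kernel 1 (y - w)) by rewrite /A; ring.
  apply: ler_wpM2l; first by rewrite mulr_ge0.
  have dw : del ^+ 2 <= (y - w) ^+ 2.
    by rewrite -[leRHS]real_normK ?num_real// distrC lerXn2r ?nnegrE// ltW.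
  rewrite /cauchy_kernel; set t := (y - w) ^+ 2 in dw *.
  have del20 : 0 < del ^+ 2 by rewrite exprn_gt0.
  have t0 : 0 < t by exact: lt_le_trans dw.
  rewrite ler_pdivrMr ?ltr_wpDl ?sqr_ge0//.
  have -> : e * (1 + del ^- 2) * (2 * 1 / (1 ^+ 2 + t)) * (e ^+ 2 + t) =
    2 * e * ((1 + del ^- 2) * (e ^+ 2 + t) / (1 + t)) by rewrite expr1n mulr1; ring.
  apply: ler_peMr; first by rewrite mulr_ge0// ltW.
  rewrite ler_pdivlMr ?mul1r; last by rewrite ltr_wpDl.
  have : 1 <= del ^- 2 * t by rewrite mulrC ler_pdivlMr// mul1r.
  have e20 := sqr_ge0 e; have di : 0 <= del ^- 2 by rewrite invr_ge0 ltW.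
  have := mulr_ge0 di e20; nra.
rewrite RintegralD//; [|exact: RintegrableZ|exact: RintegrableZ].
have -> : \int[mu]_y (eta' * cauchy_kernel e (y - w)) = eta' * (2 * pi).
  by rewrite RintegralZl//; congr (_ * _); exact: EK.
have -> : \int[mu]_y (e * A * cauchy_kernel 1 (y - w)) = e * A * (2 * pi).
  by rewrite RintegralZl//; congr (_ * _); exact: EK.
have : e * (4 * pi * (A + 1)) <= eta by rewrite -ler_pdivlMr// !mulr_gt0// ltr_wpDl.
have : eta' * (2 * pi) = eta / 2.
  rewrite /eta'; move: pi0; move: (pi : R) => p p0; field; by rewrite gt_eqF.
by have := mulr_gt0 e0 pi0; nra.
Qed.

(** Inserting [laplace] of scale 1/(n+1) turns the left side into the integral of [h] against
    [phase_kernel], which is an approximate identity at w and at - w; dominated convergence removes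
    the factor. The phase 0 returns the even part of [h] and pi / 2 its odd part, up to 2 pi. *)
Lemma osc_inversion psi h M w : Rintegrable mu h -> (forall y, `|h y| <= M) ->
  {for w, continuous h} -> {for - w, continuous h} -> Rintegrable mu (osc psi h) ->
  osc psi (osc psi h) w = pi * (h w + cos (2 * psi) * h (- w)).
Proof.
move=> ih hM c1 c2 io; have mh := Rintegrable_measurable ih.
have mo := measurable_osc psi ih.
have L : \int[mu]_x (laplace n.+1%:R^-1 x * cos (x * w - psi) * osc psi h x) @[n --> \oo] -->
    osc psi (osc psi h) w.
  apply: (@cvg_dominated_Rintegral _ RM R mu _ _ (fun x => `|osc psi h x|)).
  - move=> n; apply: measurable_funM => //; apply: measurable_funM.
      exact: measurable_laplace.
    exact: measurable_phase2.
  - by apply: measurable_funM => //; exact: measurable_phase1.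
  - move=> x; rewrite [osc psi h x * _]mulrC (mulrC w x); apply: cvgM; last exact: cvg_cst.
    rewrite -[X in _ --> X]mul1r; apply: cvgM; last exact: cvg_cst.
    exact: cvg_laplace1.
  - move=> n x; rewrite !normrM -[leRHS]mul1r ler_wpM2r//.
    rewrite -[leRHS]mulr1; apply: ler_pM => //; last exact: cos_max.
    by rewrite ger0_norm ?laplace_ge0// laplace_le1// invr_ge0.
  - exact: Rintegrable_abs.
have E n : \int[mu]_y (h y * phase_kernel psi n.+1%:R^-1 w y) =
   2^-1 * \int[mu]_y (h y * cauchy_kernel n.+1%:R^-1 (y - w)) +
   (2^-1 * cos (2 * psi)) * \int[mu]_y (h y * cauchy_kernel n.+1%:R^-1 (y - - w)).
  have e0 : 0 < n.+1%:R^-1 :> R by rewrite invr_gt0.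
  have iK v : Rintegrable mu (fun y => h y * cauchy_kernel n.+1%:R^-1 (y - v)).
    by apply: (RintegrableMl _ mh hM); apply: Rintegrable_shift; exact: Rintegrable_cauchy_kernel.
  transitivity (\int[mu]_y (2^-1 * (h y * cauchy_kernel n.+1%:R^-1 (y - w)) +
      2^-1 * cos (2 * psi) * (h y * cauchy_kernel n.+1%:R^-1 (y - - w)))).
    apply: eq_Rintegral => y _; rewrite /phase_kernel -(opprB y w) cauchy_kernelN opprK (addrC w).
    ring.
  rewrite RintegralD//; [|exact: RintegrableZ|exact: RintegrableZ].
  by rewrite (RintegralZl _ measurableT (iK w)) (RintegralZl _ measurableT (iK (- w))).
apply: (cvg_unique (@norm_hausdorff _ R^o) L) => /=.
rewrite (_ : (fun n => _) = (fun n => 2^-1 * \int[mu]_y (h y * cauchy_kernel n.+1%:R^-1 (y - w)) +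
   (2^-1 * cos (2 * psi)) * \int[mu]_y (h y * cauchy_kernel n.+1%:R^-1 (y - - w)))); last first.
  by apply/funext => n; rewrite Rintegral_laplace_osc ?invr_gt0.
rewrite (_ : pi * _ = 2^-1 * (2 * pi * h w) + (2^-1 * cos (2 * psi)) * (2 * pi * h (- w))); last by field.
by apply: cvgD; (apply: cvgM; first exact: cvg_cst); exact: approx_identity hM _.
Qed.

End oscillatory.

(** * Weighted square norms of cosine integrals *)

Section oscillatory_weights.
Context (R : realType).
Local Notation mu := (@lebesgue_measure R).
Local Notation RM := (measurableTypeR R).
Implicit Types (h : R -> R) (psi x y e w : R).

Lemma oscD psi h1 h2 x : Rintegrable mu h1 -> Rintegrable mu h2 ->
  osc psi (fun y => h1 y + h2 y) x = osc psi h1 x + osc psi h2 x.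
Proof.
move=> i1 i2; have m1 := measurable_phase1 psi x.
rewrite /osc -RintegralD//; [|exact: (RintegrableM i1 m1 (fun y => cos_max _))|exact: (RintegrableM i2 m1 (fun y => cos_max _))].
by apply: eq_Rintegral => y _; rewrite mulrDl.
Qed.

Lemma oscZ psi h c x : Rintegrable mu h ->
  osc psi (fun y => c * h y) x = c * osc psi h x.
Proof.
move=> i1; have m1 := measurable_phase1 psi x.
rewrite /osc -RintegralZl//; last exact: (RintegrableM i1 m1 (fun y => cos_max _)).
by apply: eq_Rintegral => y _; rewrite mulrA.
Qed.

(** The derivative of t -> sin (x t) at 0, read along t = 1/(n+1). *)
Lemma cvg_sinc x : n.+1%:R * sin (x * n.+1%:R^-1) @[n --> \oo] --> x.
Proof.
have d : is_derive (0 : R) 1 (fun t => sin (x * t)) (x * cos (x * 0)).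
  exact: is_derive_comp_scale.
have [dd dv] := d; rewrite mulr0 cos0 mulr1 in dv.
move: dd; rewrite /derivable => dd.
have := dd; rewrite -[in X in X -> _]/(cvg _) => /cvg_ex[l lP].
have lx : l = x by rewrite -dv; apply/esym/cvg_lim.
rewrite lx in lP; move/cvgr_dnbhsP : lP => /(_ (fun n => n.+1%:R^-1)) h.
have {h} := h _; rewrite /= => /(_ (conj _ _)) h.
rewrite (_ : (fun n => _) = (fun n : nat => n.+1%:R^-1^-1 *: (sin (x * (n.+1%:R^-1 *: 1 + 0)) - sin (x * 0)))); last first.
  by apply/funext => n; rewrite invrK /GRing.scale/= mulr1 addr0 mulr0 sin0 subr0.
apply: h; first by move=> n; rewrite invr_eq0 pnatr_eq0.
exact: cvg_harmonic.
Qed.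

(** The discrete form of the rule that differentiation multiplies the transform by the frequency and
    turns its phase by pi / 2. It spares any differentiability of [h], which will only be
    Lipschitz. *)
Lemma osc_diff psi h (del : R) x : Rintegrable mu h ->
  osc psi (fun y => h (y + del) - h (y + - del)) x =
  2 * sin (x * del) * osc (psi + pi / 2) h x.
Proof.
move=> ih; have mh := Rintegrable_measurable ih.
have m1 v := measurable_phase1 v x.
have E v : \int[mu]_y (h (y + v) * cos (x * y - psi)) = osc (psi + x * v) h x.
  transitivity (\int[mu]_y (fun z => h z * cos (x * z - (psi + x * v))) (y + v)).
    by apply: eq_Rintegral => y _; congr (_ * cos _); ring.
  apply: (@Rintegral_shift _ (fun z => h z * cos (x * z - (psi + x * v)))).
  by apply: measurable_funM => //; exact: m1.
transitivity (osc (psi + x * del) h x - osc (psi + x * - del) h x).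
  rewrite -!E /osc -RintegralB//.
  - by apply: eq_Rintegral => y _; rewrite mulrBl.
  - exact: (RintegrableM (Rintegrable_shift _ ih) (m1 _) (fun y => cos_max _)).
  - exact: (RintegrableM (Rintegrable_shift _ ih) (m1 _) (fun y => cos_max _)).
have io v : Rintegrable mu (fun y => h y * cos (x * y - v)) := RintegrableM ih (m1 v) (fun y => cos_max _).
have -> : 2 * sin (x * del) * osc (psi + pi / 2) h x =
    \int[mu]_y (2 * sin (x * del) * (h y * cos (x * y - (psi + pi / 2)))).
  by rewrite (RintegralZl _ measurableT (io _)).
transitivity (\int[mu]_y (h y * cos (x * y - (psi + x * del)) - h y * cos (x * y - (psi + x * - del)))).
  by rewrite RintegralB//; exact: io.
apply: eq_Rintegral => y _.
have -> : x * y - (psi + pi / 2) = (x * y - psi) - pi / 2 by ring.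
rewrite cosBpihalf.
have -> : x * y - (psi + x * del) = (x * y - psi) - x * del by ring.
have -> : x * y - (psi + x * - del) = (x * y - psi) + x * del by ring.
move: (x * y - psi) (x * del) => p q; rewrite cosB cosD; ring.
Qed.

Lemma Rintegrable_supported h (l r M : R) : measurable_fun setT h ->
  (forall y, `|h y| <= M) -> (forall y, y < l \/ r < y -> h y = 0) ->
  Rintegrable mu h.
Proof.
move=> mh hM hs.
have i1 : Rintegrable mu (\1_`[l, r] : R -> R).
  exact: integrable_indic_itv.
have := RintegrableM i1 mh hM; apply: eq_integrable => // y _ /=.
rewrite indicE; have [|] := boolP (y \in `[l, r]%classic); rewrite ?mul1r//.
rewrite mul0r notin_setE/= in_itv/= => /negP/nandP; rewrite -!ltNge => H.
by rewrite hs.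
Qed.

Lemma Rintegral_sqr_supported h (l r M : R) : l <= r -> measurable_fun setT h ->
  (forall y, `|h y| <= M) -> (forall y, y < l \/ r < y -> h y = 0) ->
  Rintegrable mu (fun y => h y ^+ 2) /\ \int[mu]_y (h y ^+ 2) <= M ^+ 2 * (r - l).
Proof.
move=> lr mh hM hs; have M0 : 0 <= M by apply: le_trans (hM 0).
have i2 : Rintegrable mu (fun y => h y ^+ 2).
  apply: (@Rintegrable_supported _ l r (M ^+ 2)) => [|y|y /hs ->]; last by rewrite expr0n.
    exact: measurable_funX.
  by rewrite normrX lerXn2r// ?nnegrE.
split => //.
have i1 : Rintegrable mu (\1_`[l, r] : R -> R) by exact: integrable_indic_itv.
apply: (@le_trans _ _ (\int[mu]_y (M ^+ 2 * \1_`[l, r] y))).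
  apply: le_Rintegral => //; first exact: RintegrableZ.
  move=> y _; rewrite indicE; have [|] := boolP (y \in `[l, r]%classic) => H.
    by rewrite mulr1 -[leLHS]real_normK ?num_real// lerXn2r// ?nnegrE.
  rewrite mulr0; move: H; rewrite notin_setE/= in_itv/= => /negP/nandP; rewrite -!ltNge => H.
  by rewrite hs// expr0n.
rewrite RintegralZl// ler_wpM2l ?sqr_ge0//.
have -> : \int[mu]_x \1_`[l, r] x = fine (mu `[l, r]%classic).
  by rewrite /Rintegral integral_indic// setIT.
rewrite lebesgue_measure_itv/= lte_fin.
by case: ltP => _ //=; rewrite subr_ge0.
Qed.

Section weight.
Variables (h : R -> R) (l r M L : R).
Hypotheses (lr : l <= r) (mh : measurable_fun setT h).
Hypothesis hM : forall y, `|h y| <= M.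
Hypothesis hs : forall y, y < l \/ r < y -> h y = 0.
Hypothesis hL : forall a b, `|h a - h b| <= L * `|a - b|.

Let ih : Rintegrable mu h. Proof. exact: Rintegrable_supported hs. Qed.
Let L0 : 0 <= L.
Proof. by have := hL 1 0; rewrite subr0 normr1 mulr1; apply: le_trans. Qed.

(** Bessel's inequality for symmetric differences of [h], whose values are at most 2 del L and whose
    support is wider than [l, r] by del on each side. After division by 2 del, Fatou lets del tend
    to 0 on the transform side. *)
Lemma osc_moment psi :
  (\int[mu]_x ((x * osc psi h x) ^+ 2)%:E <= (2 * pi * (L ^+ 2 * (r - l)))%:E)%E.
Proof.
have mo := measurable_osc psi ih.
pose d n : R := n.+1%:R^-1.
have d0 n : 0 < d n by rewrite invr_gt0.
apply: (@fatou_bound _ RM R mu (fun n x => (n.+1%:R * sin (x * d n) * osc psi h x) ^+ 2) _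
  (fun n => (2 * pi * (L ^+ 2 * (r - l + 2 * d n)))%:E)).
- move=> n; apply: measurable_funX; apply: measurable_funM => //; apply: measurable_funM => //.
  rewrite (_ : (fun x => _) = (fun x : R => sin (d n * x))); first exact: measurable_sin_scale.
  by apply/funext => x; rewrite mulrC.
- by move=> n x; exact: sqr_ge0.
- move=> x; apply: cvgM; apply: cvgM; try exact: cvg_sinc; exact: cvg_cst.
- move=> n; pose k y := h (y + d n) - h (y + - d n).
  have mk : measurable_fun setT k by apply: measurable_funB; exact: measurable_shift.
  have kM y : `|k y| <= 2 * d n * L.
    apply: (le_trans (hL _ _)); rewrite mulrC ler_wpM2r//.
    have -> : y + d n - (y - d n) = 2 * d n by ring.
    by rewrite gtr0_norm// mulr_gt0.
  have ks y : y < l - d n \/ r + d n < y -> k y = 0.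
    by have := d0 n => dn0 H; rewrite /k !hs ?subr0//; case: H => ?; [left|right|left|right]; lra.
  have lr' : l - d n <= r + d n by have := d0 n; move: lr; lra.
  have ik : Rintegrable mu k by exact: Rintegrable_supported ks.
  have [ik2 bk2] := Rintegral_sqr_supported lr' mk kM ks.
  (* [osc_diff] adds pi / 2 to the phase, so this choice leaves the phase psi. *)
  have := bessel (psi - pi / 2) ik ik2.
  have -> : (\int[mu]_x (osc (psi - pi / 2) k x ^+ 2)%:E)%E =
     ((4 * d n ^+ 2)%:E * \int[mu]_x ((n.+1%:R * sin (x * d n) * osc psi h x) ^+ 2)%:E)%E.
    rewrite -ge0_integralZl//; last 3 first.
    - apply/measurable_EFinP; apply: measurable_funX; apply: measurable_funM => //; apply: measurable_funM => //.
      rewrite (_ : (fun x => _) = (fun x : R => sin (d n * x))); first exact: measurable_sin_scale.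
      by apply/funext => x; rewrite mulrC.
    - by move=> x _; rewrite lee_fin sqr_ge0.
    - by rewrite lee_fin mulr_ge0// sqr_ge0.
    apply: eq_integral => x _; rewrite -EFinM osc_diff// subrK; congr EFin.
    have dn : d n * n.+1%:R = 1 by rewrite mulVf.
    rewrite !exprMn; have -> : 4 * d n ^+ 2 * (n.+1%:R ^+ 2 * sin (x * d n) ^+ 2 * osc psi h x ^+ 2) =
      (d n * n.+1%:R) ^+ 2 * (2 ^+ 2 * sin (x * d n) ^+ 2 * osc psi h x ^+ 2) by ring.
    by rewrite dn expr1n mul1r.
  move=> H; have d2 : 0 < 4 * d n ^+ 2 by rewrite mulr_gt0// exprn_gt0.
  rewrite -(@lee_pmul2l _ (4 * d n ^+ 2)%:E)//.
  apply: (le_trans H); rewrite -EFinM lee_fin.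
  have -> : 4 * d n ^+ 2 * (2 * pi * (L ^+ 2 * (r - l + 2 * d n))) =
     2 * pi * ((2 * d n * L) ^+ 2 * (r + d n - (l - d n))) by ring.
  by rewrite ler_wpM2l// mulr_ge0// pi_ge0.
- apply: cvg_EFin; first exact: nearW.
  apply: cvgM; first exact: cvg_cst; apply: cvgM; first exact: cvg_cst.
  rewrite -[X in _ --> X]addr0; apply: cvgD; first exact: cvg_cst.
  rewrite -(mulr0 2); apply: cvgM; first exact: cvg_cst.
  exact: cvg_harmonic.
Qed.

Lemma osc_weight psi :
  (\int[mu]_x ((1 + x ^+ 2) * osc psi h x ^+ 2)%:E <=
   (2 * pi * ((M ^+ 2 + L ^+ 2) * (r - l)))%:E)%E.
Proof.
have mo := measurable_osc psi ih.
have [i2 b2] := Rintegral_sqr_supported lr mh hM hs.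
under eq_integral do rewrite mulrDl mul1r -exprMn EFinD.
rewrite ge0_integralD//; do ?[by move=> x _; rewrite lee_fin sqr_ge0]; last 2 first.
- by apply/measurable_EFinP; exact: measurable_funX.
- by apply/measurable_EFinP; apply: measurable_funX; exact: measurable_funM.
rewrite (_ : 2 * pi * _ = 2 * pi * (M ^+ 2 * (r - l)) + 2 * pi * (L ^+ 2 * (r - l))); last by rewrite -mulrDr -mulrDl.
rewrite EFinD; apply: leeD; last exact: osc_moment.
apply: (le_trans (bessel psi ih i2)).
by rewrite lee_fin ler_wpM2l// mulr_ge0// pi_ge0.
Qed.

End weight.

(** The weight converts L^2 control into L^1 control, because 1 / (1 + x^2) has the finite integral
    pi. The free parameter [la] balances the two terms and is used to make the L^1 norm small. *)
Lemma Rintegrable_weight (u : R -> R) (X : R) : measurable_fun setT u ->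
  (\int[mu]_x ((1 + x ^+ 2) * u x ^+ 2)%:E <= X%:E)%E ->
  [/\ Rintegrable mu (fun x => (1 + x ^+ 2) * u x ^+ 2),
      Rintegrable mu (fun x => u x ^+ 2), Rintegrable mu u,
      \int[mu]_x (u x ^+ 2) <= X &
      forall la, 0 < la -> \int[mu]_x `|u x| <= 2^-1 * (la * X + pi / la)].
Proof.
move=> mu_ H.
have w0 x : 0 <= (1 + x ^+ 2) * u x ^+ 2 by rewrite mulr_ge0 ?sqr_ge0// addr_ge0 ?sqr_ge0.
have iw : Rintegrable mu (fun x => (1 + x ^+ 2) * u x ^+ 2).
  apply: ge0_Rintegrable => //; last by rewrite (le_lt_trans H)// ltry.
  apply: measurable_funM; last exact: measurable_funX.
  by apply: measurable_funD => //; exact: measurable_funX.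
have bw : \int[mu]_x ((1 + x ^+ 2) * u x ^+ 2) <= X.
  by rewrite -lee_fin -RintegralE.
have i2 : Rintegrable mu (fun x => u x ^+ 2).
  apply: (@le_Rintegrable _ RM R mu _ (fun x => (1 + x ^+ 2) * u x ^+ 2)) => //.
    exact: measurable_funX.
  by move=> x; rewrite ger0_norm ?sqr_ge0// ler_peMl ?sqr_ge0// lerDl sqr_ge0.
have iK : Rintegrable mu (fun x => 2^-1 * cauchy_kernel 1 x).
  by apply: RintegrableZ; exact: Rintegrable_cauchy_kernel.
have eK : \int[mu]_x (2^-1 * cauchy_kernel 1 x) = pi.
  rewrite RintegralZl//; last exact: Rintegrable_cauchy_kernel.
  rewrite (RintegralE_eq (integral_cauchy_kernel (@ltr01 R))).
  by rewrite mulrA mulVf// mul1r.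
have bd la x : 0 < la -> `|u x| <= 2^-1 * (la * ((1 + x ^+ 2) * u x ^+ 2) + la^-1 * (2^-1 * cauchy_kernel 1 x)).
  move=> la0.
  have -> : 2^-1 * cauchy_kernel 1 x = (1 + x ^+ 2)^-1.
    by rewrite /cauchy_kernel expr1n mulr1 mulrA mulVf// mul1r.
  have t0 : 0 < 1 + x ^+ 2 by rewrite ltr_pwDl// sqr_ge0.
  have lt0 : 0 < la * (1 + x ^+ 2) by rewrite mulr_gt0.
  (* The inequality of arithmetic and geometric means, with its defect written as a square. *)
  have -> : 2^-1 * (la * ((1 + x ^+ 2) * u x ^+ 2) + la^-1 / (1 + x ^+ 2)) =
    `|u x| + (2 * (la * (1 + x ^+ 2)))^-1 * (la * (1 + x ^+ 2) * `|u x| - 1) ^+ 2.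
    rewrite sqrrB !exprMn real_normK ?num_real// expr1n mulr1; field.
    by rewrite (gt_eqF la0) (gt_eqF t0).
  by rewrite lerDl mulr_ge0 ?sqr_ge0// invr_ge0 ltW// mulr_gt0.
have iu : Rintegrable mu u.
  apply: (@le_Rintegrable _ RM R mu u _ mu_ (fun x => bd 1 x ltr01)).
  by apply: RintegrableZ; apply: RintegrableD; exact: RintegrableZ.
split => //.
  apply: le_trans bw; apply: le_Rintegral => // x _.
  by rewrite ler_peMl ?sqr_ge0// lerDl sqr_ge0.
move=> la la0.
apply: (@le_trans _ _ (\int[mu]_x (2^-1 * (la * ((1 + x ^+ 2) * u x ^+ 2) + la^-1 * (2^-1 * cauchy_kernel 1 x))))).
  apply: le_Rintegral => //; first exact: Rintegrable_abs.
    by apply: RintegrableZ; apply: RintegrableD; exact: RintegrableZ.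
  by move=> x _; exact: bd.
rewrite RintegralZl//; last by apply: RintegrableD; exact: RintegrableZ.
rewrite ler_pM2l ?invr_gt0// RintegralD//; [|exact: RintegrableZ|exact: RintegrableZ].
rewrite (RintegralZl _ measurableT iw) (RintegralZl _ measurableT iK) eK mulrC (mulrC pi) lerD2r.
by rewrite mulrC ler_pM2l.
Qed.

End oscillatory_weights.

(** * Convolution, and smoothing by Cauchy densities *)

Section convolution.
Context (R : realType).
Local Notation mu := (@lebesgue_measure R).
Local Notation RM := (measurableTypeR R).
Implicit Types (t k : R -> R) (psi x y e w : R).

(** [conv g f] is convertible to [conv_pdf f g], which lets facts on the law of Y be used for it
    directly. *)
Definition conv t k x := \int[mu]_y (t y * k (x - y)).

Section conv_swap.
Variables (t k c : R -> R) (K C : R).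
Hypotheses (it : Rintegrable mu t) (ik : Rintegrable mu k).
Hypothesis kK : forall x, `|k x| <= K.
Hypotheses (mc : measurable_fun setT c) (cC : forall x, `|c x| <= C).

Let mt := Rintegrable_measurable it.
Let mk := Rintegrable_measurable ik.
Let F (z : RM * RM) : R := (t z.2 * k ((z.1 : R) - z.2)) * c z.1.

Let mF : measurable_fun setT F.
Proof.
have m1 : measurable_fun setT (fun z : RM * RM => z.1 : R) := measurable_fst.
have m2 : measurable_fun setT (fun z : RM * RM => z.2 : R) := measurable_snd.
apply: measurable_funM; last exact: (measurableT_comp mc).
apply: measurable_funM; first exact: (measurableT_comp mt).
by apply: (measurableT_comp mk); exact: measurable_funB.
Qed.

Let iinner x : Rintegrable mu (fun y => t y * k (x - y)).
Proof.
apply: (RintegrableM it _ (fun y => kK (x - y))).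
by apply: (measurableT_comp mk); exact: measurable_funB.
Qed.

Let ishift y : Rintegrable mu (fun x => k (x + - y) * c x).
Proof. exact: (RintegrableM (Rintegrable_shift (- y) ik) mc cC). Qed.

Let C0 : 0 <= C. Proof. exact: le_trans (cC 0). Qed.

Let iF : Rintegrable (mu \x mu)%E F.
Proof.
have mFE : measurable_fun setT (EFin \o F) by exact/measurable_EFinP.
apply/(@integrable21ltyP _ _ RM RM R lebesgue_measure lebesgue_measure _ mFE).
apply: (le_lt_trans _ (ltry (C * (\int[mu]_x `|k x| * \int[mu]_y `|t y|)))).
have B y : (\int[mu]_x `|(EFin \o F) (x, y)| <= (C * \int[mu]_x `|k x| * `|t y|)%:E)%E.
  have -> : (\int[mu]_x `|(EFin \o F) (x, y)| = \int[mu]_x (`|t y| * `|k (x + - y) * c x|)%:E)%E.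
    by apply: eq_integral => x _; rewrite /F/= -mulrA normrM.
  rewrite RintegralE; last by apply: RintegrableZ; exact: Rintegrable_abs.
  rewrite lee_fin RintegralZl//; last exact: Rintegrable_abs.
  rewrite mulrC ler_wpM2r//.
  have := RintegralM_le (Rintegrable_shift (- y) (Rintegrable_abs ik)) (measurableT_comp (@normr_measurable R setT) mc) (M := C).
  rewrite (_ : \int[mu]_x `| `|k (x + - y)| | = \int[mu]_x `|k x|); last first.
    rewrite -(@Rintegral_shift _ (fun x => `|k x|) (- y)); last exact: measurableT_comp.
    by apply: eq_Rintegral => x _; rewrite normr_id.
  move=> /(_ _)/wrap[x|]; first by rewrite /= normr_id.
  apply: le_trans; rewrite ger0_norm; last first.
    by apply: Rintegral_ge0 => x _; apply: mulr_ge0; exact: normr_ge0.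
  rewrite le_eqVlt; apply/orP; left; apply/eqP.
  by apply: eq_Rintegral => x _ /=; rewrite normrM.
apply: (@le_trans _ _ (\int[mu]_y (C * \int[mu]_x `|k x| * `|t y|)%:E)%E).
  apply: ge0_le_integral => //.
  - by move=> y _; apply: integral_ge0.
  - apply: (measurable_fun_fubini_tonelli_G (abse \o (EFin \o F))) => //=.
    exact: measurableT_comp.
  - by apply/measurable_EFinP; apply: measurable_funM => //; exact: measurableT_comp.
rewrite RintegralE; last by apply: RintegrableZ; exact: Rintegrable_abs.
by rewrite RintegralZl ?mulrA//; exact: Rintegrable_abs.
Qed.

Let FE x : (\int[mu]_y (F (x, y))%:E = (conv t k x * c x)%:E)%E.
Proof.
rewrite /F/= RintegralE; last first.
  by have := RintegrableZ (c x) (iinner x); apply: eq_integrable => // y _ /=; rewrite mulrC.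
by rewrite (RintegralZr _ measurableT (iinner x)).
Qed.

Let GE y : (\int[mu]_x (F (x, y))%:E = (t y * \int[mu]_x (k x * c (x + y)))%:E)%E.
Proof.
have E : \int[mu]_x (k x * c (x + y)) = \int[mu]_x (k (x + - y) * c x).
  rewrite -(@Rintegral_shift _ (fun x => k x * c (x + y)) (- y)).
    by apply: eq_Rintegral => x _; rewrite subrK.
  by apply: measurable_funM => //; exact: measurable_shift.
transitivity (\int[mu]_x (t y * (k (x + - y) * c x))%:E)%E.
  by apply: eq_integral => x _; rewrite /F/= mulrA.
by rewrite RintegralE ?E; [rewrite (RintegralZl _ measurableT (ishift y))|exact: (RintegrableZ _ (ishift y))].
Qed.

Lemma Rintegrable_convM : Rintegrable mu (fun x => conv t k x * c x).
Proof.
have := integrable_fubini_F iF.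
by apply: eq_integrable => // x _; rewrite /fubini_F FE.
Qed.

(** Fubini and a translation in x. Taking c = 1 gives the total mass of a convolution, and c a
    cosine gives its transform. *)
Lemma Rintegral_convM : \int[mu]_x (conv t k x * c x) =
  \int[mu]_y (t y * \int[mu]_x (k x * c (x + y))).
Proof.
have := @Fubini _ _ RM RM R lebesgue_measure lebesgue_measure _ iF => E.
rewrite /Rintegral; congr fine.
transitivity (\int[mu]_x \int[mu]_y (F (x, y))%:E)%E; first by apply: eq_integral => x _; rewrite FE.
by rewrite E; apply: eq_integral => y _; rewrite GE.
Qed.

End conv_swap.

Lemma Rintegrable_conv t k K : Rintegrable mu t -> Rintegrable mu k ->
  (forall x, `|k x| <= K) -> Rintegrable mu (conv t k).
Proof.
move=> it ik kK.
have := @Rintegrable_convM t k (cst 1) K 1 it ik kK (@measurable_cst _ _ _ _ _ _) _.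
move=> /(_ _)/wrap[x|]; first by rewrite normr1.
by apply: eq_integrable => // x _ /=; rewrite mulr1.
Qed.

Lemma Rintegral_conv t k K : Rintegrable mu t -> Rintegrable mu k ->
  (forall x, `|k x| <= K) -> \int[mu]_x conv t k x = (\int[mu]_x t x) * \int[mu]_x k x.
Proof.
move=> it ik kK.
transitivity (\int[mu]_x (conv t k x * cst 1 x)).
  by apply: eq_Rintegral => x _; rewrite mulr1.
rewrite (@Rintegral_convM t k (cst 1) K 1)//; last by move=> x; rewrite normr1.
rewrite -RintegralZr//; apply: eq_Rintegral => y _; congr (_ * _).
by apply: eq_Rintegral => x _; rewrite mulr1.
Qed.

Lemma conv_bound t k K x : Rintegrable mu t -> Rintegrable mu k ->
  (forall x, `|k x| <= K) -> `|conv t k x| <= K * \int[mu]_y `|t y|.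
Proof.
move=> it ik kK; apply: RintegralM_le => //.
by apply: (measurableT_comp (Rintegrable_measurable ik)); exact: measurable_funB.
Qed.

Definition cauchy_pdf e x := (2 * pi)^-1 * cauchy_kernel e x.

Let pi2 : 0 < 2 * pi :> R. Proof. by rewrite mulr_gt0// pi_gt0. Qed.

Lemma cauchy_pdf_ge0 e x : 0 < e -> 0 <= cauchy_pdf e x.
Proof. by move=> e0; rewrite mulr_ge0 ?invr_ge0 ?(ltW pi2)// cauchy_kernel_ge0// ltW. Qed.

Lemma Rintegrable_cauchy_pdf e : 0 < e -> Rintegrable mu (cauchy_pdf e).
Proof. by move=> e0; apply: RintegrableZ; exact: Rintegrable_cauchy_kernel. Qed.

Lemma cauchy_pdf_is_pdf e : 0 < e -> is_pdf (cauchy_pdf e).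
Proof.
move=> e0; split; first exact: Rintegrable_measurable (Rintegrable_cauchy_pdf e0).
  by move=> x; exact: cauchy_pdf_ge0.
rewrite RintegralE; last exact: Rintegrable_cauchy_pdf.
rewrite RintegralZl//; last exact: Rintegrable_cauchy_kernel.
by rewrite (RintegralE_eq (integral_cauchy_kernel e0)) mulVf// gt_eqF.
Qed.

Lemma cauchy_pdf_le e x : 0 < e -> `|cauchy_pdf e x| <= (pi * e)^-1.
Proof.
move=> e0; rewrite ger0_norm ?cauchy_pdf_ge0//.
rewrite /cauchy_pdf invfM mulrAC; apply: (@le_trans _ _ (2^-1 * (2 / e) / pi)).
  by rewrite ler_pM2r ?invr_gt0 ?pi_gt0// ler_pM2l ?invr_gt0// cauchy_kernel_le.
by rewrite mulrA mulVf// mul1r invfM mulrC.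
Qed.

(** Inversion applied to [laplace e], whose transform is the Cauchy kernel; the sine part of the
    phase is odd and drops out, leaving the factor cos psi. *)
Lemma osc_cauchy_pdf psi e w : 0 < e ->
  osc psi (cauchy_pdf e) w = cos psi * laplace e w.
Proof.
move=> e0; have iK := Rintegrable_cauchy_kernel e0; have il := Rintegrable_laplace e0.
have E0 : osc 0 (laplace e) = cauchy_kernel e.
  apply/funext => x; rewrite -Rintegral_laplace_cos//; apply: eq_Rintegral => y _.
  by rewrite subr0.
have E1 : osc 0 (cauchy_kernel e) w = 2 * pi * laplace e w.
  rewrite -E0 (@osc_inversion _ _ _ 1)//.
  - by rewrite mulr0 cos0 mul1r laplaceN; ring.
  - by move=> y; rewrite ger0_norm ?laplace_ge0// laplace_le1// ltW.
  - exact: continuous_laplace.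
  - exact: continuous_laplace.
  - by rewrite E0.
rewrite oscZ//.
have ic : Rintegrable mu (fun y => cauchy_kernel e y * cos (w * y)).
  exact: (RintegrableM iK (measurable_cos_scale w) (fun x => cos_max (w * x))).
have isn : Rintegrable mu (fun y => cauchy_kernel e y * sin (w * y)).
  exact: (RintegrableM iK (measurable_sin_scale w) (fun x => sin_max (w * x))).
have S0 : \int[mu]_y (cauchy_kernel e y * sin (w * y)) = 0.
  apply: Rintegral_odd0 => //; first exact: Rintegrable_measurable isn.
  by move=> y; rewrite cauchy_kernelN mulrN sinN mulrN.
have C0 : \int[mu]_y (cauchy_kernel e y * cos (w * y)) = 2 * pi * laplace e w.
  by rewrite -E1; apply: eq_Rintegral => y _; rewrite subr0.
rewrite (_ : osc psi (cauchy_kernel e) w = cos psi * (2 * pi * laplace e w)).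
  by rewrite mulrCA mulKf// gt_eqF.
transitivity (\int[mu]_y (cos psi * (cauchy_kernel e y * cos (w * y)) + sin psi * (cauchy_kernel e y * sin (w * y)))).
  by apply: eq_Rintegral => y _; rewrite cosB; ring.
rewrite RintegralD//; [|exact: RintegrableZ|exact: RintegrableZ].
by rewrite (RintegralZl _ measurableT ic) (RintegralZl _ measurableT isn) S0 C0 mulr0 addr0.
Qed.

Lemma osc_conv_cauchy psi t e w : 0 < e -> Rintegrable mu t ->
  osc psi (conv t (cauchy_pdf e)) w = laplace e w * osc psi t w.
Proof.
move=> e0 it; have ic := Rintegrable_cauchy_pdf e0.
have icos : Rintegrable mu (fun y => t y * cos (w * y - psi)).
  exact: (RintegrableM it (measurable_phase1 psi w) (fun y => cos_max _)).
rewrite /osc (@Rintegral_convM t (cauchy_pdf e) (fun x => cos (w * x - psi)) ((pi * e)^-1) 1)//.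
- rewrite -RintegralZl//; apply: eq_Rintegral => y _.
  have := osc_cauchy_pdf (psi - w * y) w e0; rewrite /osc => E.
  rewrite (_ : \int[mu]_x _ = cos (psi - w * y) * laplace e w).
    by rewrite -cosN opprB; ring.
  by rewrite -E; apply: eq_Rintegral => x _; congr (_ * cos _); ring.
- by move=> x; exact: cauchy_pdf_le.
- exact: measurable_phase1.
- by move=> x; exact: cos_max.
Qed.

(** Dual to [osc_conv_cauchy]: here the function that is smoothed is itself given by a spectrum [h],
    and smoothing damps this spectrum. *)
Lemma conv_osc_cauchy psi h e x : 0 < e -> Rintegrable mu h ->
  conv (osc psi h) (cauchy_pdf e) x = osc psi (fun w => h w * laplace e w) x.
Proof.
move=> e0 ih; have ic := Rintegrable_cauchy_pdf e0.
have mcd := Rintegrable_measurable ic.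
have icx : Rintegrable mu (fun y => cauchy_pdf e (x - y)).
  have := Rintegrable_opp (Rintegrable_shift x ic).
  by apply: eq_integrable => // y _ /=; rewrite addrC.
rewrite /conv.
transitivity (\int[mu]_y (cauchy_pdf e (x - y) * osc psi h y)); first by apply: eq_Rintegral => y _; rewrite mulrC.
rewrite (@Rintegral_swap _ _ RM RM R lebesgue_measure lebesgue_measure
  (fun y => cauchy_pdf e (x - y)) h _ 1 icx ih (measurable_phase psi) (fun z => cos_max _)).
apply: eq_Rintegral => w _; rewrite -mulrA; congr (_ * _).
have := osc_cauchy_pdf (w * x - psi) w e0; rewrite /osc => E.
have -> : laplace e w * cos (x * w - psi) = cos (w * x - psi) * laplace e w by rewrite mulrC (mulrC x).
rewrite -E.
pose H z := cauchy_pdf e z * cos (w * (x - z) - psi).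
have mH : measurable_fun setT H.
  apply: measurable_funM => //; apply: (measurableT_comp (f := @cos R)).
    by apply: continuous_measurable_fun; exact: continuous_cos.
  by apply: measurable_funB => //; apply: measurable_funM => //; exact: measurable_funB.
transitivity (\int[mu]_y H (- y + x)).
  by apply: eq_Rintegral => y _; rewrite /H (addrC (- y)) /=; congr (_ * cos _); ring.
rewrite (@Rintegral_opp _ (fun y => H (y + x))); last exact: measurable_shift.
rewrite Rintegral_shift//; apply: eq_Rintegral => z _.
by rewrite /H -cosN; congr (_ * cos _); ring.
Qed.

(** The real form of the rule that convolution multiplies spectra. The addition formula splits cos
    ((x - y) w - psi) into the two products that contain the real and the imaginary part of the
    transform of [g]. *)
Lemma conv_osc psi g h x : Rintegrable mu g -> Rintegrable mu h ->
  conv g (osc psi h) x = osc psi (fun w => h w * osc 0 g w) x +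
                         osc (psi + pi / 2) (fun w => h w * osc (pi / 2) g w) x.
Proof.
move=> ig ih.
have mshift : measurable_fun setT (fun z : RM * RM => cos ((x - (z.1 : R)) * z.2 - psi)).
  apply: (measurableT_comp (f := @cos R)).
    by apply: continuous_measurable_fun; exact: continuous_cos.
  apply: measurable_funB => //.
  have m1 : measurable_fun setT (fun z : RM * RM => z.1 : R) := measurable_fst.
  have m2 : measurable_fun setT (fun z : RM * RM => z.2 : R) := measurable_snd.
  by apply: measurable_funM => //; exact: measurable_funB.
have i1 : Rintegrable mu (fun w => h w * osc 0 g w) := RintegrableM ih (measurable_osc 0 ig) (fun w => osc_bound 0 w ig).
have i2 : Rintegrable mu (fun w => h w * osc (pi / 2) g w) := RintegrableM ih (measurable_osc (pi / 2) ig) (fun w => osc_bound (pi / 2) w ig).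
rewrite /conv {1}/osc.
rewrite (@Rintegral_swap _ _ RM RM R lebesgue_measure lebesgue_measure g h _ 1 ig ih mshift (fun z => cos_max _)).
rewrite -RintegralD//; last 2 first.
- exact: (RintegrableM i1 (measurable_phase1 _ _) (fun w => cos_max _)).
- exact: (RintegrableM i2 (measurable_phase1 _ _) (fun w => cos_max _)).
apply: eq_Rintegral => w _; rewrite -!mulrA -mulrDr; congr (_ * _).
have ig0 : Rintegrable mu (fun y => g y * cos (w * y - 0)) := RintegrableM ig (measurable_phase1 _ _) (fun w => cos_max _).
have ig1 : Rintegrable mu (fun y => g y * cos (w * y - pi / 2)) := RintegrableM ig (measurable_phase1 _ _) (fun w => cos_max _).
rewrite /osc -!RintegralZr// -RintegralD//; last 2 first.
- by have := RintegrableZ (cos (x * w - psi)) ig0; apply: eq_integrable => // y _ /=; rewrite mulrC.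
- by have := RintegrableZ (cos (x * w - (psi + pi / 2))) ig1; apply: eq_integrable => // y _ /=; rewrite mulrC.
apply: eq_Rintegral => y _; rewrite -!mulrA -mulrDr; congr (_ * _).
rewrite subr0 cosBpihalf.
have -> : x * w - (psi + pi / 2) = (x * w - psi) - pi / 2 by ring.
rewrite cosBpihalf.
have -> : (x - y) * w - psi = (x * w - psi) - w * y by ring.
rewrite cosB; ring.
Qed.

End convolution.

(** * Fourier transforms *)

Section fourier_osc.
Context (R : realType).
Local Notation mu := (@lebesgue_measure R).
Local Notation RM := (measurableTypeR R).
Implicit Types (t h : R -> R) (w x d : R).

Lemma Re_expi_mul (p q : R) : complex.Re (expi p * q%:C)%C = q * cos p.
Proof. by rewrite /expi /=; ring. Qed.

Lemma Im_expi_mul (p q : R) : complex.Im (expi p * q%:C)%C = q * sin p.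
Proof. by rewrite /expi /=; ring. Qed.

Lemma Re_fourier t w : complex.Re (fourier t w) = osc 0 t w.
Proof. by apply: eq_Rintegral => x _; rewrite Re_expi_mul subr0. Qed.

Lemma Im_fourier t w : complex.Im (fourier t w) = osc (pi / 2) t w.
Proof. by apply: eq_Rintegral => x _; rewrite Im_expi_mul cosBpihalf. Qed.

Lemma fourierE t w : fourier t w = (osc 0 t w +i* osc (pi / 2) t w)%C.
Proof. by rewrite -Re_fourier -Im_fourier; case: (fourier t w). Qed.

Lemma cmodE (z : R[i]) : cmod z = Num.sqrt (complex.Re z ^+ 2 + complex.Im z ^+ 2).
Proof. by case: z. Qed.

Lemma cmod_sqr (z : R[i]) : cmod z ^+ 2 = complex.Re z ^+ 2 + complex.Im z ^+ 2.
Proof. by rewrite cmodE sqr_sqrtr// addr_ge0// sqr_ge0. Qed.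

Lemma cmod_ge0 (z : R[i]) : 0 <= cmod z.
Proof. by rewrite cmodE sqrtr_ge0. Qed.

Lemma Re_le_cmod (z : R[i]) : `|complex.Re z| <= cmod z.
Proof. by rewrite cmodE -sqrtr_sqr ler_sqrt ?lerDl ?sqr_ge0// addr_ge0// sqr_ge0. Qed.

Lemma Im_le_cmod (z : R[i]) : `|complex.Im z| <= cmod z.
Proof. by rewrite cmodE -sqrtr_sqr ler_sqrt ?lerDr ?sqr_ge0// addr_ge0// sqr_ge0. Qed.

Lemma osc0N t w : osc 0 t (- w) = osc 0 t w.
Proof. by apply: eq_Rintegral => x _; rewrite !subr0 mulNr cosN. Qed.

Lemma oscpi2N t w : osc (pi / 2) t (- w) = - osc (pi / 2) t w.
Proof.
transitivity (\int[mu]_x (- (t x * cos (w * x - pi / 2)))).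
  by apply: eq_Rintegral => x _; rewrite !cosBpihalf mulNr sinN mulrN.
(* As [t] need not be integrable, the sign is carried by exchanging the integrals of the positive
   and the negative part; [fine] sends infinite values to 0 on both sides. *)
rewrite /osc /Rintegral; under eq_integral do rewrite EFinN.
rewrite -fineN.
rewrite integralE [in RHS]integralE.
rewrite (_ : (fun x => - _)%E = (-%E \o (fun x => (t x * cos (w * x - pi / 2))%:E))%E)//.
rewrite funeposN funenegN.
set a := (\int[mu]_x _)%E; set b := (\int[mu]_x _)%E.
have a0 : (0 <= a)%E by exact: integral_ge0.
have b0 : (0 <= b)%E by exact: integral_ge0.
move: a b a0 b0 => [a| |] [b| |] //= _ _.
by rewrite /= opprB.
Qed.

(** Half-open, so that three translates of it tile the window of triple length without overlap. *)
Definition win (A : R) : R -> R := \1_(`[- A, A[%classic).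

Lemma winE A x : win A x = ((- A <= x) && (x < A))%:R.
Proof. by rewrite /win indicE mem_setE in_itv. Qed.

Lemma Rintegrable_win A : Rintegrable mu (win A).
Proof. exact: integrable_indic_itv. Qed.

Lemma win_split A x : 0 <= A ->
  win (3 * A) x = win A (x + 2 * A) + win A x + win A (x - 2 * A).
Proof.
move=> A0; rewrite !winE.
have -> : (- A <= x + 2 * A) = (- (3 * A) <= x) by apply/idP/idP; lra.
have -> : (x + 2 * A < A) = (x < - A) by apply/idP/idP; lra.
have -> : (- A <= x - 2 * A) = (A <= x) by apply/idP/idP; lra.
have -> : (x - 2 * A < A) = (x < 3 * A) by apply/idP/idP; lra.
have := ltP x (- A); have := ltP x A; have := ltP x (3 * A); have := leP (- (3 * A)) x.
by move=> [?|?] [?|?] [?|?] [?|?] /=; rewrite ?addr0 ?add0r//; lra.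
Qed.

Lemma Rintegral_win (F : R -> R) M A : measurable_fun setT F ->
  (forall x, `|F x| <= M) ->
  \int[mu]_(x in `[- A, A]) F x = \int[mu]_x (F x * win A x).
Proof.
move=> mF FM; have iw := Rintegrable_win A.
have iFw := RintegrableMl iw mF FM.
have E : \int[mu]_(x in `[- A, A[) F x = \int[mu]_x (F x * win A x).
  by rewrite Rintegral_mkcond; apply: eq_Rintegral => x _; rewrite patch_indic.
rewrite -E Rintegral_itv_bndo_bndc//.
apply/(integrable_mkcond _ _).2 => //.
by move: iFw; apply: eq_integrable => // x _; rewrite /= restrict_EFin patch_indic.
Qed.

(** * The transform of the bounded function phi *)

Section symbol.
Variables (phi : R -> R) (phis : R -> R[i]) (M : R).
Hypotheses (mphi : measurable_fun setT phi) (phiM : forall x, `|phi x| <= M).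
Hypothesis hphis : is_fourier phi phis.

Let trunc A x := phi x * win A x.

Let itrunc A : Rintegrable mu (trunc A).
Proof. exact: (RintegrableMl (Rintegrable_win A) mphi phiM). Qed.

Lemma cvg_Re_symbol w : osc 0 (trunc A) w @[A --> +oo] --> complex.Re (phis w).
Proof.
have [+ _] := hphis w; rewrite (_ : (fun A => _) = (fun A => osc 0 (trunc A) w))//.
apply/funext => A; rewrite /cintegral/=.
transitivity (\int[mu]_(x in `[- A, A]) (phi x * cos (w * x))).
  by apply: eq_Rintegral => x _; exact: Re_expi_mul.
rewrite (@Rintegral_win _ M).
- by apply: eq_Rintegral => x _; rewrite /trunc subr0 mulrAC.
- by apply: measurable_funM => //; exact: measurable_cos_scale.
- by move=> x; rewrite normrM -[leRHS]mulr1 ler_pM// cos_max.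
Qed.

Lemma cvg_Im_symbol w : osc (pi / 2) (trunc A) w @[A --> +oo] --> complex.Im (phis w).
Proof.
have [_] := hphis w; rewrite (_ : (fun A => _) = (fun A => osc (pi / 2) (trunc A) w))//.
apply/funext => A; rewrite /cintegral/=.
transitivity (\int[mu]_(x in `[- A, A]) (phi x * sin (w * x))).
  by apply: eq_Rintegral => x _; exact: Im_expi_mul.
rewrite (@Rintegral_win _ M).
- by apply: eq_Rintegral => x _; rewrite /trunc cosBpihalf mulrAC.
- by apply: measurable_funM => //; exact: measurable_sin_scale.
- by move=> x; rewrite normrM -[leRHS]mulr1 ler_pM// sin_max.
Qed.

Lemma Re_symbolN w : complex.Re (phis (- w)) = complex.Re (phis w).
Proof.
have := @cvg_Re_symbol (- w); rewrite (_ : (fun A => _) = (fun A => osc 0 (trunc A) w)).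
  by move=> h; exact: (cvg_unique (@norm_hausdorff _ R^o) h (@cvg_Re_symbol w)).
by apply/funext => A; rewrite osc0N.
Qed.

Lemma Im_symbolN w : complex.Im (phis (- w)) = - complex.Im (phis w).
Proof.
have := @cvg_Im_symbol (- w); rewrite (_ : (fun A => _) = (fun A => - osc (pi / 2) (trunc A) w)).
  by move=> h; exact: (cvg_unique (@norm_hausdorff _ R^o) h (cvgN (@cvg_Im_symbol w))).
by apply/funext => A; rewrite oscpi2N.
Qed.

Let cvg_natmul d : 0 < d -> (n%:R * d) @[n --> \oo] --> +oo.
Proof.
move=> d0; apply/cvgryPge => A.
have [N HN] : exists N : nat, A / d <= N%:R.
  by exists (Num.Def.trunc `|A / d|).+1; rewrite (le_trans (ler_norm _))// ltW// truncnS_gt.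
exists N => // n /= Nn; rewrite -ler_pdivrMr//; apply: (le_trans HN); by rewrite ler_nat.
Qed.

Let cvg_nat_oo : (n%:R : R) @[n --> \oo] --> +oo.
Proof.
by have := @cvg_natmul 1 ltr01; rewrite (_ : (fun n => n%:R * 1) = (fun n => n%:R))//; apply/funext => n; rewrite mulr1.
Qed.

Lemma measurable_Re_symbol : measurable_fun setT (fun w => complex.Re (phis w)).
Proof.
apply: (@measurable_fun_cvg _ _ R setT (fun n w => osc 0 (trunc n%:R) w)).
  by move=> n; exact: measurable_osc.
by move=> w _; exact: (@cvg_comp _ _ _ _ _ _ _ _ cvg_nat_oo (@cvg_Re_symbol w)).
Qed.

Lemma measurable_Im_symbol : measurable_fun setT (fun w => complex.Im (phis w)).
Proof.
apply: (@measurable_fun_cvg _ _ R setT (fun n w => osc (pi / 2) (trunc n%:R) w)).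
  by move=> n; exact: measurable_osc.
by move=> w _; exact: (@cvg_comp _ _ _ _ _ _ _ _ cvg_nat_oo (@cvg_Im_symbol w)).
Qed.

(* A bounded [d]-periodic function has integral over [-A, A] growing linearly
   along A = N d / 2, so its transform at 0 can only exist if it vanishes. *)
Lemma symbol_aperiodic d : phis 0 != 0 -> 0 < d ->
  ~ (forall c, Rintegrable mu c ->
      \int[mu]_x (phi (x + d) * c x) = \int[mu]_x (phi x * c x)).
Proof.
move=> p0 d0 per; case/negP: p0; apply/eqP.
have perN N c : Rintegrable mu c ->
    \int[mu]_x (phi (x + N%:R * d) * c x) = \int[mu]_x (phi x * c x).
  elim: N c => [|N IH] c ic; first by apply: eq_Rintegral => x _; rewrite mul0r addr0.
  have mc := Rintegrable_measurable ic.
  rewrite -(per _ ic).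
  have ics : Rintegrable mu (fun x => c (x + - d)) by exact: Rintegrable_shift.
  have mcs := Rintegrable_measurable ics.
  have := IH _ ics.
  rewrite -(@Rintegral_shift _ (fun x => phi (x + N%:R * d) * c (x + - d)) d); last first.
    by apply: measurable_funM => //; exact: measurable_shift.
  rewrite -(@Rintegral_shift _ (fun x => phi x * c (x + - d)) d); last exact: measurable_funM.
  move=> E; transitivity (\int[mu]_x (phi (x + d + N%:R * d) * c (x + d + - d))).
    apply: eq_Rintegral => x _; rewrite addrK; congr (phi _ * _).
    by rewrite -[N.+1]addn1 natrD; ring.
  by rewrite E; apply: eq_Rintegral => x _; rewrite addrK.
pose J A := \int[mu]_x trunc A x.
(* The three translates that tile the large window differ by 2 A = N d, a multiple of the period,
   and carry the same integral. In the limit the real part of [phis 0] equals three times itself. *)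
have J3 N : J (3 * (N%:R * d / 2)) = 3 * J (N%:R * d / 2).
  set A := N%:R * d / 2; have A0 : 0 <= A by rewrite !mulr_ge0// ltW.
  have A2 : 2 * A = N%:R * d by rewrite /A; field.
  have iw := Rintegrable_win A; have mw := Rintegrable_measurable iw.
  have iwp := Rintegrable_shift (2 * A) iw; have iwm := Rintegrable_shift (- (2 * A)) iw.
  have ip := RintegrableMl iwp mphi phiM; have im := RintegrableMl iwm mphi phiM.
  have E1 : \int[mu]_x (phi x * win A (x + 2 * A)) = J A.
    rewrite -(perN N _ iwp) -A2 /J.
    by rewrite (@Rintegral_shift _ (trunc A) (2 * A))//; exact: measurable_funM.
  have E2 : \int[mu]_x (phi x * win A (x + - (2 * A))) = J A.
    rewrite -(@Rintegral_shift _ (fun x => phi x * win A (x + - (2 * A))) (2 * A)); last first.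
      by apply: measurable_funM => //; exact: (Rintegrable_measurable iwm).
    rewrite /J -(perN N _ iw) -A2; apply: eq_Rintegral => x _; by rewrite addrK.
  rewrite /J; transitivity (\int[mu]_x (phi x * win A (x + 2 * A) + trunc A x + phi x * win A (x + - (2 * A)))).
    by apply: eq_Rintegral => x _; rewrite /trunc win_split// !mulrDr.
  rewrite RintegralD//; last exact: (RintegrableD ip (itrunc A)).
  transitivity (J A + J A + J A); last by rewrite /J; ring.
  have -> : J A + J A = \int[mu]_x (phi x * win A (x + 2 * A) + trunc A x).
    rewrite RintegralD//; do ?exact: itrunc; by congr (_ + _); exact: esym.
  by congr (_ + _).
have Jl : J A @[A --> +oo] --> complex.Re (phis 0).
  rewrite (_ : J = (fun A => osc 0 (trunc A) 0)); first exact: cvg_Re_symbol.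
  by apply/funext => A; apply: eq_Rintegral => x _; rewrite mul0r subr0 cos0 mulr1.
have d2 : 0 < d / 2 by rewrite divr_gt0.
have Jn : J (N%:R * d / 2) @[N --> \oo] --> complex.Re (phis 0).
  rewrite (_ : (fun N => _) = (fun N : nat => J (N%:R * (d / 2)))); last by apply/funext => N; rewrite mulrA.
  exact: (cvg_comp _ _ (cvg_natmul d2) Jl).
have Jn3 : J (3 * (N%:R * d / 2)) @[N --> \oo] --> complex.Re (phis 0).
  rewrite (_ : (fun N => _) = (fun N : nat => J (N%:R * (3 * (d / 2))))); last by apply/funext => N; congr J; ring.
  have d3 : 0 < 3 * (d / 2) by rewrite mulr_gt0.
  exact: (cvg_comp _ _ (cvg_natmul d3) Jl).
have R0 : complex.Re (phis 0) = 3 * complex.Re (phis 0).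
  apply: (cvg_unique (@norm_hausdorff _ R^o) Jn3).
  rewrite (_ : (fun N => _) = (fun N : nat => 3 * J (N%:R * d / 2))); last by apply/funext => N; rewrite J3.
  by apply: cvgM => //; exact: cvg_cst.
have I0 : complex.Im (phis 0) = 0.
  apply: (cvg_unique (@norm_hausdorff _ R^o) (@cvg_Im_symbol 0)).
  rewrite (_ : (fun A => _) = (fun=> 0)); first exact: cvg_cst.
  apply/funext => A.
  transitivity (\int[mu]_x (0 * trunc A x)).
    by apply: eq_Rintegral => x _; rewrite mul0r sub0r -[- _]add0r cosBpihalf sin0 mulr0 mul0r.
  by rewrite (RintegralZl 0 measurableT (itrunc A)); exact: mul0r.
have {}R0 : complex.Re (phis 0) = 0 by lra.
by move: R0 I0; case: (phis 0) => a b /= -> ->.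
Qed.

End symbol.

End fourier_osc.

(** * The parametric lower bound *)

Section single_density.
Context (R : realType).
Local Notation mu := (@lebesgue_measure R).
Local Notation RM := (measurableTypeR R).
Implicit Types (f g phi : R -> R).

Definition overlap g x := \int[mu]_y (g y * g (y + - x)).

(** The autocorrelation of g is even and has total mass 1, being the convolution of g with its
    reflection. If it vanished at every d > 0, it would live on the null set {0}. *)
Lemma overlap_pos g : is_pdf g -> (exists K, bounded_by K g) ->
  exists2 d, 0 < d & 0 < overlap g d.
Proof.
move=> pg [K gK]; have ig := pdf_Rintegrable pg; have mg := pdf_measurable pg.
have g0 := pdf_ge0 pg.
pose gm y := g (- y).
have igm : Rintegrable mu gm by exact: Rintegrable_opp.
have gmK y : `|gm y| <= K by exact: gK.
have E : conv g gm = overlap g.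
  by apply/funext => x; apply: eq_Rintegral => y _; rewrite /gm opprB.
have tot : \int[mu]_x overlap g x = 1.
  rewrite -E (Rintegral_conv ig igm gmK) (Rintegral_opp mg) (pdf_Rintegral pg) mulr1.
  by [].
have iE : Rintegrable mu (overlap g) by rewrite -E; exact: Rintegrable_conv gmK.
have ov0 x : 0 <= overlap g x.
  by apply: Rintegral_ge0 => y _; rewrite mulr_ge0.
have ovN x : overlap g (- x) = overlap g x.
  rewrite /overlap.
  have mm : measurable_fun setT (fun y => g y * g (y + - - x)).
    by apply: measurable_funM => //; exact: measurable_shift.
  rewrite -(Rintegral_shift (- x) mm); apply: eq_Rintegral => y _.
  by rewrite opprK subrK mulrC.
apply/not_exists2P => H.
have ovz x : 0 < x -> overlap g x = 0.
  move=> x0; apply/eqP; rewrite eq_le ov0 andbT leNgt.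
  by have [|/negP] := H x.
have ovz' x : x != 0 -> overlap g x = 0.
  by rewrite neq_lt => /orP[x0|/ovz//]; rewrite -ovN ovz// oppr_gt0.
suff : \int[mu]_x overlap g x = 0 by move/eqP; rewrite tot oner_eq0.
have -> : \int[mu]_x overlap g x = \int[mu]_x (overlap g 0 * \1_[set 0] x).
  apply: eq_Rintegral => x _; rewrite indicE; have [->|x0] := eqVneq x 0.
    by rewrite mem_set// mulr1.
  by rewrite memNset ?mulr0 ?ovz'//; apply/eqP.
apply: RintegralE_eq.
transitivity (\int[mu]_(x in [set (0 : R)%R]) (overlap g 0%R)%:E)%E.
  rewrite [in RHS]integral_mkcond; apply: eq_integral => x _.
  by rewrite patchE indicE; case: (x \in _); rewrite ?mulr1 ?mulr0.
by rewrite integral_set1.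
Qed.

Variables (phi : R -> R) (phis : R -> R[i]) (M : R).
Hypotheses (mphi : measurable_fun setT phi) (phiM : bounded_by M phi).
Hypothesis hphis : is_fourier phi phis.
Hypothesis phis0 : phis 0 != 0.

(** If the energy were 0, [phi] would agree almost everywhere with its translate by d. This is the
    weak periodicity, tested against integrable functions, that [symbol_aperiodic] excludes. *)
Lemma increment_energy_pos w d : Rintegrable mu w -> (forall x, 0 < w x) ->
  0 < d -> 0 < \int[mu]_x ((phi x - phi (x + d)) ^+ 2 * w x).
Proof.
move=> iw w0 d0; have mphid := measurable_shift d mphi.
pose D x := phi x - phi (x + d).
have mD : measurable_fun setT D by exact: measurable_funB.
have DM x : `|D x| <= 2 * M by rewrite (le_trans (ler_normB _ _))// mulr_natl mulr2n lerD.
have mD2 : measurable_fun setT (fun x => D x ^+ 2) by exact: measurable_funX.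
have iDw : Rintegrable mu (fun x => D x ^+ 2 * w x).
  apply: (RintegrableMl (M := (2 * M) ^+ 2) iw mD2) => x.
  by rewrite normrX ler_pXn2r// nnegrE (le_trans _ (DM x)).
have D20 x : 0 <= D x ^+ 2 * w x by rewrite mulr_ge0 ?sqr_ge0// ltW.
have e0 : 0 <= \int[mu]_x (D x ^+ 2 * w x) by exact: Rintegral_ge0.
rewrite lt_neqAle e0 andbT; apply/eqP => /esym E0.
apply: (symbol_aperiodic mphi phiM hphis phis0 d0) => c ic.
have ae0 : ae_eq mu setT (EFin \o (fun x => D x ^+ 2 * w x)) (cst 0%E).
  apply/(ae_eq_integral_abs _ measurableT).
    by apply/measurable_EFinP; exact: (Rintegrable_measurable iDw).
  transitivity (\int[mu]_x (D x ^+ 2 * w x)%:E)%E.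
    by apply: eq_integral => x _ /=; rewrite ger0_norm.
  by rewrite RintegralE// E0.
have mc := Rintegrable_measurable ic.
have i1 := RintegrableMl ic mphi phiM.
have i2 : Rintegrable mu (fun x => phi (x + d) * c x).
  exact: (RintegrableMl ic mphid (fun x => phiM (x + d))).
rewrite /Rintegral; congr fine; apply: ae_eq_integral => //.
- by apply/measurable_EFinP; exact: (Rintegrable_measurable i2).
- by apply/measurable_EFinP; exact: (Rintegrable_measurable i1).
- apply: filterS ae0 => x /= H _; have /eqP := H I.
  rewrite eqe mulf_eq0 sqrf_eq0 (gt_eqF (w0 x)) orbF /D subr_eq0 => /eqP ->.
  by [].
Qed.

(** The constant is a squared covariance divided by a bound on a second moment. Its positivity rests
    on three facts: [g] overlaps some translate of itself, [f] vanishes nowhere, and [phi] is not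
    periodic. *)
Lemma sq_risk_parametric f g (pf : is_pdf f) (pg : is_pdf g) :
  (exists K, bounded_by K f) -> (forall x, 0 < f x) -> (exists K, bounded_by K g) ->
  exists2 c, 0 < c & forall n (h : n.-tuple RM -> R), (0 < n)%N ->
    measurable_fun setT h -> bounded_by M h ->
    c / n%:R <= sq_risk (@pair_sum R) (phi \o fst) h (pair_law pf pg).
Proof.
move=> [K fK] fpos gb; have [d d0 od] := overlap_pos pg gb; have [G gG] := gb.
have mf := pdf_measurable pf; have mg := pdf_measurable pg.
have K0 : 0 <= K by apply: le_trans (fK 0).
have G0 : 0 <= G by apply: le_trans (gG 0).
have M0 : 0 <= M by apply: le_trans (phiM 0).
have mphid := measurable_shift d mphi.
pose D x := phi x - phi (x + d).
have mD : measurable_fun setT D by exact: measurable_funB.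
have DM x : `|D x| <= 2 * M by rewrite (le_trans (ler_normB _ _))// mulr_natl mulr2n lerD.
pose a1 x := D x * f (x + d); pose a2 x := D (x + - d) * f (x + - d).
pose b1 y := g (y + - d); pose b2 y := g (y + d).
have ma1 : measurable_fun setT a1 by apply: measurable_funM => //; exact: measurable_shift.
have ma2 : measurable_fun setT a2.
  by apply: (measurable_shift (f := fun x => D x * f x)); exact: measurable_funM.
have mb1 : measurable_fun setT b1 by exact: measurable_shift.
have mb2 : measurable_fun setT b2 by exact: measurable_shift.
have aB (x y : R) : `|D x * f y| <= 2 * M * K by rewrite normrM ler_pM.
pose U1 (z : RM * RM) : R := a1 z.1 * b1 z.2.
pose U2 (z : RM * RM) : R := a2 z.1 * b2 z.2.
have mfst : measurable_fun setT (fun z : RM * RM => z.1 : R) := measurable_fst.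
have msnd : measurable_fun setT (fun z : RM * RM => z.2 : R) := measurable_snd.
have mU1 : measurable_fun setT U1.
  by apply: measurable_funM; [exact: (measurableT_comp ma1)|exact: (measurableT_comp mb1)].
have mU2 : measurable_fun setT U2.
  by apply: measurable_funM; [exact: (measurableT_comp ma2)|exact: (measurableT_comp mb2)].
have bU1 : bounded_by (2 * M * K * G) U1.
  by move=> z; rewrite /U1 normrM ler_pM// ?aB// gG.
have bU2 : bounded_by (2 * M * K * G) U2.
  by move=> z; rewrite /U2 normrM ler_pM// ?aB// gG.
(* The shift turns [U2] weighted by the joint density into [U1] weighted by it, so only the
   increment of P along the shift is left. It is 0 when P depends on the sum; for P = phi it is a
   second factor [D], which produces the energy [e]. *)
have key (P : RM * RM -> R) Q : measurable_fun setT P -> bounded_by Q P ->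
    \int[pair_law pf pg]_z (P z * (U1 z - U2 z)) =
    \int[mu]_x (f x * \int[mu]_y (g y * (P (x, y) * U1 (x, y)))) -
    \int[mu]_x (f x * \int[mu]_y (g y * (P (x + d, y + - d) * U1 (x, y)))).
  move=> mP PQ.
  have mPs (x : RM) : measurable_fun setT (fun y : R => P (x, y + - d)).
    have mPx : measurable_fun setT (fun y : R => P (x, y)) by exact: (measurableT_comp mP).
    exact: (measurable_shift (- d) mPx).
  have mPU1 : measurable_fun setT (fun z => P z * U1 z) by exact: measurable_funM.
  have mPU2 : measurable_fun setT (fun z => P z * U2 z) by exact: measurable_funM.
  have bPU1 : bounded_by (Q * (2 * M * K * G)) (fun z => P z * U1 z).
    by move=> z; rewrite normrM ler_pM// ?PQ ?bU1.
  have bPU2 : bounded_by (Q * (2 * M * K * G)) (fun z => P z * U2 z).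
    by move=> z; rewrite normrM ler_pM// ?PQ ?bU2.
  transitivity (\int[pair_law pf pg]_z (P z * U1 z - P z * U2 z)).
    by apply: eq_Rintegral => z _; rewrite mulrBr.
  rewrite RintegralB//; [|exact: (prob_Rintegrable _ mPU1 bPU1)|exact: (prob_Rintegrable _ mPU2 bPU2)].
  rewrite (Rintegral_pair_law _ _ mPU1 bPU1) (Rintegral_pair_law _ _ mPU2 bPU2).
  congr (_ - _).
  have msec x : measurable_fun setT (fun y => g y * (P (x, y) * U2 (x, y))).
    by apply: measurable_funM => //; exact: (measurableT_comp mPU2).
  transitivity (\int[mu]_x (f (x + d) * \int[mu]_y (g (y + - d) * (P (x + d, y + - d) * U2 (x + d, y + - d))))).
    have mO : measurable_fun setT (fun x => f x * \int[mu]_y (g y * (P (x, y) * U2 (x, y)))).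
      apply: measurable_funM => //.
      have := measurable_Rintegral1 (pdf_law pf) (pdf_law pg) mPU2 bPU2.
      apply: eq_measurable_fun => x _.
      rewrite (@Rintegral_pdf_law _ _ pg (fun y => P (x, y) * U2 (x, y)) (Q * (2 * M * K * G)))//.
      - by apply: eq_Rintegral => y _; rewrite mulrC.
      - exact: (measurableT_comp mPU2).
    rewrite -(Rintegral_shift d mO); apply: eq_Rintegral => x _; congr (_ * _).
    by rewrite -(Rintegral_shift (- d) (msec (x + d))).
  apply: eq_Rintegral => x _.
  rewrite /U1 /U2 /a1 /a2 /b1 /b2 /= addrK.
  rewrite -!RintegralZl//.
  - by apply: eq_Rintegral => y _; rewrite subrK; ring.
  - apply: (RintegrableM (M := Q * (2 * M * K * G)) (pdf_Rintegrable pg)).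
      by apply: measurable_funM; [exact: mPs|exact: measurable_funM].
    by move=> y; rewrite normrM ler_pM// ?PQ// normrM ler_pM// ?aB// gG.
  - have := Rintegrable_shift (- d) (pdf_Rintegrable pg) => igs.
    apply: (RintegrableM (M := Q * (2 * M * K * G)) igs).
      apply: measurable_funM; [exact: mPs|apply: measurable_funM => //].
      by under eq_fun do rewrite subrK.
    by move=> y; rewrite normrM ler_pM// ?PQ// normrM ler_pM// ?aB// subrK gG.
pose u z := U1 z - U2 z.
have mu_ : measurable_fun setT u by exact: measurable_funB.
pose Nu := 4 * M * K * G.
have bu : bounded_by Nu u.
  move=> z; rewrite (le_trans (ler_normB _ _))//.
  by rewrite (_ : Nu = 2 * M * K * G + 2 * M * K * G) ?lerD ?bU1 ?bU2// /Nu; ring.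
have u0 (k : RM -> R) Q : measurable_fun setT k -> bounded_by Q k ->
    \int[pair_law pf pg]_z (k (pair_sum z) * u z) = 0.
  move=> mk kQ; rewrite (@key (k \o @pair_sum R) Q)//; first last.
  - by move=> z; exact: kQ.
  - by apply: (measurableT_comp mk); exact: measurable_pair_sum.
  apply/eqP; rewrite subr_eq0; apply/eqP; apply: eq_Rintegral => x _; congr (_ * _).
  apply: eq_Rintegral => y _; congr (_ * (k _ * _)).
  by rewrite /pair_sum /=; ring.
pose e := \int[mu]_x (D x ^+ 2 * (f x * f (x + d))).
have iff_ : Rintegrable mu (fun x => f x * f (x + d)).
  apply: (RintegrableM (pdf_Rintegrable pf)); first exact: measurable_shift.
  by move=> x; exact: fK.
have e0 : 0 < e.
  by apply: increment_energy_pos => // x; rewrite mulr_gt0.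
have Ephi : \int[pair_law pf pg]_z ((phi \o fst) z * u z) = overlap g d * e.
  rewrite (@key (phi \o fst) M)//; first last.
  - by move=> z; exact: phiM.
  - exact: (measurableT_comp mphi).
  have ia1 : Rintegrable mu (fun x => f x * a1 x).
    by apply: (RintegrableM (pdf_Rintegrable pf) ma1 (fun x => aB x (x + d))).
  have E (q : R -> R) : 
      \int[mu]_x (f x * \int[mu]_y (g y * (q x * U1 (x, y)))) =
      \int[mu]_x (overlap g d * (f x * a1 x * q x)).
    apply: eq_Rintegral => x _; rewrite /U1 /=.
    transitivity (f x * \int[mu]_y (q x * a1 x * (g y * b1 y))).
      by congr (_ * _); apply: eq_Rintegral => y _; ring.
    rewrite RintegralZl//; last first.
      by apply: (RintegrableM (pdf_Rintegrable pg) mb1) => y; exact: gG.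
    rewrite /overlap /b1; ring.
  rewrite !(E phi, E (fun x => phi (x + d))) -RintegralB//; first last.
  - by apply: RintegrableZ; apply: (RintegrableM ia1 mphid) => x; exact: phiM.
  - by apply: RintegrableZ; exact: (RintegrableM ia1 mphi phiM).
  rewrite -RintegralZl//; last first.
    apply: (RintegrableMl (M := (2 * M) ^+ 2) iff_); first exact: measurable_funX.
    by move=> x; rewrite normrX ler_pXn2r ?nnegrE//; exact: le_trans (DM x).
  by apply: eq_Rintegral => x _; rewrite /a1 /D; ring.
(* Adding 1 makes the denominator positive without a separate argument. *)
have Nu1 : 0 < Nu ^+ 2 + 1 by rewrite ltr_wpDl// sqr_ge0.
exists ((overlap g d * e) ^+ 2 / (Nu ^+ 2 + 1)).
  by rewrite divr_gt0// exprn_gt0// mulr_gt0.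
move=> n h n0 mh hM.
have mpf : measurable_fun setT (phi \o fst : RM * RM -> R) by exact: (measurableT_comp mphi).
have bpf : bounded_by M (phi \o fst : RM * RM -> R) by move=> z; exact: phiM.
have := sq_risk_orth (@measurable_pair_sum R) mpf bpf n0 mh hM mu_ bu u0.
rewrite Ephi => H.
have U2b : \int[pair_law pf pg]_z (u z ^+ 2) <= Nu ^+ 2 + 1.
  apply: (@le_trans _ _ (Nu ^+ 2)); last by rewrite lerDl.
  apply: (le_trans (ler_norm _)); apply: Rintegral_prob_bound; first exact: measurable_funX.
  by move=> z; rewrite normrX ler_pXn2r ?nnegrE//; exact: le_trans (bu z).
have nR : 0 < n%:R :> R by rewrite ltr0n.
rewrite ler_pdivrMr// ler_pdivrMr// (le_trans H)//.
rewrite -mulrA ler_wpM2l//; last by rewrite ler_wpM2l.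
by apply: Rintegral_ge0 => t _; exact: sqr_ge0.
Qed.

End single_density.

(** * Sobolev balls *)

Section sobolev_ball.
Context (R : realType).
Local Notation mu := (@lebesgue_measure R).
Implicit Types (t : R -> R) (s B e w : R).

Lemma sqrD1_powR_le s w : 0 <= s -> (w ^+ 2 + 1) `^ s <= (1 + `|w|) `^ (2 * s).
Proof.
move=> s0; rewrite powRrM -[2]/(2%:R) powR_mulrn ?addr_ge0//.
apply: ge0_ler_powR => //; rewrite ?nnegrE ?exprn_ge0 ?addr_ge0 ?sqr_ge0//.
by rewrite -(real_normK (num_real w)); have := normr_ge0 w; nra.
Qed.

(** From 1 + |w| <= (s + 1) / e * exp y with y = e |w| / (s + 1): after raising to the power 2 s,
    the exponential is at most exp (2 e |w|). Using s + 1 in place of s avoids a division by 0. *)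
Lemma powR_laplace_le s e w : 0 <= s -> 0 < e <= 1 ->
  (w ^+ 2 + 1) `^ s * laplace (2 * e) w <= ((s + 1) / e) `^ (2 * s).
Proof.
move=> s0 /andP[e0 e1]; have s1 : 0 < s + 1 by rewrite ltr_wpDl.
pose y := e * `|w| / (s + 1).
have y0 : 0 <= y by rewrite divr_ge0 ?mulr_ge0// ltW.
have C0 : 0 < (s + 1) / e by rewrite divr_gt0.
have C1 : 1 <= (s + 1) / e by rewrite ler_pdivlMr// mul1r (le_trans e1)// lerDr.
have H : 1 + `|w| <= (s + 1) / e * expR y.
  apply: (@le_trans _ _ ((s + 1) / e * (1 + y))); last first.
    by rewrite ler_wpM2l ?expR_ge1Dx// ltW.
  have -> : (s + 1) / e * (1 + y) = (s + 1) / e + `|w|.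
    by rewrite /y; field; rewrite !gt_eqF.
  by rewrite lerD2r.
apply: (@le_trans _ _ ((1 + `|w|) `^ (2 * s) * laplace (2 * e) w)).
  by rewrite ler_wpM2r ?laplace_ge0// sqrD1_powR_le.
apply: (@le_trans _ _ (((s + 1) / e * expR y) `^ (2 * s) * laplace (2 * e) w)).
  rewrite ler_wpM2r ?laplace_ge0//; apply: ge0_ler_powR => //; rewrite ?nnegrE.
  - exact: mulr_ge0.
  - exact: addr_ge0.
  - by rewrite mulr_ge0 ?expR_ge0 ?(ltW C0).
rewrite powRM ?expR_ge0 ?(ltW C0)// -expRM -mulrA ler_piMr ?powR_ge0//.
rewrite /laplace -expRD -[leRHS]expR0 ler_expR.
have -> : y * (2 * s) - 2 * e * `|w| = - (2 * (e * `|w|) / (s + 1)).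
  by rewrite /y; field; rewrite gt_eqF.
by rewrite oppr_le0 divr_ge0 ?(ltW s1)// mulr_ge0// mulr_ge0// ltW.
Qed.

(** The fixed Cauchy component of scale [sg] receives whatever mass [t] leaves, so [t] is not
    normalized. *)
Definition mixture sg e t x := (1 - \int[mu]_y t y) * cauchy_pdf sg x + conv t (cauchy_pdf e) x.

Lemma Rintegrable_mixture sg e t : 0 < sg -> 0 < e -> Rintegrable mu t ->
  Rintegrable mu (mixture sg e t).
Proof.
move=> sg0 e0 it; apply: RintegrableD.
  by apply: RintegrableZ; exact: Rintegrable_cauchy_pdf.
by apply: (Rintegrable_conv it (Rintegrable_cauchy_pdf e0)) => x; exact: cauchy_pdf_le.
Qed.

Lemma mixture_is_pdf sg e t : 0 < sg -> 0 < e -> Rintegrable mu t ->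
  (forall x, 0 <= t x) -> \int[mu]_x t x <= 1 -> is_pdf (mixture sg e t).
Proof.
move=> sg0 e0 it t0 t1; have im := Rintegrable_mixture sg0 e0 it.
have ic := Rintegrable_cauchy_pdf e0; have is_ := Rintegrable_cauchy_pdf sg0.
have cb x := cauchy_pdf_le x e0.
split; first exact: (Rintegrable_measurable im).
  move=> x; apply: addr_ge0.
    by apply: mulr_ge0; [rewrite subr_ge0|exact: cauchy_pdf_ge0].
  by apply: Rintegral_ge0 => y _; rewrite mulr_ge0// cauchy_pdf_ge0.
rewrite RintegralE//; congr EFin; rewrite /mixture RintegralD//; first last.
- exact: (Rintegrable_conv it ic cb).
- exact: RintegrableZ.
rewrite RintegralZl// (Rintegral_conv it ic cb).
by rewrite (pdf_Rintegral (cauchy_pdf_is_pdf sg0)) (pdf_Rintegral (cauchy_pdf_is_pdf e0)) !mulr1 subrK.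
Qed.

Lemma osc_mixture psi sg e t w : 0 < sg -> 0 < e -> Rintegrable mu t ->
  osc psi (mixture sg e t) w =
  (1 - \int[mu]_y t y) * (cos psi * laplace sg w) + laplace e w * osc psi t w.
Proof.
move=> sg0 e0 it.
have ic := Rintegrable_cauchy_pdf e0; have is_ := Rintegrable_cauchy_pdf sg0.
have icv := Rintegrable_conv it ic (fun x => cauchy_pdf_le x e0).
have iZ := RintegrableZ (1 - \int[mu]_y t y) is_.
by rewrite (oscD _ _ iZ icv) (oscZ _ _ _ is_) osc_cauchy_pdf// osc_conv_cauchy.
Qed.

Lemma cmod_fourier_mixture sg e t w : 0 < sg -> 0 < e -> Rintegrable mu t ->
  (forall x, 0 <= t x) -> \int[mu]_x t x <= 1 ->
  cmod (fourier (mixture sg e t) w) ^+ 2 <=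
  2 * laplace (2 * sg) w + 2 * laplace (2 * e) w * (osc 0 t w ^+ 2 + osc (pi / 2) t w ^+ 2).
Proof.
move=> sg0 e0 it t0 t1; rewrite fourierE cmod_sqr/= !osc_mixture//.
have it0 : 0 <= \int[mu]_x t x by exact: Rintegral_ge0.
have L2 c : laplace (2 * c) w = laplace c w ^+ 2.
  by rewrite /laplace expr2 -expRD; congr expR; ring.
rewrite !L2 cos0 cos_pihalf mul0r mul1r mulr0 add0r.
have l0 := laplace_ge0 sg w.
set m := \int[mu]_x t x in it0 t1 *; set p := laplace sg w in l0 *; set q := laplace e w.
set u := osc 0 t w; set v := osc (pi / 2) t w.
have H1 : ((1 - m) * p) ^+ 2 <= p ^+ 2.
  rewrite exprMn ler_piMl ?sqr_ge0// expr_le1//; first by lra.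
  by rewrite subr_ge0.
have := sqr_ge0 ((1 - m) * p - q * u); have := sqr_ge0 (q * v); nra.
Qed.

(** Each component receives half of B^2. One unit of the scale of the fixed component absorbs the
    Sobolev weight at the cost (s + 1)^(2 s); the excess over 1 is chosen so that the remaining
    exponential integrates to exactly B^2 / 2. The other half is Bessel's inequality for [t], in
    both phases. *)
Lemma sobolev_mixture s B e t : 0 <= s -> 0 < B -> 0 < e <= 1 ->
  Rintegrable mu t -> (forall x, 0 <= t x) -> \int[mu]_x t x <= 1 ->
  Rintegrable mu (fun x => t x ^+ 2) ->
  16 * pi * ((s + 1) / e) `^ (2 * s) * \int[mu]_x t x ^+ 2 <= B ^+ 2 ->
  sobolev_pdf s B (mixture (1 + 4 * (s + 1) `^ (2 * s) / B ^+ 2) e t).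
Proof.
move=> s0 B0 e01 it t0 t1 it2 H; have /andP[e0 e1] := e01.
set Cs := (s + 1) `^ (2 * s); set sg := 1 + _.
have Cs0 : 0 < Cs by rewrite powR_gt0// ltr_wpDl.
have B20 : 0 < B ^+ 2 by rewrite exprn_gt0.
have k0 : 0 < sg - 1 by rewrite /sg addrC addKr divr_gt0// mulr_gt0.
have sg0 : 0 < sg by lra.
have mosc psi := measurable_osc psi it.
split; first exact: mixture_is_pdf.
set Ce := ((s + 1) / e) `^ (2 * s) in H.
have Ce0 : 0 <= Ce by exact: powR_ge0.
pose F1 w := 2 * Cs * laplace (2 * (sg - 1)) w.
pose F2 w := 2 * Ce * (osc 0 t w ^+ 2 + osc (pi / 2) t w ^+ 2).
have mF1 : measurable_fun setT F1 by apply: measurable_funM => //; exact: measurable_laplace.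
have mo2 : measurable_fun setT (fun w => osc 0 t w ^+ 2 + osc (pi / 2) t w ^+ 2).
  by apply: measurable_funD; exact: measurable_funX.
have mF2 : measurable_fun setT F2 by apply: measurable_funM.
have F10 w : 0 <= F1 w by rewrite !mulr_ge0 ?laplace_ge0// ltW.
have F20 w : 0 <= F2 w by rewrite !mulr_ge0// addr_ge0 ?sqr_ge0.
have mim := Rintegrable_mixture sg0 e0 it.
have mW : measurable_fun setT (fun w => cmod (fourier (mixture sg e t) w) ^+ 2 * (w ^+ 2 + 1) `^ s).
  apply: measurable_funM.
    rewrite (_ : (fun _ => _) = (fun w => osc 0 (mixture sg e t) w ^+ 2 + osc (pi / 2) (mixture sg e t) w ^+ 2)); last first.
      by apply/funext => w; rewrite fourierE cmod_sqr.
    by apply: measurable_funD; apply: measurable_funX; exact: measurable_osc.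
  apply: (measurableT_comp (measurable_powR s)).
  by apply: measurable_funD => //; exact: measurable_funX.
apply: (@le_trans _ _ (\int[mu]_w (F1 w + F2 w)%:E)%E).
  apply: ge0_le_integral => //.
  - by move=> w _; rewrite lee_fin mulr_ge0 ?sqr_ge0 ?powR_ge0.
  - exact/measurable_EFinP.
  - by apply/measurable_EFinP; exact: measurable_funD.
  move=> w _; rewrite lee_fin.
  have S0 : 0 <= osc 0 t w ^+ 2 + osc (pi / 2) t w ^+ 2 by rewrite addr_ge0 ?sqr_ge0.
  apply: (le_trans (ler_wpM2r (powR_ge0 _ _) (cmod_fourier_mixture w sg0 e0 it t0 t1))).
  have e11 : 0 < (1 : R) <= 1 by rewrite ltr01 lexx.
  have P1 : (w ^+ 2 + 1) `^ s * laplace 2 w <= Cs.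
    by have := powR_laplace_le w s0 e11; rewrite mulr1 divr1.
  have P2 := powR_laplace_le w s0 e01.
  have L : laplace (2 * sg) w = laplace 2 w * laplace (2 * (sg - 1)) w.
    by rewrite /laplace -expRD; congr expR; ring.
  have l0 := laplace_ge0 (2 * (sg - 1)) w.
  rewrite mulrDl; apply: lerD.
    rewrite L /F1; have := ler_wpM2r l0 P1; lra.
  rewrite /F2 -/Ce in P2 *; have := ler_wpM2r S0 P2; lra.
under eq_integral do rewrite EFinD.
rewrite ge0_integralD//; last 4 first.
- by move=> w _; rewrite lee_fin.
- exact/measurable_EFinP.
- by move=> w _; rewrite lee_fin.
- exact/measurable_EFinP.
have -> : (B ^+ 2)%:E = ((B ^+ 2 / 2)%:E + (B ^+ 2 / 2)%:E)%E.
  by rewrite -EFinD; congr EFin; field.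
apply: leeD.
  have il : Rintegrable mu (laplace (2 * (sg - 1))) by apply: Rintegrable_laplace; rewrite mulr_gt0.
  rewrite RintegralE; last exact: RintegrableZ.
  rewrite RintegralZl// (RintegralE_eq (integral_laplace _)) ?mulr_gt0//.
  rewrite lee_fin /sg addrC addKr le_eqVlt; apply/orP; left; apply/eqP.
  by field; rewrite !gt_eqF.
under eq_integral do rewrite EFinM EFinD.
rewrite ge0_integralZl//; first last.
- by rewrite lee_fin mulr_ge0.
- by move=> w _; rewrite -EFinD lee_fin addr_ge0 ?sqr_ge0.
- by apply/measurable_EFinP.
have msq psi : measurable_fun setT (fun x => (osc psi t x ^+ 2)%:E) by exact/measurable_EFinP/measurable_funX.
have sq0 psi x : (0 <= (osc psi t x ^+ 2)%:E)%E by rewrite lee_fin sqr_ge0.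
rewrite ge0_integralD//; do ?exact: msq.
apply: (@le_trans _ _ ((2 * Ce)%:E * ((2 * pi * \int[mu]_y (t y ^+ 2))%:E + (2 * pi * \int[mu]_y (t y ^+ 2))%:E))%E).
  by rewrite lee_wpmul2l ?lee_fin ?mulr_ge0// leeD// bessel.
rewrite -EFinD -EFinM lee_fin; move: H; set I := \int[mu]_x _; move: (pi : R) => p; lra.
Qed.

End sobolev_ball.

(** * Perturbations with transform in a window *)

Section lipschitz.
Context (R : realType).
Implicit Types (f h : R -> R).

Definition lip L f := forall x y : R, `|f x - f y| <= L * `|x - y|.

Lemma lip_continuous L f : lip L f -> continuous f.
Proof.
move=> fL x; have L0 : 0 <= L.
  by have := fL 1 0; rewrite subr0 normr1 mulr1; apply: le_trans.
apply/cvgrPdist_le => e e0; near=> y.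
rewrite (le_trans (fL x y))//.
have yx : `|x - y| <= e / (L + 1).
  near: y; apply/nbhs_ballP; exists (e / (L + 1)) => /=; first by rewrite divr_gt0// ltr_wpDl.
  by move=> y; rewrite /ball/= => /ltW.
apply: (@le_trans _ _ ((L + 1) * `|x - y|)); first by rewrite ler_wpM2r// lerDl.
by rewrite mulrC -ler_pdivlMr// ltr_wpDl.
Unshelve. all: by end_near.
Qed.

Lemma lip_measurable L f : lip L f -> measurable_fun setT f.
Proof. by move=> /lip_continuous; exact: continuous_measurable_fun. Qed.

(** [f] is controlled on [l, r] only. If one of the two points lies outside, [h] vanishes there and
    its own Lipschitz bound at the other point suffices. *)
Lemma lip_mul (l r a0 a1 F0 F1 : R) h f : 0 <= a0 -> 0 <= a1 -> 0 <= F0 -> 0 <= F1 ->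
  (forall x, `|h x| <= a0) -> lip a1 h -> (forall x, x < l \/ r < x -> h x = 0) ->
  (forall x, l <= x <= r -> `|f x| <= F0) ->
  (forall x y, l <= x <= r -> l <= y <= r -> `|f x - f y| <= F1 * `|x - y|) ->
  lip (a1 * F0 + a0 * F1) (fun x => h x * f x).
Proof.
move=> a00 a10 F00 F10 hb hl hs fb fl.
have out x : ~~ (l <= x <= r) -> h x = 0.
  by rewrite negb_and -!ltNge => /orP ?; exact: hs.
have one x y : l <= x <= r -> h y = 0 ->
    `|h x * f x| <= (a1 * F0 + a0 * F1) * `|x - y|.
  move=> xJ hy; apply: (@le_trans _ _ (a1 * F0 * `|x - y|)); last first.
    by rewrite ler_wpM2r// lerDl mulr_ge0.
  rewrite normrM mulrAC ler_pM ?fb//.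
  by have := hl x y; rewrite hy subr0.
move=> x y; case: (boolP (l <= x <= r)) => xJ; case: (boolP (l <= y <= r)) => yJ.
- have -> : h x * f x - h y * f y = (h x - h y) * f x + h y * (f x - f y) by ring.
  apply: (le_trans (ler_normD _ _)); rewrite [leRHS]mulrDl !normrM; apply: lerD.
    by rewrite mulrAC ler_pM ?fb.
  by rewrite -mulrA ler_pM ?fl.
- by rewrite (out _ yJ) mul0r subr0 one// out.
- by rewrite (out _ xJ) mul0r sub0r normrN distrC one// out.
- by rewrite (out _ xJ) (out _ yJ) !mul0r subrr normr0 mulr_ge0// addr_ge0// mulr_ge0.
Qed.

End lipschitz.

Section weighted.
Context (R : realType).
Local Notation mu := (@lebesgue_measure R).
Implicit Types (u v h : R -> R) (X Y : R).

(** The form taken by the chi-square distance once the reference density is at least a multiple of 1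
    / (1 + x^2). Measurability is included so that L^1 and L^2 bounds can be read off with
    [Rintegrable_weight]. *)
Definition weighted u X := measurable_fun setT u /\
  (\int[mu]_x ((1 + x ^+ 2) * u x ^+ 2)%:E <= X%:E)%E.

Lemma weight_ge0 u x : 0 <= (1 + x ^+ 2) * u x ^+ 2.
Proof. by rewrite mulr_ge0 ?sqr_ge0// addr_ge0// sqr_ge0. Qed.

Lemma measurable_weight u : measurable_fun setT u ->
  measurable_fun setT (fun x : R => ((1 + x ^+ 2) * u x ^+ 2)%:E).
Proof.
move=> m; apply/measurable_EFinP; apply: measurable_funM; last exact: measurable_funX.
by apply: measurable_funD => //; exact: measurable_funX.
Qed.

Lemma weightedZ c u X : weighted u X -> weighted (fun x => c * u x) (c ^+ 2 * X).
Proof.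
move=> [m H]; split; first exact: measurable_funM.
under eq_integral do rewrite exprMn mulrCA EFinM.
rewrite ge0_integralZl//; first by rewrite [leRHS]EFinM; apply: lee_wpmul2l => //; rewrite lee_fin sqr_ge0.
- exact: measurable_weight.
- by move=> x _; rewrite lee_fin weight_ge0.
- by rewrite lee_fin sqr_ge0.
Qed.

Lemma weightedD u v X Y : weighted u X -> weighted v Y ->
  weighted (fun x => u x + v x) (2 * (X + Y)).
Proof.
move=> [mu_ Hu] [mv Hv]; split; first exact: measurable_funD.
apply: (@le_trans _ _ (\int[mu]_x (2%:E * (((1 + x ^+ 2) * u x ^+ 2)%:E + ((1 + x ^+ 2) * v x ^+ 2)%:E)))%E).
  apply: ge0_le_integral => //.
  - by move=> x _; rewrite lee_fin (weight_ge0 (fun x => u x + v x)).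
  - by apply: (@measurable_weight (fun x => u x + v x)); exact: measurable_funD.
  - by apply: measurable_funeM; apply: emeasurable_funD; exact: measurable_weight.
  move=> x _; rewrite -EFinD -EFinM lee_fin.
  have p0 : 0 <= 1 + x ^+ 2 by rewrite addr_ge0// sqr_ge0.
  have uv : (u x + v x) ^+ 2 <= 2 * (u x ^+ 2 + v x ^+ 2) by have := sqr_ge0 (u x - v x); nra.
  by have := ler_wpM2l p0 uv; lra.
rewrite ge0_integralZl//; first last.
- by move=> x _; rewrite -EFinD lee_fin addr_ge0 ?weight_ge0.
- by apply: emeasurable_funD; exact: measurable_weight.
rewrite ge0_integralD//; first by rewrite [leRHS]EFinM (EFinD X Y); apply: lee_wpmul2l; [rewrite lee_fin|exact: leeD].
- by move=> x _; rewrite lee_fin weight_ge0.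
- exact: measurable_weight.
- by move=> x _; rewrite lee_fin weight_ge0.
- exact: measurable_weight.
Qed.

Lemma weighted_osc psi h l r M L : l <= r -> (forall x, `|h x| <= M) -> lip L h ->
  (forall x, x < l \/ r < x -> h x = 0) ->
  weighted (osc psi h) (2 * pi * ((M ^+ 2 + L ^+ 2) * (r - l))).
Proof.
move=> lr hM hL hs; have mh := lip_measurable hL.
split; first exact: (measurable_osc psi (Rintegrable_supported mh hM hs)).
exact: osc_weight lr mh hM hs hL psi.
Qed.

Lemma osc0_odd u w : Rintegrable mu u -> (forall x, u (- x) = - u x) -> osc 0 u w = 0.
Proof.
move=> iu uN; have m1 := measurable_phase1 0 w.
apply: Rintegral_odd0.
- by apply: measurable_funM => //; exact: Rintegrable_measurable iu.
- by move=> x; rewrite uN !subr0 mulrN cosN mulNr.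
- by apply: (RintegrableM iu m1) => x; exact: cos_max.
Qed.

Lemma oscpi2_even u w : Rintegrable mu u -> (forall x, u (- x) = u x) -> osc (pi / 2) u w = 0.
Proof.
move=> iu uN; have m1 := measurable_phase1 (pi / 2) w.
apply: Rintegral_odd0.
- by apply: measurable_funM => //; exact: Rintegrable_measurable iu.
- by move=> x; rewrite uN !cosBpihalf mulrN sinN mulrN.
- by apply: (RintegrableM iu m1) => x; exact: cos_max.
Qed.

End weighted.

(** * Functions with a prescribed transform on a window *)

Section perturbation.
Context (R : realType).
Local Notation mu := (@lebesgue_measure R).
Variables (G1 G2 : R -> R) (l r a0 a1 : R).
Hypotheses (l0 : 0 < l) (lr : l <= r).
Hypotheses (G1b : forall x, `|G1 x| <= a0) (G2b : forall x, `|G2 x| <= a0).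
Hypotheses (G1l : lip a1 G1) (G2l : lip a1 G2).
Hypothesis G1s : forall x, x < l \/ r < x -> G1 x = 0.
Hypothesis G2s : forall x, x < l \/ r < x -> G2 x = 0.

(** The inverse transform of G1 + i G2 on [l, r], continued to negative frequencies by conjugation.
    The factor comes from [osc_inversion]. As l > 0, the transform vanishes at 0, which makes the
    integral 0. *)
Definition pert x := pi^-1 * (osc 0 G1 x + osc (pi / 2) G2 x).

Let iG1 : Rintegrable mu G1.
Proof. exact: (Rintegrable_supported (lip_measurable G1l) G1b G1s). Qed.
Let iG2 : Rintegrable mu G2.
Proof. exact: (Rintegrable_supported (lip_measurable G2l) G2b G2s). Qed.

Let w1 := weighted_osc 0 lr G1b G1l G1s.
Let w2 := weighted_osc (pi / 2) lr G2b G2l G2s.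

Let io1 : Rintegrable mu (osc 0 G1).
Proof. by case: w1 => m /(Rintegrable_weight m)[]. Qed.
Let io2 : Rintegrable mu (osc (pi / 2) G2).
Proof. by case: w2 => m /(Rintegrable_weight m)[]. Qed.

Lemma weighted_pert : weighted pert (8 / pi * ((a0 ^+ 2 + a1 ^+ 2) * (r - l))).
Proof.
(* The constant 8 / pi is pi^-2 times 2 (2 pi + 2 pi), the outer 2 being that of [weightedD]. *)
have := weightedZ pi^-1 (weightedD w1 w2).
set X := (X in weighted _ X -> _); set Y := (X in _ -> weighted _ X).
suff -> : X = Y by [].
rewrite /X /Y; have := pi_gt0 R; move: (pi : R) => p p0; field; exact: lt0r_neq0.
Qed.

Lemma Rintegrable_pert : Rintegrable mu pert.
Proof. by case: weighted_pert => m /(Rintegrable_weight m)[]. Qed.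

Lemma osc0_pert w : osc 0 pert w = G1 w + G1 (- w).
Proof.
have p0 := pi_gt0 R.
rewrite /pert oscZ ?oscD//; last exact: RintegrableD.
rewrite (osc0_odd w io2) ?addr0; last by move=> x; exact: oscpi2N.
rewrite (osc_inversion iG1 G1b _ _ io1); [|exact: (lip_continuous G1l)..].
by rewrite mulr0 cos0 mul1r mulrA mulVf ?mul1r// gt_eqF.
Qed.

Lemma oscpi2_pert w : osc (pi / 2) pert w = G2 w - G2 (- w).
Proof.
have p0 := pi_gt0 R.
rewrite /pert oscZ ?oscD//; last exact: RintegrableD.
rewrite (oscpi2_even w io1) ?add0r; last by move=> x; exact: osc0N.
rewrite (osc_inversion iG2 G2b _ _ io2); [|exact: (lip_continuous G2l)..].
rewrite [2 * _]mulrC divfK ?pnatr_eq0// cospi mulN1r.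
by rewrite mulrA mulVf ?mul1r// gt_eqF.
Qed.

Lemma Rintegral_pert : \int[mu]_x pert x = 0.
Proof.
transitivity (osc 0 pert 0).
  by apply: eq_Rintegral => x _; rewrite mul0r subr0 cos0 mulr1.
by rewrite osc0_pert oppr0 G1s ?addr0//; left.
Qed.

Section convolution.
Variables (g : R -> R) (e b0 b1 : R).
Hypotheses (ig : Rintegrable mu g) (e0 : 0 < e).
Hypothesis Hb : forall psi x, psi \in [:: 0; pi / 2] ->
  `|G1 x * (laplace e x * osc psi g x)| <= b0 /\ `|G2 x * (laplace e x * osc psi g x)| <= b0.
Hypothesis Hl : forall psi, psi \in [:: 0; pi / 2] ->
  lip b1 (fun x => G1 x * (laplace e x * osc psi g x)) /\
  lip b1 (fun x => G2 x * (laplace e x * osc psi g x)).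

(** Smoothing multiplies both spectra by [laplace e], and convolution with [g] multiplies each by
    the real and by the imaginary part of the transform of [g]. The four resulting spectra are still
    supported in [l, r], so the weighted bound applies to each. *)
Lemma conv_pert x : conv g (conv pert (cauchy_pdf e)) x =
  pi^-1 * ((osc 0 (fun y => G1 y * (laplace e y * osc 0 g y)) x +
            osc (pi / 2) (fun y => G1 y * (laplace e y * osc (pi / 2) g y)) x) +
           (osc (pi / 2) (fun y => G2 y * (laplace e y * osc 0 g y)) x +
            osc (pi / 2 + pi / 2) (fun y => G2 y * (laplace e y * osc (pi / 2) g y)) x)).
Proof.
have ml := measurable_laplace e.
have ll y : `|laplace e y| <= 1 by rewrite ger0_norm ?laplace_ge0// laplace_le1// ltW.
have iG1e := RintegrableM iG1 ml ll; have iG2e := RintegrableM iG2 ml ll.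
have ic := Rintegrable_cauchy_pdf e0.
have E : conv pert (cauchy_pdf e) =
    (fun z => pi^-1 * (osc 0 (fun w => G1 w * laplace e w) z + osc (pi / 2) (fun w => G2 w * laplace e w) z)).
  apply/funext => z; rewrite -!conv_osc_cauchy//.
  have icz : measurable_fun setT (fun y : R => cauchy_pdf e (z - y)).
    by apply: (measurableT_comp (Rintegrable_measurable ic)); exact: measurable_funB.
  have cb y := cauchy_pdf_le (z - y) e0.
  have j1 := RintegrableM io1 icz cb; have j2 := RintegrableM io2 icz cb.
  rewrite /conv -RintegralD// -RintegralZl//; last exact: RintegrableD.
  by apply: eq_Rintegral => y _; rewrite /pert; ring.
have A (h : R -> R) psi : (fun y => h y * (laplace e y * osc psi g y)) = (fun y => h y * laplace e y * osc psi g y).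
  by apply/funext => y; rewrite mulrA.
rewrite !A; have := conv_osc 0 x ig iG1e; rewrite add0r => <-.
have := conv_osc (pi / 2) x ig iG2e => <-.
rewrite E /conv.
have mo h psi z : Rintegrable mu h -> Rintegrable mu (fun y => g y * osc psi h (z - y)).
  move=> ih; apply: (RintegrableM ig); last by move=> y; exact: osc_bound.
  by apply: (measurableT_comp (measurable_osc psi ih)); exact: measurable_funB.
have k1 := mo _ 0 x iG1e; have k2 := mo _ (pi / 2) x iG2e.
rewrite -RintegralD// -RintegralZl//; last exact: RintegrableD.
by apply: eq_Rintegral => y _; ring.
Qed.

Lemma weighted_conv_pert : weighted (conv g (conv pert (cauchy_pdf e)))
  (32 / pi * ((b0 ^+ 2 + b1 ^+ 2) * (r - l))).
Proof.
have i0 : (0 : R) \in [:: 0; pi / 2] by rewrite inE eqxx.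
have i1 : (pi / 2 : R) \in [:: 0; pi / 2] by rewrite !inE eqxx orbT.
have S psi x : x < l \/ r < x -> G1 x * (laplace e x * osc psi g x) = 0.
  by move=> /G1s ->; rewrite mul0r.
have S' psi x : x < l \/ r < x -> G2 x * (laplace e x * osc psi g x) = 0.
  by move=> /G2s ->; rewrite mul0r.
have W psi psi' : psi \in [:: 0; pi / 2] ->
   weighted (osc psi' (fun x => G1 x * (laplace e x * osc psi g x))) (2 * pi * ((b0 ^+ 2 + b1 ^+ 2) * (r - l))) /\
   weighted (osc psi' (fun x => G2 x * (laplace e x * osc psi g x))) (2 * pi * ((b0 ^+ 2 + b1 ^+ 2) * (r - l))).
  move=> hp; have [L1 L2] := Hl hp.
  by split; apply: weighted_osc => // x; [have [] := Hb x hp|exact: S|have [] := Hb x hp|exact: S'].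
have [W1 _] := W 0 0 i0; have [W2 _] := W (pi / 2) (pi / 2) i1.
have [_ W3] := W 0 (pi / 2) i0; have [_ W4] := W (pi / 2) (pi / 2 + pi / 2) i1.
have := weightedZ pi^-1 (weightedD (weightedD W1 W2) (weightedD W3 W4)).
rewrite (_ : (fun x => _) = conv g (conv pert (cauchy_pdf e))); last by apply/funext => x; rewrite conv_pert.
set X := (X in weighted _ X -> _); set Y := (X in _ -> weighted _ X).
suff -> : X = Y by [].
rewrite /X /Y; have := pi_gt0 R; move: (pi : R) => p p0; field; exact: lt0r_neq0.
Qed.

End convolution.

End perturbation.

(** * Two densities *)

Section two_point.
Context (R : realType).
Local Notation mu := (@lebesgue_measure R).
Local Notation RM := (measurableTypeR R).

(** From 1 + (y - x)^2 <= 2 (1 + y^2) (1 + x^2), the translates of the Cauchy density are at least a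
    multiple of the product of 1 / (1 + y^2) and 1 / (1 + x^2). The integral of g(x) / (1 + x^2) is
    positive because g has mass 1. *)
Lemma conv_cauchy_lower (g : R -> R) (sg : R) : is_pdf g -> 0 < sg ->
  exists2 c, 0 < c & forall y, c <= (1 + y ^+ 2) * conv g (cauchy_pdf sg) y.
Proof.
move=> pg sg0; have ig := pdf_Rintegrable pg; have g0 := pdf_ge0 pg; have mg := pdf_measurable pg.
have d0 (x : R) : 0 < 1 + x ^+ 2 by rewrite ltr_wpDr ?sqr_ge0.
pose v (x : R) := (1 + x ^+ 2)^-1.
have v0 x : 0 < v x by rewrite invr_gt0.
have v1 x : `|v x| <= 1.
  by rewrite ger0_norm ?(ltW (v0 x))// invf_le1// lerDl sqr_ge0.
have mv : measurable_fun setT v.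
  by apply: measurable_inv_gt0 => //; apply: measurable_funD => //; exact: measurable_funX.
have igv := RintegrableM ig mv v1.
pose I := \int[mu]_x (g x * v x).
have I0 : 0 < I.
  have Ige : 0 <= I by apply: Rintegral_ge0 => x _; rewrite mulr_ge0// ltW.
  rewrite lt_neqAle Ige andbT; apply/eqP => /esym E0.
  have ae0 : ae_eq mu setT (EFin \o (fun x => g x * v x)) (cst 0%E).
    apply/(ae_eq_integral_abs _ measurableT).
      by apply/measurable_EFinP; exact: (Rintegrable_measurable igv).
    transitivity (\int[mu]_x (g x * v x)%:E)%E.
      by apply: eq_integral => x _ /=; rewrite ger0_norm// mulr_ge0// ltW.
    by rewrite RintegralE// -/I E0.
  have : \int[mu]_x g x = 0.
    rewrite -(Rintegral_cst1 (pdf_law pg) 0) /Rintegral integral0; congr fine.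
    rewrite -[RHS](integral0 mu setT); apply: ae_eq_integral => //.
    - exact/measurable_EFinP.
    - apply: filterS ae0 => x /= H _; have /eqP := H Logic.I.
      by rewrite eqe mulf_eq0 [X in _ || X](gt_eqF (v0 x)) orbF => /eqP ->.
  by move/eqP; rewrite (pdf_Rintegral pg) oner_eq0.
have p0 := pi_gt0 R.
pose c1 := (2 * pi)^-1 * (2 * sg / (1 + sg ^+ 2)).
have c10 : 0 < c1 by rewrite mulr_gt0 ?invr_gt0 ?divr_gt0 ?mulr_gt0.
have low z : c1 * v z <= cauchy_pdf sg z.
  rewrite /c1 /cauchy_pdf /cauchy_kernel -mulrA ler_pM2l ?invr_gt0 ?mulr_gt0//.
  have -> : 2 * sg / (1 + sg ^+ 2) * v z = 2 * sg / ((1 + sg ^+ 2) * (1 + z ^+ 2)).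
    by rewrite /v; field; rewrite !lt0r_neq0.
  rewrite ler_pM2l ?mulr_gt0// lef_pV2 ?posrE ?mulr_gt0 ?cauchy_kernel_denom//.
  by have := sqr_ge0 (sg * z); nra.
exists (c1 / 2 * I); first by rewrite mulr_gt0// divr_gt0.
move=> y; have ic := Rintegrable_cauchy_pdf sg0.
have mcy : measurable_fun setT (fun x : R => cauchy_pdf sg (y - x)).
  by apply: (measurableT_comp (Rintegrable_measurable ic)); exact: measurable_funB.
have icy := RintegrableM ig mcy (fun x => cauchy_pdf_le (y - x) sg0).
suff low2 : c1 / 2 * v y * I <= conv g (cauchy_pdf sg) y.
  have := ler_wpM2l (ltW (d0 y)) low2; apply: le_trans.
  by rewrite le_eqVlt; apply/orP; left; apply/eqP; rewrite /v; field; rewrite gt_eqF.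
rewrite /I -RintegralZl//; apply: le_Rintegral => //; first exact: RintegrableZ.
move=> x _; rewrite mulrCA ler_wpM2l//; apply: le_trans (low _).
have -> : c1 / 2 * v y * v x = c1 * (2 * (1 + y ^+ 2) * (1 + x ^+ 2))^-1.
  by rewrite /v; field; rewrite !lt0r_neq0.
rewrite ler_pM2l// lef_pV2 ?posrE ?mulr_gt0//.
by have := sqr_ge0 (x * y); have := sqr_ge0 (x + y); nra.
Qed.

Variables (phi : R -> R) (M : R) (g f0 f1 : R -> R).
Hypotheses (mphi : measurable_fun setT phi) (phiM : bounded_by M phi).
Hypotheses (pg : is_pdf g) (p0 : is_pdf f0) (p1 : is_pdf f1).
Hypotheses (b0 : exists K, bounded_by K f0) (b1 : exists K, bounded_by K f1).
Variables (c X : R).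
Hypotheses (c0 : 0 < c) (qc : forall y, c <= (1 + y ^+ 2) * conv g f0 y).
Hypothesis f12 : forall x, f1 x <= 2 * f0 x.
Hypothesis WX : weighted (fun y => conv g f1 y - conv g f0 y) X.

Let q0 := conv g f0.
Let q1 := conv g f1.

Let d0 (x : R) : 0 < 1 + x ^+ 2. Proof. by rewrite ltr_wpDr ?sqr_ge0. Qed.

Let q0_gt0 y : 0 < q0 y.
Proof. by rewrite -(pmulr_rgt0 _ (d0 y)) (lt_le_trans c0). Qed.

Let pq0 : is_pdf q0. Proof. exact: conv_pdf_is_pdf. Qed.
Let pq1 : is_pdf q1. Proof. exact: conv_pdf_is_pdf. Qed.

Let q12 y : q1 y <= 2 * q0 y.
Proof.
have [K0 K0b] := b0; have [K1 K1b] := b1; have ig := pdf_Rintegrable pg.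
have ms (f : R -> R) : measurable_fun setT f -> measurable_fun setT (fun x : R => f (y - x)).
  by move=> mf; apply: (measurableT_comp mf); exact: measurable_funB.
have i0 := RintegrableM ig (ms _ (pdf_measurable p0)) (fun x => K0b (y - x)).
have i1 := RintegrableM ig (ms _ (pdf_measurable p1)) (fun x => K1b (y - x)).
rewrite /q0 /conv -RintegralZl//; apply: le_Rintegral => //; first exact: RintegrableZ.
by move=> x _; rewrite mulrCA ler_wpM2l// pdf_ge0.
Qed.

Definition lik y := q1 y / q0 y.

Let likb : bounded_by 2 lik.
Proof.
move=> y; rewrite ger0_norm ?divr_ge0 ?(ltW (q0_gt0 y))//; last exact: pdf_ge0.
by rewrite ler_pdivrMr ?q12// q0_gt0.
Qed.

Let mlik : measurable_fun setT lik.
Proof.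
apply: measurable_funM; first exact: pdf_measurable.
by apply: measurable_inv_gt0; first exact: pdf_measurable.
Qed.

(** The chi-square identity: q1^2 / q0 is q0 + 2 (q1 - q0) + (q1 - q0)^2 / q0. The middle term
    integrates to 0, and 1 / q0 <= (1 + y^2) / c bounds the last by the weighted integral. *)
Let lik_sq : \int[pair_law p0 pg]_z (lik (pair_sum z) ^+ 2) <= 1 + X / c.
Proof.
have bl2 : bounded_by (2 ^+ 2) (fun y => lik y ^+ 2).
  by move=> y; rewrite normrX lerXn2r ?nnegrE.
have ml2 : measurable_fun setT (fun y => lik y ^+ 2) by exact: measurable_funX.
have := Rintegral_pair_law_sum p0 pg b0 ml2 bl2.
rewrite -/q0 => ->.
have [mW HW] := WX; have [iW _ _ _ _] := Rintegrable_weight mW HW.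
have ip0 := pdf_Rintegrable pq0; have ip1 := pdf_Rintegrable pq1.
have iWc := RintegrableZ c^-1 iW; have iB := RintegrableZ 2 (RintegrableB ip1 ip0).
apply: (@le_trans _ _ (\int[mu]_y (q0 y + 2 * (q1 y - q0 y) +
    c^-1 * ((1 + y ^+ 2) * (q1 y - q0 y) ^+ 2)))); last first.
  rewrite RintegralD//; last exact: RintegrableD.
  rewrite RintegralD// RintegralZl//; last exact: RintegrableB.
  have D0 : \int[mu]_y (q1 y - q0 y) = 0.
    by rewrite (RintegralB measurableT ip1 ip0) (pdf_Rintegral pq1) (pdf_Rintegral pq0) subrr.
  rewrite D0 (pdf_Rintegral pq0) mulr0 addr0 lerD2l (RintegralZl _ measurableT iW).
  rewrite mulrC ler_pM2r ?invr_gt0//.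
  by move: HW; rewrite RintegralE// lee_fin.
apply: le_Rintegral => //.
- exact: (RintegrableMl ip0 ml2 bl2).
- by apply: RintegrableD => //; exact: RintegrableD.
move=> y _; have qy := q0_gt0 y.
have E : lik y ^+ 2 * q0 y = q0 y + 2 * (q1 y - q0 y) + (q1 y - q0 y) ^+ 2 / q0 y.
  by rewrite /lik; field; rewrite gt_eqF.
rewrite E lerD2l mulrA mulrC ler_wpM2r ?sqr_ge0//.
rewrite -[leLHS]mul1r ler_pdivrMr// -mulrA ler_pdivlMl// mulr1.
exact: qc.
Qed.

Lemma two_point_risk n (h : n.-tuple RM -> R) r : (0 < n)%N ->
  measurable_fun setT h -> bounded_by M h -> n%:R * (X / c) <= 1 ->
  sq_risk (@pair_sum R) (phi \o fst) h (pair_law p0 pg) <= r ->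
  sq_risk (@pair_sum R) (phi \o fst) h (pair_law p1 pg) <= r ->
  (\int[mu]_x (phi x * f1 x) - \int[mu]_x (phi x * f0 x)) ^+ 2 <=
  2 * r + 2 * (expR 1 * (2 * r + 2 * ((2 * M) ^+ 2 / n%:R))).
Proof.
move=> n0 mh hM nX r0 r1.
have mpf : measurable_fun setT (phi \o fst : RM * RM -> R) by exact: (measurableT_comp mphi).
have bpf : bounded_by M (phi \o fst : RM * RM -> R) by move=> z; exact: phiM.
have [K0 K0b] := b0; have [K1 K1b] := b1.
have P (k : RM -> R) K : measurable_fun setT k -> bounded_by K k ->
    \int[pair_law p1 pg]_z k (pair_sum z) =
    \int[pair_law p0 pg]_z (k (pair_sum z) * lik (pair_sum z)).
  move=> mk kK; apply: (likelihood_ratio p0 p1 pg K0b K1b q0_gt0 mk kK).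
  by exists 2; exact: likb.
have E f (pf : is_pdf f) : \int[pair_law pf pg]_z (phi \o fst) z = \int[mu]_x (phi x * f x).
  rewrite (Rintegral_pair_law pf pg mpf bpf); apply: eq_Rintegral => x _ /=.
  by rewrite (RintegralZr _ measurableT (pdf_Rintegrable pg)) (pdf_Rintegral pg) mul1r mulrC.
have := sq_risk_two_point (@measurable_pair_sum R) mpf bpf n0 mh hM mlik likb P lik_sq nX r0 r1.
by rewrite !E.
Qed.

End two_point.

(** * Lipschitz bounds on an interval *)

Section lip_on.
Context (R : realType).
Implicit Types (f u v : R -> R) (l r K : R).

Lemma MVT_lip f l r K :
  (forall x, l <= x <= r -> derivable f x 1 /\ `|f^`()%classic x| <= K) ->
  forall x y, l <= x <= r -> l <= y <= r -> `|f x - f y| <= K * `|x - y|.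
Proof.
move=> fd.
have lt x y : l <= x <= r -> l <= y <= r -> x < y -> `|f x - f y| <= K * `|x - y|.
  move=> /andP[lx xr] /andP[ly yr] xy.
  have inJ z : x <= z <= y -> l <= z <= r.
    by move=> /andP[xz zy]; rewrite (le_trans lx xz) (le_trans zy yr).
  have [||c] := @MVT R f f^`()%classic x y xy.
  - move=> z; rewrite in_itv/= => /andP[xz zy].
    have [|d _] := fd z; first by apply: inJ; rewrite !ltW.
    by apply: DeriveDef => //; rewrite derive1E.
  - apply: derivable_within_continuous => z; rewrite in_itv/= => xzy.
    by have [] := fd z (inJ z xzy).
  - rewrite in_itv/= => /andP[xc cy] E.
    rewrite distrC E normrM (distrC x y) ler_wpM2r//.
    by have [|_] := fd c; first by apply: inJ; rewrite !ltW.
move=> x y xJ yJ; have [xy|xy|->] := ltgtP x y; first exact: lt.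
  by rewrite distrC [`|x - y|]distrC; exact: lt.
by rewrite !subrr normr0 mulr0.
Qed.

Lemma cos_lip (x y : R) : `|cos x - cos y| <= `|x - y|.
Proof.
rewrite -[leRHS]mul1r; have [m [xm ym]] : exists m, - m <= x <= m /\ - m <= y <= m.
  exists (`|x| + `|y|); rewrite -!ler_norml; split; first by rewrite lerDl.
  by rewrite lerDr.
apply: (@MVT_lip cos (- m) m 1) => // z _; split; first exact: ex_derive.
by rewrite derive1E derive_val normrN sin_max.
Qed.

Lemma sin_lip (x y : R) : `|sin x - sin y| <= `|x - y|.
Proof.
by rewrite -!cosBpihalf (le_trans (cos_lip _ _))// opprB addrA subrK.
Qed.

Lemma laplace_lip (e x y : R) : 0 <= e -> `|laplace e x - laplace e y| <= e * `|x - y|.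
Proof.
move=> e0; have lt a b : `|b| <= `|a| -> `|laplace e a - laplace e b| <= e * `|a - b|.
  move=> ba; have H : laplace e a <= laplace e b.
    by rewrite ler_expR lerN2 ler_wpM2l.
  rewrite ler0_norm ?subr_le0// opprB.
  apply: (@le_trans _ _ (e * (`|a| - `|b|))); last first.
    by rewrite ler_wpM2l// lerB_dist.
  have E : laplace e a = laplace e b * expR (- (e * (`|a| - `|b|))).
    by rewrite /laplace -expRD; congr expR; ring.
  rewrite E; set z := e * _; have z0 : 0 <= z by rewrite mulr_ge0// subr_ge0.
  have := expR_ge1Dx (- z); have := laplace_le1 b e0; have := laplace_ge0 e b; nra.
have [|/ltW] := leP `|y| `|x|; first exact: lt.
by move=> /lt; rewrite distrC [`|y - x|]distrC.
Qed.

Definition lip_on l r U0 U1 u := (forall x, l <= x <= r -> `|u x| <= U0) /\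
  (forall x y, l <= x <= r -> l <= y <= r -> `|u x - u y| <= U1 * `|x - y|).

Lemma lip_onM l r U0 U1 V0 V1 u v : 0 <= U0 -> 0 <= V0 -> lip_on l r U0 U1 u -> lip_on l r V0 V1 v ->
  lip_on l r (U0 * V0) (U1 * V0 + U0 * V1) (fun x => u x * v x).
Proof.
move=> U00 V00 [ub ul] [vb vl]; split=> [x xJ|x y xJ yJ]; first by rewrite normrM ler_pM ?ub ?vb.
have -> : u x * v x - u y * v y = (u x - u y) * v x + u y * (v x - v y) by ring.
apply: (le_trans (ler_normD _ _)); rewrite [leRHS]mulrDl !normrM; apply: lerD.
  by rewrite mulrAC ler_pM ?vb ?ul.
by rewrite -mulrA ler_pM ?ub ?vl.
Qed.

End lip_on.

Section bump.
Context (R : realType).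
Local Notation mu := (@lebesgue_measure R).
Variables (l wd h : R).
Hypotheses (wd0 : 0 < wd) (h0 : 0 <= h).

(** The tent of height h over [l, l + wd]. Piecewise linearity is enough, since smoothness is
    measured by Lipschitz constants only. *)
Definition bump (x : R) := h * Num.max 0 (1 - `|x - (l + wd / 2)| * (2 / wd)).

Let k0 : 0 < 2 / wd. Proof. by rewrite divr_gt0. Qed.

Lemma bump_ge0 x : 0 <= bump x.
Proof. by rewrite mulr_ge0// le_max lexx. Qed.

Lemma bump_le x : bump x <= h.
Proof.
rewrite -[leRHS]mulr1 ler_wpM2l// ge_max ler01/= gerBl.
by rewrite mulr_ge0// ltW.
Qed.

Lemma bump_supp x : x < l \/ l + wd < x -> bump x = 0.
Proof.
move=> H; rewrite /bump max_l ?mulr0// subr_le0 mulrA ler_pdivlMr// mul1r.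
have [H1 H2] := ler_normlP _ _ (lexx `|x - (l + wd / 2)|); case: H => H; lra.
Qed.

Lemma bump_lip : lip (2 / wd * h) bump.
Proof.
move=> x y; rewrite /bump -mulrBr normrM ger0_norm//.
rewrite (mulrC (2 / wd)) -mulrA ler_wpM2l//.
set a := _ * _; set b := _ * _.
have maxl : `|Num.max 0 (1 - a) - Num.max 0 (1 - b)| <= `|a - b|.
  have [] := ler_normlP _ _ (lexx `|a - b|) => H1 H2.
  apply/ler_normlP; case: (leP 0 (1 - a)) => ?; case: (leP 0 (1 - b)) => ?; split; lra.
apply: (le_trans maxl).
rewrite /a /b -mulrBl normrM [X in _ * X]gtr0_norm// mulrC ler_wpM2l ?(ltW k0)//.
by rewrite (le_trans (ler_dist_dist _ _))// opprB addrA subrK.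
Qed.

Lemma Rintegrable_bump : Rintegrable mu bump.
Proof.
apply: (Rintegrable_supported (M := h) (lip_measurable bump_lip) _ bump_supp).
by move=> x; rewrite ger0_norm ?bump_ge0 ?bump_le.
Qed.

(** The tent is at least h / 2 on the middle half of its support. *)
Lemma Rintegral_bump_ge : h * wd / 4 <= \int[mu]_x bump x.
Proof.
pose J := `[l + wd / 4, l + 3 * wd / 4]%classic.
have iJ : Rintegrable mu (\1_J : R -> R) by exact: integrable_indic_itv.
have E : \int[mu]_x (h / 2 * \1_J x) = h * wd / 4.
  rewrite (RintegralZl _ measurableT iJ).
  have -> : \int[mu]_x \1_J x = wd / 2.
    apply: RintegralE_eq; transitivity (mu (J `&` setT)); first by apply: integral_indic => //; exact: measurable_itv.
    rewrite setIT /J lebesgue_measure_itv/= lte_fin.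
    have -> : l + wd / 4 < l + 3 * wd / 4 by rewrite ltrD2l ltr_pM2r ?invr_gt0// ltr_pMl// ltr1n.
    by rewrite -EFinD; congr EFin; field.
  by field.
rewrite -E; apply: le_Rintegral => //; [exact: RintegrableZ|exact: Rintegrable_bump|].
move=> x _; rewrite indicE; case: (boolP (x \in J)) => xJ; last by rewrite mulr0 bump_ge0.
move: xJ; rewrite mem_setE in_itv/= mulr1 => /andP[x1 x2].
rewrite /bump ler_wpM2l// le_max; apply/orP; right.
suff : `|x - (l + wd / 2)| * (2 / wd) <= 2^-1 by lra.
rewrite mulrA ler_pdivrMr// -ler_pdivlMr//; apply/ler_normlP; split; lra.
Qed.

End bump.

(** * Two densities in the Sobolev ball that differ on a window of frequencies *)

Section two_densities.
Context (R : realType).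
Local Notation mu := (@lebesgue_measure R).
Local Notation RM := (measurableTypeR R).
Variables (s B : R) (phi g : R -> R) (phis : R -> R[i]) (M : R).
Hypotheses (s0 : 0 <= s) (B0 : 0 < B).
Hypotheses (mphi : measurable_fun setT phi) (phiM : bounded_by M phi).
Hypotheses (hphis : is_fourier phi phis) (pg : is_pdf g).
Hypothesis hparseval : forall f, sobolev_pdf s B f -> parseval phi phis f.

Let sg := 1 + 4 * (s + 1) `^ (2 * s) / B ^+ 2.

Let sg0 : 0 < sg.
Proof. by rewrite ltr_wpDr// divr_ge0 ?sqr_ge0// mulr_ge0 ?powR_ge0. Qed.

Lemma parseval_Re f : Rintegrable mu f -> sobolev_pdf s B f ->
  Rintegrable mu (fun w => osc 0 f w * complex.Re (phis (- w)) - osc (pi / 2) f w * complex.Im (phis (- w))) /\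
  \int[mu]_x (phi x * f x) = (2 * pi)^-1 *
    \int[mu]_w (osc 0 f w * complex.Re (phis (- w)) - osc (pi / 2) f w * complex.Im (phis (- w))).
Proof.
move=> iff_ /hparseval[iP EP].
have ReE w : complex.Re (fourier f w * phis (- w))%C =
    osc 0 f w * complex.Re (phis (- w)) - osc (pi / 2) f w * complex.Im (phis (- w)).
  by rewrite fourierE; case: (phis (- w)).
have mRe : measurable_fun setT (fun w : R => complex.Re (phis (- w))).
  apply: (measurable_opp (f := fun w => complex.Re (phis w))).
  exact: (measurable_Re_symbol mphi phiM hphis).
have mIm : measurable_fun setT (fun w : R => complex.Im (phis (- w))).
  apply: (measurable_opp (f := fun w => complex.Im (phis w))).
  exact: (measurable_Im_symbol mphi phiM hphis).
split.
  apply: (le_Rintegrable _ _ iP) => [|w].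
    by apply: measurable_funB; apply: measurable_funM => //; exact: measurable_osc.
  by rewrite -ReE; exact: Re_le_cmod.
have := congr1 (@complex.Re R) EP.
rewrite /= mul0r subr0 => ->; congr (_ * _).
by apply: eq_Rintegral => w _; exact: ReE.
Qed.

Section perturbed.
Variables (l wd h e : R) (rho : R -> R) (rM La ga pmin : R).
Hypotheses (l0 : 0 < l) (wd0 : 0 < wd) (h0 : 0 <= h) (e01 : 0 < e <= 1).
Hypotheses (rM0 : 0 <= rM) (La0 : 0 <= La) (ga0 : 0 <= ga) (pm0 : 0 <= pmin).
Hypothesis rhod : forall x, l <= x <= l + wd ->
  derivable rho x 1 /\ `|rho^`()%classic x| <= rM.
Hypothesis phisE : forall x, l <= x <= l + wd ->
  phis x = ((cmod (phis x))%:C * expi (rho x))%C.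
Hypothesis gsb : forall psi x, psi \in [:: 0; pi / 2] -> l <= x <= l + wd ->
  [/\ `|osc psi g x| <= ga, derivable (osc psi g) x 1 & `|(osc psi g)^`()%classic x| <= La * ga].
Hypothesis phis_low : forall x, l <= x <= l + wd -> pmin <= cmod (phis x).

Let lr : l <= l + wd. Proof. by rewrite lerDl ltW. Qed.
Let e0 : 0 < e. Proof. by case/andP: e01. Qed.
Let e1 : e <= 1. Proof. by case/andP: e01. Qed.

Let A := bump l wd h.
Let G1 x := A x * cos (rho x).
Let G2 x := A x * sin (rho x).

Let Ab x : `|A x| <= h. Proof. by rewrite ger0_norm ?bump_ge0 ?bump_le. Qed.

Let lip_cos : lip_on l (l + wd) 1 rM (fun x => cos (rho x)).
Proof.
split=> [x _|x y xJ yJ]; first exact: cos_max.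
by rewrite (le_trans (cos_lip _ _))//; exact: (MVT_lip rhod).
Qed.

Let lip_sin : lip_on l (l + wd) 1 rM (fun x => sin (rho x)).
Proof.
split=> [x _|x y xJ yJ]; first exact: sin_max.
by rewrite (le_trans (sin_lip _ _))//; exact: (MVT_lip rhod).
Qed.

Let lip_bump_mul f F0 F1 : 0 <= F0 -> 0 <= F1 -> lip_on l (l + wd) F0 F1 f ->
  (forall x, `|A x * f x| <= h * F0) /\
  lip (2 / wd * h * F0 + h * F1) (fun x => A x * f x).
Proof.
move=> F00 F10 [fb fl]; split.
  move=> x; rewrite normrM; case: (boolP (l <= x <= l + wd)) => xJ; first by rewrite ler_pM ?fb.
  rewrite /A bump_supp ?normr0 ?mul0r ?mulr_ge0//.
  by move: xJ; rewrite negb_and -!ltNge => /orP.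
apply: (lip_mul h0 _ F00 F10 Ab (bump_lip l wd0 h0) _ fb fl).
  by rewrite mulr_ge0// divr_ge0// ltW.
by move=> x; exact: bump_supp.
Qed.

Let a1 := h * (2 / wd + rM).
Let b1 := h * ga * (2 / wd + rM + 1 + La).

Let k0 : 0 <= 2 / wd. Proof. by rewrite divr_ge0// ltW. Qed.

Let GP : [/\ forall x, `|G1 x| <= h, forall x, `|G2 x| <= h, lip a1 G1 & lip a1 G2].
Proof.
have [b1' l1] := lip_bump_mul ler01 rM0 lip_cos.
have [b2' l2] := lip_bump_mul ler01 rM0 lip_sin.
rewrite mulr1 in b1' b2'.
have E : 2 / wd * h * 1 + h * rM = a1 by rewrite /a1; ring.
by rewrite E in l1 l2.
Qed.

Let G1b x : `|G1 x| <= h. Proof. by case: GP. Qed.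
Let G2b x : `|G2 x| <= h. Proof. by case: GP. Qed.
Let G1l : lip a1 G1. Proof. by case: GP. Qed.
Let G2l : lip a1 G2. Proof. by case: GP. Qed.
Let G1s x : x < l \/ l + wd < x -> G1 x = 0.
Proof. by move=> H; rewrite /G1 /A bump_supp// mul0r. Qed.
Let G2s x : x < l \/ l + wd < x -> G2 x = 0.
Proof. by move=> H; rewrite /G2 /A bump_supp// mul0r. Qed.

Let k := pert G1 G2.
Let X0 := 8 / pi * ((h ^+ 2 + a1 ^+ 2) * wd).
Let wk : weighted k X0.
Proof.
have := weighted_pert lr G1b G2b G1l G2l G1s G2s.
by rewrite (addrC l) addrK.
Qed.

Let ik : Rintegrable mu k. Proof. exact: (Rintegrable_pert lr G1b G2b G1l G2l G1s G2s). Qed.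
Let intk : \int[mu]_x k x = 0.
Proof. exact: (Rintegral_pert l0 lr G1b G2b G1l G2l G1s G2s). Qed.

(** This bound forces the integral of |k| below 1/2, so that the fixed Cauchy component keeps at
    least half of the mass. The next one is the condition of [sobolev_mixture] after t^2 <= 4 k^2
    and the bound [X0] on the integral of k^2: 16 pi * 4 * 8 / pi = 512. *)
Hypothesis small1 : 64 * ((h ^+ 2 + a1 ^+ 2) * wd) <= 3 / 8.
Hypothesis small2 : 512 * ((s + 1) / e) `^ (2 * s) * ((h ^+ 2 + a1 ^+ 2) * wd) <= B ^+ 2.

Let t0 x := `|k x|.
Let t1 x := `|k x| + k x.
Let f0 := mixture sg e t0.
Let f1 := mixture sg e t1.

Let it0 : Rintegrable mu t0. Proof. exact: Rintegrable_abs. Qed.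
Let it1 : Rintegrable mu t1. Proof. exact: RintegrableD. Qed.
Let t00 x : 0 <= t0 x. Proof. exact: normr_ge0. Qed.
Let t10 x : 0 <= t1 x.
Proof. by rewrite /t1 -lerBlDr sub0r -normrN ler_norm. Qed.
Let int_t1 : \int[mu]_x t1 x = \int[mu]_x t0 x.
Proof. by rewrite (RintegralD measurableT it0 ik) intk addr0. Qed.
Let int_t0 : \int[mu]_x t0 x <= 2^-1.
Proof.
have [mk Hk] := wk; have [_ _ _ _ H] := Rintegrable_weight mk Hk.
have p0 := pi_gt0 R.
(* With this parameter the two terms of the L^1 bound are at most 3/8 and 1/8. *)
have := H (8 * pi); rewrite mulr_gt0// => /(_ isT)/le_trans; apply.
have E : 8 * pi * X0 = 64 * ((h ^+ 2 + a1 ^+ 2) * wd).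
  by rewrite /X0; move: p0; move: (pi : R) => p p0; field; exact: lt0r_neq0.
rewrite E (_ : pi / (8 * pi) = 8^-1); first by move: small1; set q := 64 * _; lra.
by rewrite invfM mulrCA mulfV ?mulr1// gt_eqF.
Qed.

Let ik2 : Rintegrable mu (fun x => k x ^+ 2) /\ \int[mu]_x k x ^+ 2 <= X0.
Proof. by have [mk Hk] := wk; have [_ ? _ ? _] := Rintegrable_weight mk Hk. Qed.

(** [t0] and [t1] lie between 0 and 2 |k| and have the same integral, so one argument puts both
    mixtures in the ball. *)
Let sob t : Rintegrable mu t -> (forall x, 0 <= t x) -> \int[mu]_x t x = \int[mu]_x t0 x ->
  (forall x, t x <= 2 * `|k x|) -> sobolev_pdf s B (mixture sg e t).
Proof.
move=> it tge tint tle; have [ik2' k2X] := ik2.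
have t2 x : t x ^+ 2 <= 4 * k x ^+ 2.
  by rewrite -(real_normK (num_real (k x))); have := tle x; have := tge x; nra.
have i4 := RintegrableZ 4 ik2'.
have mt := Rintegrable_measurable it.
have it2 : Rintegrable mu (fun x => t x ^+ 2).
  apply: (le_Rintegrable _ _ i4); first exact: measurable_funX.
  by move=> x; rewrite ger0_norm ?sqr_ge0.
apply: sobolev_mixture => //; first by rewrite tint (le_trans int_t0)// invf_le1// ler1n.
apply: le_trans small2.
have H : \int[mu]_x t x ^+ 2 <= 4 * X0.
  apply: (@le_trans _ _ (4 * \int[mu]_x k x ^+ 2)); last by rewrite ler_pM2l.
  by rewrite -(RintegralZl 4 measurableT ik2'); apply: le_Rintegral.
have p0 := pi_gt0 R; set Ce := _ `^ _.
have Ce0 : 0 <= Ce by exact: powR_ge0.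
apply: (@le_trans _ _ (16 * pi * Ce * (4 * X0))).
  by rewrite ler_wpM2l// mulr_ge0// mulr_ge0// ltW.
rewrite le_eqVlt; apply/orP; left; apply/eqP.
rewrite /X0; move: p0; move: (pi : R) => p p0; field; exact: lt0r_neq0.
Qed.

Let sob0 : sobolev_pdf s B f0.
Proof. by apply: sob => // x; rewrite /t0; have := normr_ge0 (k x); lra. Qed.
Let sob1 : sobolev_pdf s B f1.
Proof. by apply: sob => // x; rewrite /t1; have := ler_norm (k x); lra. Qed.

Let if0 : Rintegrable mu f0. Proof. exact: Rintegrable_mixture. Qed.
Let if1 : Rintegrable mu f1. Proof. exact: Rintegrable_mixture. Qed.

Let icy x : measurable_fun setT (fun y : R => cauchy_pdf e (x - y)).
Proof.
by apply: (measurableT_comp (Rintegrable_measurable (Rintegrable_cauchy_pdf e0))); exact: measurable_funB.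
Qed.

Let f1E x : f1 x = f0 x + conv k (cauchy_pdf e) x.
Proof.
rewrite /f1 /f0 /mixture int_t1 -addrA; congr (_ + _).
have i0 := RintegrableM it0 (icy x) (fun y => cauchy_pdf_le (x - y) e0).
have i1 := RintegrableM ik (icy x) (fun y => cauchy_pdf_le (x - y) e0).
by rewrite /conv -RintegralD//; apply: eq_Rintegral => y _; rewrite -mulrDl.
Qed.

Let f12 x : f1 x <= 2 * f0 x.
Proof.
rewrite /f1 /f0 /mixture int_t1 mulrDr; apply: lerD.
  by rewrite [leRHS]mulr_natl mulr2n lerDl mulr_ge0 ?subr_ge0 ?cauchy_pdf_ge0// (le_trans int_t0)// invf_le1// ler1n.
have i0 := RintegrableM it0 (icy x) (fun y => cauchy_pdf_le (x - y) e0).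
have i1 := RintegrableM it1 (icy x) (fun y => cauchy_pdf_le (x - y) e0).
rewrite /conv -RintegralZl//; apply: le_Rintegral => //; first exact: RintegrableZ.
move=> y _; rewrite mulrA ler_wpM2r ?cauchy_pdf_ge0// /t1 /t0.
by have := ler_norm (k y); lra.
Qed.


Let fb t : Rintegrable mu t -> exists K, bounded_by K (mixture sg e t).
Proof.
move=> it; exists (`|1 - \int[mu]_y t y| * (pi * sg)^-1 + (pi * e)^-1 * \int[mu]_y `|t y|) => x.
rewrite (le_trans (ler_normD _ _))// normrM; apply: lerD.
  by rewrite ler_wpM2l// cauchy_pdf_le.
apply: (conv_bound x it (Rintegrable_cauchy_pdf e0)) => y; exact: cauchy_pdf_le.
Qed.

Let b0 := h * ga.
Let X := 32 / pi * ((b0 ^+ 2 + b1 ^+ 2) * wd).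

Let lip_trig_g psi c : psi \in [:: 0; pi / 2] -> lip_on l (l + wd) 1 rM c ->
  (forall x, `|A x * (c x * (laplace e x * osc psi g x))| <= b0) /\
  lip b1 (fun x => A x * (c x * (laplace e x * osc psi g x))).
Proof.
move=> hp cl; have gp x := gsb (x := x) hp.
have L1 : lip_on l (l + wd) 1 1 (laplace e).
  split=> [x _|x y _ _]; first by rewrite ger0_norm ?laplace_ge0// laplace_le1// ltW.
  by rewrite (le_trans (laplace_lip _ _ (ltW e0)))// ler_wpM2r.
have L2 : lip_on l (l + wd) ga (La * ga) (osc psi g).
  split=> [x /gp[]//|]; apply: MVT_lip => x /gp[_ ? ?]; by split.
have L3 := lip_onM ler01 ga0 L1 L2; rewrite mul1r in L3.
have L4 := lip_onM ler01 ga0 cl L3; rewrite mul1r in L4.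
have [] := lip_bump_mul ga0 _ L4.
  by rewrite !addr_ge0// ?mulr_ge0// ?addr_ge0// ?mulr_ge0.
move=> Hb Hl; split => //.
suff <- : 2 / wd * h * ga + h * (rM * ga + 1 * (ga + 1 * (La * ga))) = b1 by [].
by rewrite /b1; move: (2 / wd) => q; ring.
Qed.

Let wX : weighted (fun y => conv g f1 y - conv g f0 y) X.
Proof.
have ig := pdf_Rintegrable pg.
have [K0 K0b] := fb it0; have [K1 K1b] := fb it1.
have -> : (fun y => conv g f1 y - conv g f0 y) = conv g (conv k (cauchy_pdf e)).
  apply/funext => y.
  have ms (f : R -> R) : measurable_fun setT f -> measurable_fun setT (fun x : R => f (y - x)).
    by move=> mf; apply: (measurableT_comp mf); exact: measurable_funB.
  have i0 := RintegrableM ig (ms _ (Rintegrable_measurable if0)) (fun x => K0b (y - x)).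
  have i1 := RintegrableM ig (ms _ (Rintegrable_measurable if1)) (fun x => K1b (y - x)).
  rewrite /conv -RintegralB//; apply: eq_Rintegral => x _.
  by rewrite -mulrBr f1E addrC addKr.
have E (c : R -> R) psi : (fun x => A x * c x * (laplace e x * osc psi g x)) = (fun x => A x * (c x * (laplace e x * osc psi g x))).
  by apply/funext => x; rewrite -mulrA.
have := @weighted_conv_pert R G1 G2 l (l + wd) h a1 lr G1b G2b G1l G2l G1s G2s g e b0 b1 ig e0.
rewrite (addrC l) addrK; apply.
- move=> psi x hp; have [H1 _] := lip_trig_g hp lip_cos; have [H2 _] := lip_trig_g hp lip_sin.
  by split; rewrite /G1 /G2 -mulrA; [exact: H1|exact: H2].
- move=> psi hp; have [_ H1] := lip_trig_g hp lip_cos; have [_ H2] := lip_trig_g hp lip_sin.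
  by rewrite /G1 /G2 !E.
Qed.

(** In the difference of the two Parseval integrals the phases cancel by cos^2 + sin^2 = 1. What
    remains is [laplace e] times the bump times the modulus of [phis], on the window and on its
    reflection. Both parts are nonnegative, and the window alone gives the bound. *)
Lemma functional_gap : (2 * pi)^-1 * (expR (- (e * (l + wd))) * pmin * (h * wd / 4)) <=
  \int[mu]_x (phi x * f1 x) - \int[mu]_x (phi x * f0 x).
Proof.
have p0 := pi_gt0 R.
have [j0 ->] := parseval_Re if0 sob0; have [j1 ->] := parseval_Re if1 sob1.
rewrite -mulrBr ler_pM2l ?invr_gt0 ?mulr_gt0//.
rewrite -(RintegralB measurableT j1 j0).
set c := expR _ * pmin.
have ibump := Rintegrable_bump l wd0 h0.
have c0 : 0 <= c by rewrite mulr_ge0 ?expR_ge0.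
apply: (@le_trans _ _ (\int[mu]_x (c * A x))).
  by rewrite (RintegralZl c measurableT ibump) ler_wpM2l// Rintegral_bump_ge.
apply: (le_Rintegral measurableT (RintegrableZ c ibump) (RintegrableB j1 j0)) => w _; rewrite -/A.
have D psi : osc psi f1 w - osc psi f0 w = laplace e w * osc psi k w.
  have E : osc psi t1 w = osc psi t0 w + osc psi k w by exact: oscD.
  by rewrite !osc_mixture// int_t1 E; ring.
have S x : G1 x * complex.Re (phis x) + G2 x * complex.Im (phis x) = A x * cmod (phis x).
  case: (boolP (l <= x <= l + wd)) => xJ; last first.
    have A0 : A x = 0 by rewrite /A bump_supp//; move: xJ; rewrite negb_and -!ltNge => /orP.
    by rewrite /G1 /G2 A0 !mul0r addr0.
  rewrite [in complex.Re _](phisE xJ) [in complex.Im _](phisE xJ) /G1 /G2 /expi /=.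
  rewrite !mul0r subr0 addr0 -[RHS]mulr1 -(cos2Dsin2 (rho x)); ring.
have -> : osc 0 f1 w * complex.Re (phis (- w)) - osc (pi / 2) f1 w * complex.Im (phis (- w)) -
    (osc 0 f0 w * complex.Re (phis (- w)) - osc (pi / 2) f0 w * complex.Im (phis (- w))) =
    laplace e w * (A w * cmod (phis w) + A (- w) * cmod (phis (- w))).
  rewrite -!S.
  have alg (a b c' d p q : R) : a * p - b * q - (c' * p - d * q) = (a - c') * p - (b - d) * q by ring.
  rewrite alg !D /k (osc0_pert lr G1b G2b G1l G2l G1s G2s) (oscpi2_pert lr G1b G2b G1l G2l G1s G2s).
  by rewrite (Re_symbolN mphi phiM hphis) (Im_symbolN mphi phiM hphis); ring.
case: (boolP (l <= w <= l + wd)) => wJ; last first.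
  have A0 : A w = 0 by rewrite /A bump_supp//; move: wJ; rewrite negb_and -!ltNge => /orP.
  by rewrite A0 mulr0 mulr_ge0 ?laplace_ge0// mul0r add0r mulr_ge0 ?bump_ge0 ?cmod_ge0.
apply: (@le_trans _ _ (laplace e w * (A w * cmod (phis w)))); last first.
  by rewrite ler_wpM2l ?laplace_ge0// lerDl mulr_ge0 ?bump_ge0 ?cmod_ge0.
rewrite [leRHS]mulrCA [leLHS]mulrC ler_wpM2l ?bump_ge0// /c ler_pM ?expR_ge0 ?phis_low//.
have /andP[lw wr] := wJ.
rewrite ler_expR lerN2 ler_wpM2l ?(ltW e0)// ger0_norm//.
by rewrite (le_trans (ltW l0)).
Qed.

Lemma perturbation_risk c0 n (est : n.-tuple RM -> R) r : 0 < c0 ->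
  (forall y, c0 <= (1 + y ^+ 2) * conv g (cauchy_pdf sg) y) ->
  n%:R * (2 * X / c0) <= 1 -> (0 < n)%N -> measurable_fun setT est -> bounded_by M est ->
  (forall f (pf : is_pdf f), sobolev_pdf s B f ->
     sq_risk (@pair_sum R) (phi \o fst) est (pair_law pf pg) <= r) ->
  ((2 * pi)^-1 * (expR (- (e * (l + wd))) * pmin * (h * wd / 4))) ^+ 2 <=
  2 * r + 2 * (expR 1 * (2 * r + 2 * ((2 * M) ^+ 2 / n%:R))).
Proof.
move=> c00 cg nX n0 mest best H.
have p0 : is_pdf f0 by case: sob0.
have p1 : is_pdf f1 by case: sob1.
have pi0 := pi_gt0 R.
apply: (@le_trans _ _ ((\int[mu]_x (phi x * f1 x) - \int[mu]_x (phi x * f0 x)) ^+ 2)).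
  have g0 : 0 <= (2 * pi)^-1 * (expR (- (e * (l + wd))) * pmin * (h * wd / 4)).
    have wd0' := ltW wd0.
    by rewrite mulr_ge0 ?invr_ge0 ?mulr_ge0 ?expR_ge0// ?ltW// divr_ge0// mulr_ge0.
  by rewrite lerXn2r ?nnegrE ?functional_gap// (le_trans g0)// functional_gap.
(* As the integral of [t0] is at most 1/2, [f0] is at least half of the fixed Cauchy density; this
   accounts for the factor 2 in the condition on n. *)
have qc y : c0 / 2 <= (1 + y ^+ 2) * conv g f0 y.
  have dy : 0 <= 1 + y ^+ 2 by rewrite addr_ge0// sqr_ge0.
  have ig := pdf_Rintegrable pg; have [K0 K0b] := fb it0.
  have ms (f : R -> R) : measurable_fun setT f -> measurable_fun setT (fun x : R => f (y - x)).
    by move=> mf; apply: (measurableT_comp mf); exact: measurable_funB.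
  have i0 := RintegrableM ig (ms _ (Rintegrable_measurable if0)) (fun x => K0b (y - x)).
  have ic := Rintegrable_cauchy_pdf sg0.
  have i1 := RintegrableM ig (ms _ (Rintegrable_measurable ic)) (fun x => cauchy_pdf_le (y - x) sg0).
  have low : 2^-1 * conv g (cauchy_pdf sg) y <= conv g f0 y.
    rewrite /conv -(RintegralZl 2^-1 measurableT i1); apply: le_Rintegral => //; first exact: RintegrableZ.
    move=> x _; rewrite mulrCA ler_wpM2l ?pdf_ge0// /f0 /mixture -[leLHS]addr0 lerD//.
      by rewrite ler_wpM2r ?cauchy_pdf_ge0// lerBrDl; move: int_t0; lra.
    by apply: Rintegral_ge0 => z _; rewrite mulr_ge0 ?cauchy_pdf_ge0.
  by have := cg y; have := ler_wpM2l dy low; lra.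
have c20 : 0 < c0 / 2 by rewrite divr_gt0.
have nX' : n%:R * (X / (c0 / 2)) <= 1.
  by rewrite (_ : X / (c0 / 2) = 2 * X / c0)//; field; rewrite gt_eqF.
have T := two_point_risk mphi phiM (fb it0) (fb it1) c20 qc f12 wX n0 mest best nX'.
exact: (T pg p0 p1 r (H _ p0 sob0) (H _ p1 sob1)).
Qed.

End perturbed.
End two_densities.

(** * The bound at frequency m *)

Section powR_facts.
Context (R : realType).
Implicit Types (m p q x : R).

Lemma powRDp m p q : 0 < m -> m `^ (p + q) = m `^ p * m `^ q.
Proof. by move=> m0; rewrite powRD// (gt_eqF m0) implybT. Qed.

Lemma powR_sqr m p : (m `^ p) ^+ 2 = m `^ (2 * p).
Proof. by rewrite -powR_mulrn ?powR_ge0// -powRrM mulrC. Qed.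

Lemma expR_sqr x : expR x ^+ 2 = expR (2 * x).
Proof. by rewrite expr2 -expRD; congr expR; ring. Qed.

Lemma powRN1_ge x y p : 0 < x -> x <= y -> 0 <= p -> y `^ (- p) <= x `^ (- p).
Proof.
move=> x0 xy p0; rewrite !powRN lef_pV2 ?posrE ?powR_gt0//; last exact: lt_le_trans xy.
by apply: ge0_ler_powR => //; rewrite nnegrE ltW// (lt_le_trans x0).
Qed.

Lemma expR_le_affine x b : 0 <= x <= b -> expR x <= 1 + x * expR b.
Proof.
move=> /andP[x0 xb]; have := expR_ge1Dx (- x).
have E : expR x * expR (- x) = 1 by rewrite -expRD subrr expR0.
have H : expR x <= expR b by rewrite ler_expR.
have := expR_gt0 x; nra.
Qed.

(** The reason for the width m^(1 - b): over such a window |w|^b varies by a bounded amount, so the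
    lower bound on [phis] loses only a constant factor. *)
Lemma powR_window m b : 1 <= m -> 0 <= b ->
  (m + m `^ (1 - b)) `^ b <= m `^ b + b * expR b.
Proof.
move=> m1 b0; have m0 : 0 < m by rewrite (lt_le_trans ltr01).
pose q := m `^ (- b); have q0 : 0 <= q by exact: powR_ge0.
have q1 : q <= 1 by rewrite -[leRHS](powRr0 m) ler_powR// oppr_le0.
have mq : m `^ b * q = 1 by rewrite -powRDp// subrr powRr0.
have E : m + m `^ (1 - b) = m * (1 + q).
  by rewrite powRDp// powRr1 ?(ltW m0)// mulrDr mulr1.
rewrite E powRM ?(ltW m0) ?addr_ge0//.
have H : (1 + q) `^ b <= expR (b * q).
  rewrite mulrC expRM; apply: ge0_ler_powR; rewrite ?nnegrE ?addr_ge0 ?expR_ge0//.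
  exact: expR_ge1Dx.
have H2 : expR (b * q) <= 1 + b * q * expR b.
  by apply: expR_le_affine; rewrite mulr_ge0//= ler_piMr.
have mb0 : 0 <= m `^ b by exact: powR_ge0.
have := ler_wpM2l mb0 (le_trans H H2).
rewrite mulrDr mulr1 (_ : m `^ b * (b * q * expR b) = m `^ b * q * (b * expR b)); last by ring.
by rewrite mq mul1r.
Qed.

End powR_facts.

Section lower_bound.
Context (R : realType).
Local Notation mu := (@lebesgue_measure R).
Local Notation RM := (measurableTypeR R).
Variables (s B : R) (phi g : R -> R) (phis : R -> R[i]).
Variables (Cg2 Cphi1 Cg alpha beta gamma a b d tau w0 : R).
Hypotheses (hs : 0 <= s) (hB : 0 < B) (hphi : measurable_fun setT phi).
Hypothesis hphib : exists M : R, forall x, `|phi x| <= M.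
Hypothesis hphis : is_fourier phi phis.
Hypothesis hparseval : forall f, sobolev_pdf s B f -> parseval phi phis f.
Hypothesis hg : is_pdf g.
Hypothesis hgb : exists M : R, forall x, g x <= M.
Hypotheses (hCg2 : 0 < Cg2) (hCphi1 : 0 < Cphi1).
Hypotheses (halpha : 0 <= alpha) (hbeta : 0 <= beta) (hgamma : 0 <= gamma).
Hypotheses (ha : 0 <= a) (hb : 0 <= b) (hd : 0 <= d).
Hypothesis hgs : forall w, cmod (fourier g w) <=
  Cg2 * (w ^+ 2 + 1) `^ (- (alpha / 2)) * expR (- gamma * `|w| `^ beta).
Hypothesis hphilow : forall w,
  Cphi1 * (w ^+ 2 + 1) `^ (- (a / 2)) * expR (- d * `|w| `^ b) <= cmod (phis w).
Hypothesis hgs' : forall w, cderivable (fourier g) w.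
Hypotheses (hCg : 0 < Cg) (htau : 0 <= tau).
Hypothesis hgs0 : forall w, fourier g w != 0.
Hypothesis hgratio : forall w,
  cmod (cderive (fourier g) w) / cmod (fourier g w) <= Cg * (1 + `|w|) `^ tau.
Hypothesis hw0 : 0 < w0.
Hypothesis harg : exists (rho : R -> R) (M : R), bounded_C2_arg phis w0 rho M.

Let sg := 1 + 4 * (s + 1) `^ (2 * s) / B ^+ 2.

Let sg0 : 0 < sg.
Proof. by rewrite ltr_wpDr// divr_ge0 ?sqr_ge0// mulr_ge0 ?powR_ge0. Qed.

Lemma cmod_gs_le m x : 0 < m -> m <= x ->
  cmod (fourier g x) <= Cg2 * (m `^ (- alpha) * expR (- gamma * m `^ beta)).
Proof.
move=> m0 mx; have x0 := lt_le_trans m0 mx.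
apply: (le_trans (hgs x)); rewrite -mulrA; apply: (ler_wpM2l (ltW hCg2)).
apply: ler_pM; [exact: powR_ge0|exact: expR_ge0| |].
  rewrite (_ : - alpha = 2 * - (alpha / 2)); last by field.
  rewrite powRrM -[2]/(2%:R) powR_mulrn ?(ltW m0)//; apply: powRN1_ge.
  - by rewrite exprn_gt0.
  - by rewrite (le_trans (_ : _ <= x ^+ 2)) ?lerDl// lerXn2r ?nnegrE// ltW.
  - by rewrite divr_ge0.
rewrite ler_expR !mulNr lerN2 ler_wpM2l// gtr0_norm//.
by apply: ge0_ler_powR; rewrite ?nnegrE// ltW.
Qed.

Lemma gs_derivative psi x : psi \in [:: 0; pi / 2] ->
  [/\ `|osc psi g x| <= cmod (fourier g x), derivable (osc psi g) x 1 &
      `|(osc psi g)^`()%classic x| <= Cg * (1 + `|x|) `^ tau * cmod (fourier g x)].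
Proof.
have E0 : (complex.Re (R:=R)) \o fourier g = osc 0 g by apply/funext => w; exact: Re_fourier.
have E1 : (complex.Im (R:=R)) \o fourier g = osc (pi / 2) g by apply/funext => w; exact: Im_fourier.
have [] := hgs' x; rewrite E0 E1 => d0 d1.
have c0 : 0 < cmod (fourier g x).
  rewrite lt_neqAle cmod_ge0 andbT eq_sym; apply/eqP => H.
  by have /eqP := hgs0 x; apply; exact: ComplexField.Normc.eq0_normc.
have H := hgratio x; rewrite (ler_pdivrMr _ _ c0) in H.
have gi := Im_le_cmod (fourier g x); have gr := Re_le_cmod (fourier g x).
rewrite Re_fourier in gr; rewrite Im_fourier in gi.
have di := Im_le_cmod (cderive (fourier g) x); have dr := Re_le_cmod (cderive (fourier g) x).
have HR : complex.Re (cderive (fourier g) x) = (osc 0 g)^`()%classic x by rewrite /cderive E0.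
have HI : complex.Im (cderive (fourier g) x) = (osc (pi / 2) g)^`()%classic x by rewrite /cderive E1.
rewrite !inE => /orP[]/eqP ->.
  by split; [exact: gr|exact: d0|rewrite -HR; exact: le_trans dr H].
by split; [exact: gi|exact: d1|rewrite -HI; exact: le_trans di H].
Qed.

(** Growth in m of the Lipschitz constant of the observed spectra relative to their size: m^(b - 1)
    is the slope of the bump and m^tau the logarithmic derivative of the transform of [g]. Bounded
    contributions are covered because tau >= 0. *)
Definition kappa := Num.max tau (b - 1).
(** The power of m in the chi-square distance: 2 kappa from the squared Lipschitz constant, -(2 s +
    7 b) from the squared height of the bump times its width, -2 alpha from the squared transform of
    [g]. *)
Definition loss_exponent := 2 * kappa - (2 * s + 7 * b) - 2 * alpha.

(** [perturbation_risk] with window [m, m + m^(1 - b)] and smoothing scale 1/m. The constants are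
    fixed before n and m, so that m may later depend on n. *)
Lemma risk_frequency_arg D : 0 < D -> exists2 C, 0 < C & exists2 m0, 1 <= m0 &
  forall M n m (est : n.-tuple RM -> R) r, bounded_by M phi -> (0 < n)%N -> m0 <= m ->
    n%:R * (m `^ loss_exponent * expR (- 2 * gamma * m `^ beta)) <= D ->
    measurable_fun setT est -> bounded_by M est ->
    (forall f (pf : is_pdf f), sobolev_pdf s B f ->
       sq_risk (@pair_sum R) (phi \o fst) est (pair_law pf hg) <= r) ->
    C * (m `^ (- U4 s a b) * expR (- 2 * d * m `^ b)) <=
    2 * r + 2 * (expR 1 * (2 * r + 2 * ((2 * M) ^+ 2 / n%:R))).
Proof.
move=> D0; have [rho [rM hrho]] := harg.
have [c0 c00 hc0] := conv_cauchy_lower hg sg0.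
have pi0 := pi_gt0 R.
have rM0 : 0 <= rM.
  have [|_ _ _ _ /(_ 0%N isT)] := hrho (w0 + 1); last exact: le_trans.
  by rewrite ger0_norm ?addr_ge0 ?(ltW hw0)// ltrDl.
have k0 : 0 <= kappa by rewrite /kappa le_max htau.
pose P1 := 1 + (2 + rM) ^+ 2.
pose P2 := 1 + (2 + rM + 1 + Cg * 3 `^ tau) ^+ 2.
have P10 : 0 < P1 by rewrite ltr_wpDr// sqr_ge0.
have P20 : 0 < P2 by rewrite ltr_wpDr// sqr_ge0.
pose S2 := (s + 1) `^ (2 * s).
have S20 : 0 < S2 by rewrite powR_gt0// ltr_wpDl.
(* Naming the numeral keeps it opaque in the algebra below. *)
have [N512 NE N0] : exists2 N : R, N = 512 & 0 < N by exists 512; rewrite ?ltr0n.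
(* The squared amplitude [et] is the smallest of three thresholds: [y1] for the mass of the
   perturbation, [y2] for the Sobolev ball, [y3] for the chi-square condition. *)
pose y1 := 3 / 8 / (64 * P1); pose y2 := B ^+ 2 / (N512 * S2 * P1).
pose y3 := c0 * pi / (64 * Cg2 ^+ 2 * P2 * D).
have y10 : 0 < y1 by rewrite !divr_gt0// mulr_gt0.
have y20 : 0 < y2 by apply: divr_gt0; [exact: exprn_gt0|rewrite mulr_gt0 ?mulr_gt0].
have y30 : 0 < y3 by rewrite !divr_gt0// ?mulr_gt0// exprn_gt0.
pose et := Num.min y1 (Num.min y2 y3).
have et0 : 0 < et by rewrite !lt_min y10 y20 y30.
have ety1 : et <= y1 by rewrite ge_min lexx.
have ety2 : et <= y2 by rewrite !ge_min lexx orbT.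
have ety3 : et <= y3 by rewrite !ge_min lexx !orbT.
pose pc := Cphi1 * 3 `^ (- a) * expR (- d * (b * expR b)).
have pc0 : 0 < pc by rewrite !mulr_gt0 ?powR_gt0 ?expR_gt0.
pose C := ((2 * pi)^-1 * (expR (-2) * pc / 4)) ^+ 2 * et.
have C0 : 0 < C by rewrite mulr_gt0// exprn_gt0// mulr_gt0 ?invr_gt0 ?divr_gt0 ?mulr_gt0 ?expR_gt0.
(* Above 1 powers of m are monotone in the exponent, and above [w0] the phase of [phis] is
   differentiable. *)
exists C => //; exists (Num.max 1 (w0 + 1)); first by rewrite le_max lexx.
move=> M n m est r phiM n0; rewrite ge_max => /andP[m1 mw0] HD mest best H.
have m0 : 0 < m := lt_le_trans ltr01 m1.
have mw : w0 < m by rewrite (lt_le_trans _ mw0)// ltrDl.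
pose wd := m `^ (1 - b).
have wd0 : 0 < wd by exact: powR_gt0.
have wdm : wd <= m by rewrite -[leRHS]powRr1 ?(ltW m0)// ler_powR// gerBl.
(* Chosen so that h^2 wd = et m^(-(2 s + 7 b)), the quantity through which all constraints are
   expressed; the gap contains h^2 wd^2, whose power of m is then the part of - U4 other than - 2
   a. *)
pose h := Num.sqrt et * m `^ (- (s + 7 / 2 * b + (1 - b) / 2)).
have h0 : 0 <= h by rewrite mulr_ge0 ?sqrtr_ge0 ?powR_ge0.
have h2wd : h ^+ 2 * wd = et * m `^ (- (2 * s + 7 * b)).
  rewrite /h /wd exprMn sqr_sqrtr ?(ltW et0)// powR_sqr -[LHS]mulrA -powRDp//.
  by congr (_ * _ `^ _); field.
pose La := Cg * 3 `^ tau * m `^ tau.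
pose ga := Cg2 * (m `^ (- alpha) * expR (- gamma * m `^ beta)).
pose pmin := pc * (m `^ (- a) * expR (- d * m `^ b)).
have La0 : 0 <= La by rewrite !mulr_ge0 ?powR_ge0// ltW.
have ga0 : 0 <= ga by rewrite !mulr_ge0 ?powR_ge0 ?expR_ge0// ltW.
have pm0 : 0 <= pmin by rewrite mulr_ge0 ?mulr_ge0 ?powR_ge0 ?expR_ge0// ltW.
have big x : m <= x <= m + wd -> w0 < `|x|.
  by move=> /andP[mx _]; rewrite gtr0_norm ?(lt_le_trans m0)// (lt_le_trans mw).
have e01 : 0 < m^-1 <= 1 by rewrite invr_gt0 m0 invf_le1.
have rhod x : m <= x <= m + wd -> derivable rho x 1 /\ `|rho^`()%classic x| <= rM.
  by move=> /big/hrho[_ ? _ _ /(_ 1%N isT)].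
have phisE x : m <= x <= m + wd -> phis x = ((cmod (phis x))%:C * expi (rho x))%C.
  by move=> /big/hrho[].
have gsb psi x : psi \in [:: 0; pi / 2] -> m <= x <= m + wd ->
  [/\ `|osc psi g x| <= ga, derivable (osc psi g) x 1 & `|(osc psi g)^`()%classic x| <= La * ga].
  move=> hp /andP[mx xm]; have [A1 A2 A3] := gs_derivative x hp; have gx := cmod_gs_le m0 mx.
  have x0 := lt_le_trans m0 mx.
  split => //; first exact: le_trans gx.
  apply: (le_trans A3); apply: ler_pM => //; [by rewrite mulr_ge0 ?powR_ge0// ltW|exact: cmod_ge0|].
  rewrite /La -mulrA ler_wpM2l ?(ltW hCg)// -powRM ?(ltW m0)//.
  apply: ge0_ler_powR; rewrite ?nnegrE ?addr_ge0 ?mulr_ge0 ?(ltW m0)//.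
  by rewrite gtr0_norm//; lra.
have phil x : m <= x <= m + wd -> pmin <= cmod (phis x).
  move=> /andP[mx xm]; have x0 := lt_le_trans m0 mx.
  apply: le_trans (hphilow x).
  have -> : pmin = Cphi1 * (3 `^ (- a) * m `^ (- a)) * (expR (- d * (b * expR b)) * expR (- d * m `^ b)).
    by rewrite /pmin /pc; ring.
  rewrite -!mulrA ler_wpM2l ?(ltW hCphi1)// mulrA; apply: ler_pM.
  - by rewrite mulr_ge0 ?powR_ge0.
  - by rewrite mulr_ge0 ?expR_ge0.
  - rewrite -powRM ?(ltW m0)// (_ : - a = 2 * - (a / 2)); last by field.
    rewrite powRrM -[2]/(2%:R) powR_mulrn ?mulr_ge0 ?(ltW m0)//; apply: powRN1_ge.
    + by rewrite ltr_wpDl// sqr_ge0.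
    + by nra.
    + by rewrite divr_ge0.
  - rewrite -expRD ler_expR -mulrDr !mulNr lerN2 ler_wpM2l// gtr0_norm//.
    rewrite addrC; apply: le_trans (powR_window m1 hb).
    by apply: ge0_ler_powR; rewrite ?nnegrE ?(ltW x0) ?addr_ge0 ?(ltW m0) ?(ltW wd0).
have iwd : wd^-1 = m `^ (b - 1) by rewrite /wd -powRN opprB.
have wb : 2 / wd + rM <= (2 + rM) * m `^ b.
  rewrite iwd [leRHS]mulrDl; apply: lerD; first by rewrite ler_wpM2l// ler_powR// gerDl.
  by rewrite ler_peMr// -[leLHS](powRr0 m) ler_powR.
have wb0 : 0 <= 2 / wd + rM by rewrite addr_ge0// divr_ge0// ltW.
(* The squared Lipschitz constant costs at most m^(2 b), which the factor m^(-7 b) more than pays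
   for. *)
have w1 : (h ^+ 2 + (h * (2 / wd + rM)) ^+ 2) * wd <= et * P1 * m `^ (- (2 * s)).
  have mb1 : 1 <= m `^ b by rewrite -[leLHS](powRr0 m) ler_powR.
  have -> : (h ^+ 2 + (h * (2 / wd + rM)) ^+ 2) * wd = h ^+ 2 * wd * (1 + (2 / wd + rM) ^+ 2) by ring.
  rewrite h2wd; apply: (@le_trans _ _ (et * m `^ (- (2 * s + 7 * b)) * (P1 * (m `^ b) ^+ 2))).
    rewrite ler_wpM2l ?mulr_ge0 ?powR_ge0 ?(ltW et0)// /P1 [leRHS]mulrDl mul1r; apply: lerD.
      by rewrite exprn_ege1.
    by rewrite -exprMn lerXn2r ?nnegrE ?(le_trans wb0 wb).
  rewrite powR_sqr [leLHS](_ : _ = et * P1 * (m `^ (- (2 * s + 7 * b)) * m `^ (2 * b))); last by ring.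
  rewrite -powRDp//; apply: ler_wpM2l; first exact: (mulr_ge0 (ltW et0) (ltW P10)).
  have alg (x y : R) : 0 <= y -> - (2 * x + 7 * y) + 2 * y <= - (2 * x) by move=> ?; lra.
  exact: (ler_powR m1 (alg _ _ hb)).
have m2s0 : 0 <= m `^ (- (2 * s)) by exact: powR_ge0.
have small1 : 64 * ((h ^+ 2 + (h * (2 / wd + rM)) ^+ 2) * wd) <= 3 / 8.
  have m2s1 : m `^ (- (2 * s)) <= 1 by rewrite -[leRHS](powRr0 m) ler_powR// oppr_le0 mulr_ge0.
  move: ety1; rewrite /y1 ler_pdivlMr ?mulr_gt0// => ety1'.
  have : et * P1 * m `^ (- (2 * s)) <= et * P1 by rewrite ler_piMr// (mulr_ge0 (ltW et0) (ltW P10)).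
  move=> H1; apply: le_trans (ler_wpM2l _ (le_trans w1 H1)) _ => //; by rewrite mulrCA.
have small2 : 512 * ((s + 1) / m^-1) `^ (2 * s) * ((h ^+ 2 + (h * (2 / wd + rM)) ^+ 2) * wd) <= B ^+ 2.
  rewrite -NE invrK powRM ?addr_ge0 ?(ltW m0)// -/S2.
  apply: (@le_trans _ _ (N512 * (S2 * m `^ (2 * s)) * (et * P1 * m `^ (- (2 * s))))).
    by rewrite ler_wpM2l// !mulr_ge0 ?powR_ge0// ltW.
  rewrite [leLHS](_ : _ = et * (N512 * S2 * P1) * (m `^ (2 * s) * m `^ (- (2 * s)))); last by ring.
  rewrite -powRDp// subrr powRr0 mulr1 -ler_pdivlMr// !mulr_gt0//.
have mk1 : 1 <= m `^ kappa by rewrite -[leLHS](powRr0 m) ler_powR.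
have W0 : 0 <= 2 / wd + rM + 1 + La by apply: addr_ge0 => //; exact: addr_ge0.
have wk : 2 / wd + rM + 1 + La <= (2 + rM + 1 + Cg * 3 `^ tau) * m `^ kappa.
  rewrite [leRHS](_ : _ = 2 * m `^ kappa + rM * m `^ kappa + m `^ kappa + Cg * 3 `^ tau * m `^ kappa); last by ring.
  apply: lerD; [apply: lerD => //; apply: lerD|].
  - by rewrite iwd ler_wpM2l// ler_powR// le_max lexx orbT.
  - by rewrite ler_peMr.
  - by rewrite ler_wpM2l ?mulr_ge0 ?powR_ge0 ?(ltW hCg)// ler_powR// le_max lexx.
have nX : n%:R * (2 * (32 / pi * (((h * ga) ^+ 2 + (h * ga * (2 / wd + rM + 1 + La)) ^+ 2) * wd)) / c0) <= 1.
  have -> : ((h * ga) ^+ 2 + (h * ga * (2 / wd + rM + 1 + La)) ^+ 2) * wd =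
    h ^+ 2 * wd * (ga ^+ 2 * (1 + (2 / wd + rM + 1 + La) ^+ 2)) by ring.
  rewrite h2wd.
  have L1 : 1 + (2 / wd + rM + 1 + La) ^+ 2 <= P2 * m `^ (2 * kappa).
    rewrite -powR_sqr /P2 [leRHS]mulrDl mul1r; apply: lerD; first exact: exprn_ege1.
    by rewrite -exprMn lerXn2r ?nnegrE ?(le_trans W0 wk).
  have g2 : ga ^+ 2 = Cg2 ^+ 2 * (m `^ (- (2 * alpha)) * expR (- 2 * gamma * m `^ beta)).
    rewrite /ga exprMn exprMn powR_sqr expR_sqr.
    by congr (_ * (_ `^ _ * expR _)); ring.
  have L2 : et * m `^ (- (2 * s + 7 * b)) * (ga ^+ 2 * (1 + (2 / wd + rM + 1 + La) ^+ 2)) <=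
      et * Cg2 ^+ 2 * P2 * (m `^ loss_exponent * expR (- 2 * gamma * m `^ beta)).
    apply: (@le_trans _ _ (et * m `^ (- (2 * s + 7 * b)) * (ga ^+ 2 * (P2 * m `^ (2 * kappa))))).
      apply: ler_wpM2l; first exact: (mulr_ge0 (ltW et0) (powR_ge0 _ _)).
      by apply: ler_wpM2l; [exact: sqr_ge0|exact: L1].
    rewrite g2 /loss_exponent (powRDp _ _ m0) (powRDp _ _ m0) le_eqVlt; apply/orP; left; apply/eqP; ring.
  set Q := m `^ loss_exponent * _ in HD L2.
  set T := et * m `^ _ * _ in L2 *.
  have nR : 0 <= n%:R :> R by [].
  have L3 := ler_wpM2l nR L2.
  have L4 : n%:R * (et * Cg2 ^+ 2 * P2 * Q) <= et * Cg2 ^+ 2 * P2 * D.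
    by rewrite mulrCA ler_wpM2l// !mulr_ge0 ?sqr_ge0// ltW.
  have L5 : et * (64 * Cg2 ^+ 2 * P2 * D) <= c0 * pi.
    by move: ety3; rewrite /y3 ler_pdivlMr// !mulr_gt0// exprn_gt0.
  have -> : n%:R * (2 * (32 / pi * T) / c0) = 64 * (n%:R * T) / (c0 * pi).
    by move: pi0; move: (pi : R) => p p0; field; rewrite !gt_eqF.
  by rewrite ler_pdivrMr ?mulr_gt0// mul1r; lra.
have := perturbation_risk hs hB hphi phiM hphis hparseval m0 wd0 h0 e01 rM0 La0 ga0 pm0
  rhod phisE gsb phil small1 small2 c00 hc0 nX n0 mest best H.
apply: le_trans.
have -> : C * (m `^ (- U4 s a b) * expR (- 2 * d * m `^ b)) =
   ((2 * pi)^-1 * (expR (-2) * pmin * (h * wd / 4))) ^+ 2.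
  have E1 : (h * wd) ^+ 2 = et * m `^ (- (2 * s + 7 * b) + (1 - b)).
    by rewrite exprMn (expr2 wd) mulrA h2wd -[LHS]mulrA /wd -powRDp.
  have E2 : pmin ^+ 2 = pc ^+ 2 * (m `^ (- (2 * a)) * expR (- 2 * d * m `^ b)).
    rewrite /pmin exprMn [X in _ * X]exprMn powR_sqr expR_sqr.
    by congr (_ * (_ `^ _ * expR _)); ring.
  have E3 : m `^ (- U4 s a b) = m `^ (- (2 * a)) * m `^ (- (2 * s + 7 * b) + (1 - b)).
    by rewrite -powRDp//; congr powR; rewrite /U4; ring.
  transitivity (((2 * pi)^-1 * (expR (-2) / 4)) ^+ 2 * pmin ^+ 2 * (h * wd) ^+ 2).
    rewrite E1 E2 E3 /C; move: (2 * pi)^-1 => ip; ring.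
  move: (2 * pi)^-1 => ip; ring.
have ip0 : 0 <= (2 * pi)^-1 :> R by rewrite invr_ge0; exact: mulr_ge0 (ler0n _ 2) (ltW pi0).
have hw : 0 <= h * wd / 4 by apply: divr_ge0 => //; exact: (mulr_ge0 h0 (ltW wd0)).
have le2 : expR (-2) <= expR (- (m^-1 * (m + wd))).
  rewrite ler_expR lerN2 ler_pdivrMl// mulrC mulr_natl mulr2n; exact: lerD.
have base := ler_wpM2l ip0 (ler_wpM2r hw (ler_wpM2r pm0 le2)).
have l0 : 0 <= (2 * pi)^-1 * (expR (-2) * pmin * (h * wd / 4)).
  by apply: mulr_ge0 ip0 (mulr_ge0 (mulr_ge0 (expR_ge0 _) pm0) hw).
by rewrite lerXn2r ?nnegrE ?(le_trans l0 base).
Qed.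

(** The mixture with t = 0. *)
Lemma sobolev_cauchy : sobolev_pdf s B (cauchy_pdf sg).
Proof.
have i0 : Rintegrable mu (fun=> 0 : R).
  have := @integrable0 _ RM R mu setT; exact.
have z0 : \int[mu]_x (0 : R) = 0 by apply: RintegralE_eq; rewrite integral0.
have -> : cauchy_pdf sg = mixture sg 1 (fun=> 0).
  apply/funext => x; rewrite /mixture z0 subr0 mul1r /conv -[LHS]addr0; congr (_ + _).
  by rewrite -[LHS]z0; apply: eq_Rintegral => y _; rewrite mul0r.
apply: sobolev_mixture => //; rewrite ?ltr01 ?lexx ?z0//.
  by under eq_fun do rewrite expr0n.
have -> : \int[mu]_x ((0 : R) ^+ 2) = 0.
  by rewrite -[RHS]z0; apply: eq_Rintegral => x _; rewrite expr0n.
by rewrite mulr0 sqr_ge0.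
Qed.

Lemma cauchy_risk M : bounded_by M phi -> exists2 C, 0 < C & forall n (est : n.-tuple RM -> R),
  (0 < n)%N -> measurable_fun setT est -> bounded_by M est ->
  C / n%:R <= sq_risk (@pair_sum R) (phi \o fst) est (pair_law (cauchy_pdf_is_pdf sg0) hg).
Proof.
move=> phiM; apply: (sq_risk_parametric hphi phiM hphis).
(* The lower bound on [phis] at frequency 0 excludes periodic functions. *)
- apply/eqP => E; have := hphilow 0; rewrite E.
  have -> : cmod (0 : R[i]) = 0 by rewrite cmodE/= expr0n addr0 sqrtr0.
  by apply/negP; rewrite -ltNge !mulr_gt0 ?expR_gt0 ?powR_gt0// expr0n add0r.
- by exists ((pi * sg)^-1) => x; exact: cauchy_pdf_le.
- move=> x; apply: mulr_gt0; first by rewrite invr_gt0 mulr_gt0// pi_gt0.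
  by apply: divr_gt0; [exact: mulr_gt0|exact: cauchy_kernel_denom].
- have [G gG] := hgb; exists G => x; rewrite ger0_norm ?gG//; exact: pdf_ge0.
Qed.

Lemma minimax_parametric : exists2 C, 0 < C & forall n, (0 < n)%N ->
  ((C / n%:R)%:E <= minimax_risk n (sobolev_pdf s B) phi g)%E.
Proof.
have [M phiM] := hphib; have [C C0 H] := cauchy_risk phiM.
exists C => // n n0; apply: (minimax_risk_ge (pg := hg) hphi phiM) => est mest best.
exists (cauchy_pdf sg); first exact: sobolev_cauchy.
by exists (cauchy_pdf_is_pdf sg0); exact: H.
Qed.

(* The 1/n term of the two-point bound is absorbed by the parametric bound. *)
Lemma minimax_frequency D : 0 < D -> exists2 C, 0 < C & exists2 m0, 1 <= m0 &
  forall n m, (0 < n)%N -> m0 <= m ->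
    n%:R * (m `^ loss_exponent * expR (- 2 * gamma * m `^ beta)) <= D ->
    ((C * (m `^ (- U4 s a b) * expR (- 2 * d * m `^ b)))%:E <=
      minimax_risk n (sobolev_pdf s B) phi g)%E.
Proof.
move=> D0; have [M phiM] := hphib; have [cp cp0 Hp] := cauchy_risk phiM.
have [c1 c10 [m0 m01 H1]] := risk_frequency_arg D0.
pose e1 : R := expR 1; have e10 : 0 < e1 by exact: expR_gt0.
(* With risk r = C T and 1/n <= C T / cp, the right side of the two-point bound is at most K C T.
   The choice C = c1 / (2 K) makes this half of the lower bound c1 T, a contradiction. *)
pose K := 2 + 4 * e1 + 16 * e1 * M ^+ 2 / cp.
have K0 : 0 < K.
  apply: ltr_wpDr; last by apply: addr_gt0 => //; exact: mulr_gt0.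
  by apply: divr_ge0 (ltW cp0); apply: mulr_ge0 (sqr_ge0 _); exact: mulr_ge0 (ler0n _ _) (ltW e10).
pose C := c1 / (2 * K).
have C0 : 0 < C by rewrite divr_gt0// mulr_gt0.
exists C => //; exists m0 => // n m n0 mm0 HD.
apply: (minimax_risk_ge (pg := hg) hphi phiM) => est mest best.
set T := m `^ _ * _.
have T0 : 0 < T by rewrite mulr_gt0 ?expR_gt0// powR_gt0// (lt_le_trans ltr01)// (le_trans m01).
(* If no density of the ball is bad for this estimator, its risk is below C T at all of them, in
   particular at both perturbed densities and at the Cauchy density. *)
apply: contrapT => Hn.
have low f (pf : is_pdf f) : sobolev_pdf s B f ->
    sq_risk (@pair_sum R) (phi \o fst) est (pair_law pf hg) <= C * T.
  move=> Ff; rewrite leNgt; apply/negP => lt; apply: Hn.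
  by exists f => //; exists pf; exact: ltW.
have := H1 M n m est (C * T) phiM n0 mm0 HD mest best low; rewrite -/T -/e1.
have := le_trans (Hp n est n0 mest best) (low _ (cauchy_pdf_is_pdf sg0) sobolev_cauchy).
set q := n%:R^-1 => Hq; have q0 : 0 <= q by rewrite invr_ge0.
have {}Hq : q <= C * T / cp by rewrite ler_pdivlMr// mulrC.
have E1 : C * T * K * 2 = c1 * T by rewrite /C; field; rewrite gt_eqF.
have E2 : C * T * K = 2 * (C * T) + 4 * e1 * (C * T) + 16 * e1 * M ^+ 2 * (C * T / cp).
  by rewrite /K; field; rewrite gt_eqF.
have M20 : 0 <= 16 * e1 * M ^+ 2.
  by apply: mulr_ge0 (sqr_ge0 _); exact: mulr_ge0 (ler0n _ _) (ltW e10).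
have H3 := ler_wpM2l M20 Hq.
have P0 : 0 < C * T * K by exact: mulr_gt0 (mulr_gt0 C0 T0) K0.
have E3 : 2 * (C * T) + 2 * (e1 * (2 * (C * T) + 2 * ((2 * M) ^+ 2 * q))) =
  2 * (C * T) + 4 * e1 * (C * T) + 16 * e1 * M ^+ 2 * q by ring.
rewrite E3 => H4; have : c1 * T <= C * T * K by rewrite E2 (le_trans H4)// lerD2l.
by rewrite -E1 mulr_natr mulr2n gerDl leNgt P0.
Qed.

End lower_bound.

(** * Rates *)

Section powR_growth.
Context (R : realType).
Implicit Types (x y p q : R).

Lemma powRK x p : 0 <= x -> 0 < p -> (x `^ p) `^ p^-1 = x.
Proof. by move=> x0 p0; rewrite -powRrM divff ?(gt_eqF p0)// powRr1. Qed.

(** Two-sided comparability covers exponents of either sign; the signs of those in the rates depend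
    on the parameters. *)
Lemma powR_comparable x y q p : 0 < x -> 0 < y -> 1 <= q -> x <= q * y -> y <= q * x ->
  y `^ p <= q `^ `|p| * x `^ p.
Proof.
move=> x0 y0 q1 xy yx; have q0 : 0 < q := lt_le_trans ltr01 q1.
have [p0|p0] := leP 0 p.
  rewrite (ger0_norm p0) -powRM ?(ltW q0) ?(ltW x0)//.
  by apply: ge0_ler_powR; rewrite ?nnegrE ?mulr_ge0 ?(ltW q0) ?(ltW x0) ?(ltW y0).
have pN : 0 <= - p by rewrite oppr_ge0 ltW.
have := powRN1_ge x0 xy pN; rewrite opprK powRM ?(ltW q0) ?(ltW y0)// => H.
have Q0 : 0 <= q `^ - p by exact: powR_ge0.
have := ler_wpM2l Q0 H; rewrite mulrA -powRDp// addNr powRr0 mul1r.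
by rewrite (ltr0_norm p0).
Qed.

Lemma ln_le_powR x t : 0 < t -> 0 < x -> ln x <= x `^ t / t.
Proof.
move=> t0 x0; rewrite ler_pdivlMr// mulrC -ln_powR.
have xt : 0 < x `^ t by exact: powR_gt0.
have : ln (1 + (x `^ t - 1)) <= x `^ t - 1.
  by apply: le_ln1Dx; rewrite -subr_gt0 opprK subrK.
by rewrite addrC subrK => /le_trans; apply; rewrite gerBl.
Qed.

Lemma powR_expR_bounded p c : 0 < c -> exists2 D, 0 < D &
  forall y, 1 <= y -> y `^ p * expR (- c * y) <= D.
Proof.
move=> c0; pose q := `|p| + 1; have q0 : 0 < q by rewrite ltr_wpDl.
pose e := c / q; have e0 : 0 < e by rewrite divr_gt0.
exists (e^-1 `^ `|p|); first by rewrite powR_gt0// invr_gt0.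
move=> y y1; have y0 : 0 < y := lt_le_trans ltr01 y1.
have H1 : y <= e^-1 * expR (e * y).
  rewrite ler_pdivlMl//; apply: le_trans (expR_ge1Dx _).
  by rewrite lerDr.
have H2 : y `^ `|p| <= e^-1 `^ `|p| * expR (e * y * `|p|).
  rewrite expRM -powRM ?expR_ge0 ?invr_ge0 ?(ltW e0)//.
  by apply: ge0_ler_powR; rewrite ?nnegrE ?mulr_ge0 ?expR_ge0 ?invr_ge0 ?(ltW e0) ?(ltW y0).
have H3 : y `^ p <= y `^ `|p| by rewrite ler_powR// ler_norm.
apply: (le_trans (ler_wpM2r (expR_ge0 _) (le_trans H3 H2))).
rewrite -[leLHS]mulrA -expRD ler_piMr ?powR_ge0// -[leRHS]expR0 ler_expR.
have -> : e * y * `|p| + - c * y = - (e * y).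
  by rewrite /e /q; field; rewrite gt_eqF.
by rewrite oppr_le0 mulr_ge0 ?ltW.
Qed.

Lemma near_ln_ge A c : 0 < c -> \forall n \near \oo, A <= ln (n%:R : R) / c.
Proof.
move=> c0; exists (Num.Def.trunc (expR (A * c))).+1 => // n /= Nn.
have H : expR (A * c) <= n%:R.
  by rewrite (le_trans (ltW (truncnS_gt _)))// ler_nat.
by rewrite ler_pdivlMr// -[leLHS]expRK ler_ln ?posrE ?expR_gt0// (lt_le_trans (expR_gt0 _) H).
Qed.

End powR_growth.

Section rates.
Context (R : realType).
Variables (s alpha beta gamma a b d tau : R) (risk : nat -> \bar R).
Hypotheses (hs : 0 <= s) (hbeta : 0 <= beta) (hb : 0 <= b).
Hypothesis hgamma0 : gamma = 0 -> 0 < alpha /\ beta = 0.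
Hypothesis hd0 : d = 0 -> b = 0.
Hypothesis htau0 : gamma = 0 -> tau = 0.
Let E := loss_exponent s alpha b tau.
Let U := U4 s a b.
Hypothesis risk_parametric : exists2 C, 0 < C & forall n, (0 < n)%N -> ((C / n%:R)%:E <= risk n)%E.
Hypothesis risk_frequency : forall D, 0 < D -> exists2 C, 0 < C & exists2 m0, 1 <= m0 &
  forall n m, (0 < n)%N -> m0 <= m ->
    n%:R * (m `^ E * expR (- 2 * gamma * m `^ beta)) <= D ->
    ((C * (m `^ (- U) * expR (- 2 * d * m `^ b)))%:E <= risk n)%E.

Definition achieves (r : nat -> R) := exists2 C, 0 < C & \forall n \near \oo, ((C * r n)%:E <= risk n)%E.

Lemma achieves_parametric : achieves (fun n => n%:R^-1).
Proof.
have [C C0 H] := risk_parametric; exists C => //.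
by exists 1%N => // n /= n0; exact: H.
Qed.

Lemma achieves_frequency (r m : nat -> R) D c : 0 < D -> 0 < c ->
  (forall A, \forall n \near \oo, A <= m n) ->
  (\forall n \near \oo, n%:R * (m n `^ E * expR (- 2 * gamma * m n `^ beta)) <= D) ->
  (\forall n \near \oo, c * r n <= m n `^ (- U) * expR (- 2 * d * m n `^ b)) ->
  achieves r.
Proof.
move=> D0 c0 mA mD mr; have [C C0 [m0 m01 H]] := risk_frequency D0.
exists (C * c); first exact: mulr_gt0.
near=> n; have n0 : (0 < n)%N by near: n; exists 1%N.
have h1 : m0 <= m n by near: n; exact: mA.
have h2 : n%:R * (m n `^ E * expR (- 2 * gamma * m n `^ beta)) <= D by near: n.
have h3 : c * r n <= m n `^ (- U) * expR (- 2 * d * m n `^ b) by near: n.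
apply: le_trans (H n (m n) n0 h1 h2).
by rewrite lee_fin -mulrA ler_wpM2l// ltW.
Unshelve. all: by end_near.
Qed.

(** The frequency is m = v(x)^(1 / beta) with x = log n / (2 gamma). For v(x) = x the product n
    exp(-2 gamma m^beta) would be exactly 1; the freedom in [v] serves to absorb the power of m in
    the chi-square distance. Each rate becomes a statement about [v]. *)
Lemma achieves_log (r : nat -> R) (v : R -> R) D c X0 : 0 < D -> 0 < c -> 0 < gamma -> 0 < beta ->
  1 <= X0 ->
  (forall x, X0 <= x -> x / 2 <= v x) ->
  (forall x, X0 <= x -> expR (2 * gamma * x) * (v x `^ (E / beta) * expR (- 2 * gamma * v x)) <= D) ->
  (forall n x, X0 <= x -> x = ln n%:R / (2 * gamma) -> n%:R = expR (2 * gamma * x) ->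
     c * r n <= v x `^ (- (U / beta)) * expR (- 2 * d * v x `^ (b / beta))) ->
  achieves r.
Proof.
move=> D0 c0 g0 b0 X1 vx vD vr; have g20 : 0 < 2 * gamma by rewrite mulr_gt0.
pose L n : R := ln n%:R / (2 * gamma).
have nL : \forall n \near \oo, X0 <= L n by exact: near_ln_ge.
have en n : (0 < n)%N -> n%:R = expR (2 * gamma * L n).
  by move=> n0; rewrite /L mulrC divfK ?(gt_eqF g20)// lnK// posrE ltr0n.
have pw x p : X0 <= x -> (v x `^ beta^-1) `^ p = v x `^ (p / beta).
  by move=> Xx; rewrite -powRrM mulrC.
have vb x : X0 <= x -> (v x `^ beta^-1) `^ beta = v x.
  move=> Xx; rewrite pw// divff ?(gt_eqF b0)// powRr1//.
  by apply: le_trans (vx _ Xx); rewrite divr_ge0// (le_trans _ Xx)// (le_trans ler01).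
apply: (@achieves_frequency r (fun n => v (L n) `^ beta^-1) D c) => //.
- move=> A; pose A' := Num.max 0 A.
  near=> n; have LA : 2 * A' `^ beta <= L n by near: n; exact: near_ln_ge.
  have Xn : X0 <= L n by near: n.
  apply: (@le_trans _ _ A'); first by rewrite le_max lexx orbT.
  have A0 : 0 <= A' by rewrite le_max lexx.
  rewrite -[leLHS](powRK A0 b0).
  have H : A' `^ beta <= v (L n) by apply: le_trans (vx _ Xn); rewrite ler_pdivlMr// mulrC.
  by apply: ge0_ler_powR; rewrite ?nnegrE ?invr_ge0 ?(ltW b0) ?powR_ge0 ?(le_trans (powR_ge0 _ _) H).
- near=> n; have n0 : (0 < n)%N by near: n; exists 1%N.
  have Xn : X0 <= L n by near: n.
  by rewrite vb// pw// (en _ n0); exact: vD.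
- near=> n; have n0 : (0 < n)%N by near: n; exists 1%N.
  have Xn : X0 <= L n by near: n.
  by rewrite !pw// (mulNr U); apply: vr => //; exact: en.
Unshelve. all: by end_near.
Qed.

Lemma achieves_polynomial : d = gamma -> gamma = 0 ->
  achieves (fun n => n%:R `^ (- ((2 * s + 2 * a - 1) / (2 * s + 2 * alpha)))).
Proof.
move=> dg g0; have [al0 be0] := hgamma0 g0; have t0 := htau0 g0.
have b0 : b = 0 by apply: hd0; rewrite dg.
pose p := 2 * s + 2 * alpha; have p0 : 0 < p.
  by rewrite ltr_wpDl ?mulr_ge0// mulr_gt0.
have EE : E = - p.
  rewrite /E /loss_exponent /kappa t0 b0 sub0r max_l; last by rewrite oppr_le0.
  by rewrite /p; ring.
have UE : U = 2 * s + 2 * a - 1 by rewrite /U /U4 b0; ring.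
(* Here b = tau = 0, hence kappa = 0 and E = - p, so that n m^E = 1 for m = n^(1 / p). *)
apply: (@achieves_frequency _ (fun n => n%:R `^ p^-1) 1 1) => //.
- move=> A; pose A' := Num.max 0 A; have A0 : 0 <= A' by rewrite le_max lexx.
  exists (Num.Def.trunc (A' `^ p)).+1 => // n /= Nn.
  have H : A' `^ p <= n%:R by rewrite (le_trans (ltW (truncnS_gt _)))// ler_nat.
  apply: (@le_trans _ _ A'); first by rewrite le_max lexx orbT.
  rewrite -[leLHS](powRK A0 p0).
  by apply: ge0_ler_powR; rewrite ?nnegrE ?invr_ge0 ?(ltW p0) ?powR_ge0.
- exists 1%N => // n /= n0; have nR : 0 < n%:R :> R by rewrite ltr0n.
  rewrite g0 mulr0 mul0r expR0 mulr1 EE -powRrM mulrN mulVf ?(gt_eqF p0)//.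
  by rewrite powRN powRr1 ?(ltW nR)// mulfV ?gt_eqF.
- exists 1%N => // n /= n0; rewrite mul1r dg g0 mulr0 mul0r expR0 mulr1 -powRrM UE.
  by rewrite mulrN mulrC.
Qed.

(** As d = 0, the gap is a power of m, and doubling m^beta costs a constant factor only. With v = 2
    x a surplus exp(-2 gamma x) remains, which absorbs any power of x. *)
Lemma achieves_logarithmic : b = 0 -> d = 0 -> 0 < beta -> 0 < gamma ->
  achieves (fun n => ln n%:R `^ (- ((2 * s + 2 * a - 1) / beta))).
Proof.
move=> b0 d0 be0 g0; have g20 : 0 < 2 * gamma by rewrite mulr_gt0.
have UE : U = 2 * s + 2 * a - 1 by rewrite /U /U4 b0; ring.
have [D D0 HD] := powR_expR_bounded (E / beta) g0.
set p := - (_ / beta).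
apply: (@achieves_log _ (fun x => 2 * x) D (gamma^-1 `^ p) 1) => //.
- by rewrite powR_gt0// invr_gt0.
- by move=> x x1; lra.
- move=> x x1; rewrite mulrCA -expRD.
  have -> : 2 * gamma * x + - 2 * gamma * (2 * x) = - gamma * (2 * x) by ring.
  by apply: HD; lra.
- move=> n x x1 xE nE; rewrite d0 mulr0 mul0r expR0 mulr1 UE -/p.
  have -> : 2 * x = gamma^-1 * ln n%:R by rewrite xE; field; rewrite gt_eqF.
  have l0 : 0 <= ln (n%:R : R).
    by rewrite -[leRHS](divfK (lt0r_neq0 g20)) -xE mulr_ge0 ?(ltW g20)// (le_trans ler01).
  by rewrite powRM ?invr_ge0 ?(ltW g0).
Qed.

(** The correction K log x added to x gains the factor x^(-p), enough against v^(E / beta); the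
    absolute value in [p] keeps v above x. As b < beta, the correction moves x^(b / beta) by a
    bounded amount, and the gap changes by a constant factor. *)
Lemma achieves_lower_exponential : b < beta -> 0 < d -> 0 < gamma ->
  achieves (fun n => ln n%:R `^ (- (U4 s a b / beta)) *
     expR (- 2 * d * (ln n%:R / (2 * gamma)) `^ (b / beta))).
Proof.
move=> bb d0 g0; have be0 : 0 < beta := le_lt_trans hb bb.
have g20 : 0 < 2 * gamma by rewrite mulr_gt0.
pose p := `|E / beta|; pose K := p / (2 * gamma); pose th := b / beta.
have K0 : 0 <= K by apply: divr_ge0; [exact: normr_ge0|exact: ltW].
have th0 : 0 <= th by rewrite divr_ge0.
have th1 : 0 < 1 - th by rewrite subr_gt0 ltr_pdivrMr// mul1r.
have K1 : 1 <= 1 + K by rewrite lerDl.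
set u := - (U4 s a b / beta).
have vb x : 1 <= x -> [/\ 0 < x, 0 <= ln x, x <= x + K * ln x & x + K * ln x <= (1 + K) * x].
  move=> x1; have x0 : 0 < x := lt_le_trans ltr01 x1; have l0 := ln_ge0 x1.
  split=> //; first by rewrite lerDl mulr_ge0.
  rewrite mulrDl mul1r lerD2l ler_wpM2l//.
  by have := ln_le_powR ltr01 x0; rewrite powRr1 ?(ltW x0)// divr1.
apply: (@achieves_log _ (fun x => x + K * ln x) ((1 + K) `^ p)
  (((1 + K) `^ `|u|)^-1 * (2 * gamma)^-1 `^ u * expR (- 2 * d * (K / (1 - th)))) 1) => //.
- by rewrite powR_gt0// (lt_le_trans ltr01).
- by rewrite !mulr_gt0 ?expR_gt0 ?powR_gt0 ?invr_gt0 ?powR_gt0// (lt_le_trans ltr01).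
- by move=> x /vb[x0 _ xv _]; lra.
- move=> x x1; have [x0 l0 xv vx] := vb x x1; have v0 := lt_le_trans x0 xv.
  have v1 := le_trans x1 xv.
  rewrite mulrCA -expRD.
  have -> : 2 * gamma * x + - 2 * gamma * (x + K * ln x) = - p * ln x.
    by rewrite /K; field; rewrite gt_eqF.
  have -> : expR (- p * ln x) = x `^ (- p) by rewrite /powR (gt_eqF x0).
  apply: (@le_trans _ _ (((1 + K) * x) `^ p * x `^ (- p))); last first.
    rewrite powRM ?(ltW x0) ?(le_trans ler01)// -mulrA -powRDp// subrr powRr0 mulr1.
    exact: lexx.
  rewrite ler_wpM2r ?powR_ge0//; apply: (@le_trans _ _ ((x + K * ln x) `^ p)).
    by rewrite ler_powR// ler_norm.
  apply: ge0_ler_powR; rewrite ?nnegrE ?(ltW v0)//; first exact: normr_ge0.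
  by rewrite mulr_ge0 ?(ltW x0)// (le_trans ler01).
- move=> n x x1 xE nE; have [x0 l0 xv vx] := vb x x1; have v0 := lt_le_trans x0 xv.
  rewrite -xE -/th -/u.
  have -> : ln n%:R = 2 * gamma * x by rewrite xE mulrC divfK// gt_eqF.
  set v := x + K * ln x in xv vx v0 *.
  have k0 : 0 < 1 + K := lt_le_trans ltr01 K1.
  have Q0 : 0 < (1 + K) `^ `|u| by exact: powR_gt0.
  have A1 : ((1 + K) `^ `|u|)^-1 * x `^ u <= v `^ u.
    rewrite ler_pdivrMl//; apply: powR_comparable => //.
    by rewrite (le_trans xv)// ler_peMl// ltW.
  (* From (1 + q)^th <= 1 + q with q = K log x / x, the increase is at most K x^(th - 1) log x; then
     log x <= x^(1 - th) / (1 - th). *)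
  have A2 : v `^ th <= x `^ th + K / (1 - th).
    have -> : v = x * (1 + K * ln x / x) by rewrite /v; field; rewrite gt_eqF.
    have q0 : 0 <= K * ln x / x by apply: divr_ge0; [exact: mulr_ge0|exact: ltW].
    rewrite powRM ?(ltW x0) ?addr_ge0//.
    have H1 : (1 + K * ln x / x) `^ th <= 1 + K * ln x / x.
      rewrite -[leRHS]powRr1 ?addr_ge0// ler_powR ?lerDl//.
      by rewrite -subr_ge0 ltW.
    have X0 : 0 <= x `^ th by exact: powR_ge0.
    apply: (le_trans (ler_wpM2l X0 H1)); rewrite mulrDr mulr1 lerD2l.
    have H2 := ler_wpM2l K0 (ln_le_powR th1 x0).
    have Y0 : 0 <= x `^ th / x by apply: divr_ge0; [|exact: ltW].
    have := ler_wpM2l Y0 H2.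
    have -> : x `^ th / x * (K * (x `^ (1 - th) / (1 - th))) = K / (1 - th) * (x `^ th * x `^ (1 - th) / x).
      by move: (1 - th) th1 => t t0; field; rewrite !gt_eqF.
    rewrite -powRDp// (addrC th) subrK powRr1 ?(ltW x0)// divff ?gt_eqF// mulr1.
    by apply: le_trans; rewrite le_eqVlt; apply/orP; left; apply/eqP; ring.
  rewrite powRM ?(ltW g20) ?(ltW x0)//.
  have G : (2 * gamma)^-1 `^ u * (2 * gamma) `^ u = 1.
    by rewrite -powRM ?invr_ge0 ?(ltW g20)// mulVf ?gt_eqF// powR1.
  have -> : ((1 + K) `^ `|u|)^-1 * (2 * gamma)^-1 `^ u * expR (- 2 * d * (K / (1 - th))) *
      ((2 * gamma) `^ u * x `^ u * expR (- 2 * d * x `^ th)) =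
      ((2 * gamma)^-1 `^ u * (2 * gamma) `^ u) * ((((1 + K) `^ `|u|)^-1 * x `^ u) *
       (expR (- 2 * d * x `^ th) * expR (- 2 * d * (K / (1 - th))))) by ring.
  rewrite G mul1r -expRD -mulrDr; apply: ler_pM => //.
  + by rewrite mulr_ge0 ?powR_ge0 ?invr_ge0 ?(ltW Q0).
  + by rewrite ler_expR !mulNr lerN2 ler_wpM2l ?mulr_ge0 ?(ltW d0).
Qed.

(** With b = beta the gap contains exp(-2 d v), so every correction of x is visible in the rate. [K]
    is therefore signed and cancels the power of m in the distance up to constants; the factor
    exp(-2 d K log x) is the origin of the terms of U3 that carry d / gamma. *)
Lemma achieves_equal_exponential : b = beta -> 0 < beta -> d <= gamma -> 0 < d ->
  achieves (fun n => ln n%:R `^ (- (U3 s alpha beta gamma a d tau / beta)) *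
     n%:R `^ (- (d / gamma))).
Proof.
move=> bb be0 dg d0; have g0 : 0 < gamma := lt_le_trans d0 dg.
have g20 : 0 < 2 * gamma by rewrite mulr_gt0.
pose K := E / (2 * gamma * beta).
have UE : U3 s alpha beta gamma a d tau = U + E * d / gamma.
  (* The minimum in [U_tau] is the maximum in [kappa], seen through the 7 beta of the amplitude. *)
  have Ek : U_tau beta tau + 1 = 7 * beta - 2 * kappa b tau.
    rewrite /U_tau /kappa bb; have [H1|H1] := leP tau (beta - 1).
      by rewrite min_r; [ring|lra].
    by rewrite min_l; [ring|lra].
  rewrite /U3 Ek /U /U4 /E /loss_exponent bb; field; exact: lt0r_neq0.
(* Beyond it, 4 |K| <= x^(1/2), and log x <= 2 x^(1/2) gives |K log x| <= x / 2, so that v stays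
   comparable to x for either sign of [K]. *)
pose X0 := Num.max 1 (16 * K ^+ 2).
have vb x : X0 <= x -> [/\ 0 < x, x <= 2 * (x + K * ln x) & x + K * ln x <= 2 * x].
  rewrite ge_max => /andP[x1 xK]; have x0 : 0 < x := lt_le_trans ltr01 x1.
  have l0 := ln_ge0 x1.
  have h2 : (0 : R) < 2^-1 by rewrite invr_gt0.
  have := ln_le_powR h2 x0; rewrite invrK => lx.
  set q := x `^ 2^-1 in lx; have q0 : 0 <= q by exact: powR_ge0.
  have qq : q ^+ 2 = x by rewrite powR_sqr mulfV// powRr1// ltW.
  have Kq : 4 * `|K| <= q.
    rewrite -(ler_pXn2r (n := 2)) ?nnegrE ?mulr_ge0// qq exprMn real_normK ?num_real//.
    by apply: le_trans xK; rewrite ler_wpM2r ?sqr_ge0//; lra.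
  have Kl : `|K * ln x| <= x / 2.
    rewrite normrM (ger0_norm l0); have := ler_wpM2l (normr_ge0 K) lx.
    by have := ler_wpM2r q0 Kq; rewrite -expr2 qq; lra.
  by move: Kl; rewrite ler_norml => /andP[? ?]; split => //; lra.
have X1 : 1 <= X0 by rewrite le_max lexx.
set u := - (U3 s alpha beta gamma a d tau / beta).
pose w := - (U / beta).
have := @achieves_log (fun n => ln n%:R `^ u * n%:R `^ (- (d / gamma))) (fun x => x + K * ln x) ((2 : R) `^ `|E / beta|)
  (((2 : R) `^ `|w|)^-1 * (2 * gamma)^-1 `^ u) X0; apply => //.
- by rewrite !mulr_gt0 ?powR_gt0 ?invr_gt0 ?powR_gt0.
- by move=> x /vb[x0 xv _]; lra.
- move=> x /vb[x0 xv vx]; have v0 : 0 < x + K * ln x by lra.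
  rewrite mulrCA -expRD.
  have -> : 2 * gamma * x + - 2 * gamma * (x + K * ln x) = - (E / beta) * ln x.
    by rewrite /K; field; rewrite !gt_eqF.
  have -> : expR (- (E / beta) * ln x) = x `^ (- (E / beta)) by rewrite /powR (gt_eqF x0).
  have H := powR_comparable (E / beta) x0 v0 (ler1n R 2) xv vx.
  apply: (le_trans (ler_wpM2r (powR_ge0 _ _) H)).
  by rewrite -mulrA -powRDp// subrr powRr0 mulr1.
- move=> n x Xx xE nE; have [x0 xv vx] := vb x Xx; have v0 : 0 < x + K * ln x by lra.
  have -> : ln n%:R = 2 * gamma * x by rewrite xE mulrC divfK// gt_eqF.
  rewrite bb divff ?(gt_eqF be0)// (powRr1 (ltW v0)) -/w nE -expRM.
  have -> : 2 * gamma * x * - (d / gamma) = - 2 * d * x by field; rewrite gt_eqF.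
  have A1 : (2 `^ `|w|)^-1 * x `^ w <= (x + K * ln x) `^ w.
    by rewrite ler_pdivrMl ?powR_gt0//; exact: (powR_comparable w v0 x0 (ler1n R 2) vx xv).
  rewrite powRM ?(ltW g20) ?(ltW x0)//.
  have G : (2 * gamma)^-1 `^ u * (2 * gamma) `^ u = 1.
    by rewrite -powRM ?invr_ge0 ?(ltW g20)// mulVf ?gt_eqF// powR1.
  have -> : (2 `^ `|w|)^-1 * (2 * gamma)^-1 `^ u * ((2 * gamma) `^ u * x `^ u * expR (- 2 * d * x)) =
    ((2 * gamma)^-1 `^ u * (2 * gamma) `^ u) * ((2 `^ `|w|)^-1 * x `^ u * expR (- 2 * d * x)) by ring.
  rewrite G mul1r.
  have -> : x `^ u = x `^ w * expR (- 2 * d * (K * ln x)).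
    have -> : expR (- 2 * d * (K * ln x)) = x `^ (- 2 * d * K) by rewrite /powR (gt_eqF x0) mulrA.
    rewrite -powRDp//; congr powR; rewrite /u /w UE /K; field; by rewrite !lt0r_neq0.
  rewrite mulrA -[leLHS]mulrA -expRD -mulrDr (addrC _ x).
  by rewrite ler_wpM2r ?expR_ge0.
Qed.

Lemma achieves_rate r : rate s alpha beta gamma a b d tau r -> achieves r.
Proof.
case.
- by move=> _; exact: achieves_parametric.
- by move=> _; exact: achieves_parametric.
- by move=> _; exact: achieves_parametric.
- by move=> [dg g0 _]; exact: achieves_polynomial.
- by move=> [? ? ? ?]; exact: achieves_equal_exponential.
- by move=> [? ? ?]; exact: achieves_lower_exponential.
- by move=> [? ? ? ?]; exact: achieves_logarithmic.
Qed.

End rates.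

Theorem corollary2 (R : realType) (s B : R) (phi g : R -> R)
    (phis : R -> R[i])
    (Cg2 Cphi1 Cg alpha beta gamma a b d tau w0 : R)
    (hs : 0 <= s) (hB : 0 < B)
    (hphi : measurable_fun setT phi)
    (hphib : exists M : R, forall x, `|phi x| <= M)
    (hphis : is_fourier phi phis)
    (hparseval : forall f, sobolev_pdf s B f -> parseval phi phis f)
    (hg : is_pdf g)
    (hgb : exists M : R, forall x, g x <= M)
    (hCg2 : 0 < Cg2) (hCphi1 : 0 < Cphi1)
    (halpha : 0 <= alpha) (hbeta : 0 <= beta) (hgamma : 0 <= gamma)
    (ha : 0 <= a) (hb : 0 <= b) (hd : 0 <= d)
    (hgamma0 : gamma = 0 -> 0 < alpha /\ beta = 0)
    (hd0 : d = 0 -> b = 0)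
    (hgs : forall w, cmod (fourier g w) <=
       Cg2 * (w ^+ 2 + 1) `^ (- (alpha / 2)) * expR (- gamma * `|w| `^ beta))
    (hphilow : forall w,
       Cphi1 * (w ^+ 2 + 1) `^ (- (a / 2)) * expR (- d * `|w| `^ b)
       <= cmod (phis w))
    (hgs' : forall w, cderivable (fourier g) w)
    (hCg : 0 < Cg) (htau : 0 <= tau) (htau0 : gamma = 0 -> tau = 0)
    (hgs0 : forall w, fourier g w != 0)
    (hgratio : forall w,
       cmod (cderive (fourier g) w) / cmod (fourier g w)
       <= Cg * (1 + `|w|) `^ tau)
    (hw0 : 0 < w0)
    (harg : exists (rho : R -> R) (M : R), bounded_C2_arg phis w0 rho M) :
  forall r : nat -> R, rate s alpha beta gamma a b d tau r ->
  exists2 C : R, 0 < C &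
    \forall n \near \oo,
      ((C * r n)%:E <= minimax_risk n (sobolev_pdf s B) phi g)%E.
Proof.
move=> r hr.
apply: (achieves_rate (risk := fun n => minimax_risk n (sobolev_pdf s B) phi g)
  hs hbeta hb hgamma0 hd0 htau0 _ _ hr).
- exact: (minimax_parametric hs hB hphi hphib hphis hg hgb hCphi1 hphilow).
- move=> D D0.
  exact: (minimax_frequency hs hB hphi hphib hphis hparseval hg hgb hCg2 hCphi1
    halpha hbeta hgamma ha hb hd hgs hphilow hgs' hCg htau hgs0 hgratio hw0 harg D0).
Qed.
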